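(* The operator $\mathcal{L}$ is the infinitesimal generator of an analytic semigroup $\{e^{t\mathcal{L}}\}_{t\ge0}$ in $L^2(\mathbb{R})$, and its resolvent set $\rho(\mathcal{L})$ contains the sector $|\arg(\lambda-\eta_0)|<\pi/2+\delta$ for some $\delta>0$. Moreover, the semigroup is determined explicitly by Dunford's integral formula $$e^{t\mathcal{L}}=\frac{1}{2\pi i}\int_\Gamma e^{\lambda t}(\lambda I-\mathcal{L})^{-1}\,d\lambda,$$ where $\Gamma$ is any rectifiable curve in the complex plane from $\infty\cdot e^{-i\theta}$ to $\infty\cdot e^{i\theta}$ such that $\Gamma$ lies entirely in the set $\{|\arg(\lambda-\eta_0)|<\theta\}$, and $\theta$ is any angle satisfying $\pi/2<\theta<\pi/2+\delta$.
   Context: Standing assumptions: $D\in C^2([0,1];\mathbb{R})$, $D(0)=0$, $D(u)>0$ for all $u\in(0,1]$, $D'(u)>0$ for all $u\in[0,1]$; $f\in C^2([0,1];\mathbb{R})$ and there is $\alpha\in(0,1)$ with $f(0)=f(\alpha)=f(1)=0$, $f'(0)<0$, $f'(1)<0$, $f'(\alpha)>0$, $f>0$ on $(\alpha,1)$, $f<0$ on $(0,\alpha)$; and $\int_0^1D(u)f(u)\,du=0$. $\varphi$ is the stationary degenerate Nagumo front (unique up to translation): a continuous non-increasing function $\varphi:\mathbb{R}\to[0,1]$ with $\varphi(-\infty)=1$, $\varphi(+\infty)=0$, solving $(D(\varphi)\varphi_x)_x+f(\varphi)=0$ on $\mathbb{R}$, in the sense that $x\mapsto\int_0^{\varphi(x)}D(s)\,ds$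 is of class $C^2(\mathbb{R})$ with second derivative equal to $-f(\varphi)$. $\mathcal{L}:\mathcal{D}(\mathcal{L})\subset L^2(\mathbb{R})\to L^2(\mathbb{R})$ is $\mathcal{L}u=(D(\varphi)u)_{xx}+f'(\varphi)u$, with $\mathcal{D}(\mathcal{L})=\{u\in L^2(\mathbb{R}): D(\varphi)u\in H^2(\mathbb{R})\}$ (complex-valued functions). $\eta_0>0$ denotes a fixed constant (such a constant exists) such that $\{\lambda\in\mathbb{C}:\operatorname{Re}\lambda>\eta_0\}\subset\rho(\mathcal{L})$ and $\|(\lambda-\mathcal{L})^{-1}\|_{L^2\to L^2}\le 2/|\lambda-\eta_0|$ for all $\operatorname{Re}\lambda>\eta_0$. *)

(* Defs.v *)
From HB Require Import structures.
From mathcomp Require Import all_boot all_order all_algebra complex.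
From mathcomp Require Import all_classical all_reals all_analysis measurable_realfun.

Set Implicit Arguments.
Unset Strict Implicit.
Unset Printing Implicit Defensive.

Import Order.TTheory GRing.Theory Num.Theory numFieldNormedType.Exports.

Local Open Scope classical_set_scope.
Local Open Scope ring_scope.

Notation Re := (@complex.Re _).
Notation Im := (@complex.Im _).
Notation normc := (@Normc.normc _).

HB.instance Definition _ (R : realType) := NormedModule.copy R[i] R[i]^o.


Section L2.
Variable R : realType.
Local Notation mu := (@lebesgue_measure R).
Implicit Types (f g : R -> R[i]) (a : R[i]).

(* Square integrability of [f], through its real and imaginary parts. *)
Definition sqint : {pred R -> R[i]} :=
  [pred f : R -> R[i] | (Re \o f \in Lfun mu 2%:E) && (Im \o f \in Lfun mu 2%:E)].

Definition norm2 f : R := fine 'N[mu]_2%:E[EFin \o (normc \o f)]%E.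

Lemma le1_2 : (1 <= 2%:E :> \bar R)%E. Proof. by rewrite lee_fin ler1n. Qed.

Lemma LfunZD (a b : R) (u v w : R -> R) : u \in Lfun mu 2%:E ->
  v \in Lfun mu 2%:E -> w \in Lfun mu 2%:E ->
  (fun x => a * u x + b * v x + w x) \in Lfun mu 2%:E.
Proof.
have [_ H] := Lfun_submod_closed mu le1_2.
move=> hu hv hw; rewrite (_ : (fun x => _) = a *: u + (b *: v + w)).
  by apply: (H) => //; apply: (H).
by apply/funext => x; rewrite addrA.
Qed.

Fact sqint_submod_closed : submod_closed sqint.
Proof.
have [H0 _] := Lfun_submod_closed mu le1_2.
split; first by rewrite inE/=; apply/andP; split; exact: H0.
move=> a f g /andP[fr fi] /andP[gr gi]; rewrite inE/=; apply/andP; split.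
  rewrite (_ : _ \o _ = (fun x => Re a * (Re \o f) x + (- Im a) * (Im \o f) x +
                                 (Re \o g) x)); first exact: LfunZD.
  apply/funext => x /=.
  have -> : (a *: f + g) x = a * f x + g x by [].
  by case: (a) (f x) (g x) => [? ?] [? ?] [? ?] /=; rewrite mulNr.
rewrite (_ : _ \o _ = (fun x => Re a * (Im \o f) x + (Im a) * (Re \o f) x +
                                 (Im \o g) x)); first exact: LfunZD.
apply/funext => x /=.
have -> : (a *: f + g) x = a * f x + g x by [].
by case: (a) (f x) (g x) => [? ?] [? ?] [? ?].
Qed.

HB.instance Definition _ := GRing.isSubmodClosed.Build R[i] (R -> R[i]) sqint
  sqint_submod_closed.

Record sqfun := Sqfun { sqfun_val :> R -> R[i]; _ : sqfun_val \in sqint }.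
HB.instance Definition _ := [isSub for sqfun_val].
HB.instance Definition _ := [Choice of sqfun by <:].
HB.instance Definition _ := [SubChoice_isSubLmodule of sqfun by <:].

Implicit Types u v : sqfun.

Definition ae_null : {pred sqfun} := [pred u : sqfun | `[< {ae mu, forall x, u x = 0} >]].

Fact null_submod_closed : submod_closed ae_null.
Proof.
split; first by apply/asboolP; exact: aeW.
move=> a u v /asboolP hu /asboolP hv; apply/asboolP.
apply: (@filterS2 _ _ (ae_filter_ringOfSetsType mu) _ _ _ _ hu hv) => x ux vx.
by rewrite -[LHS]/(a * u x + v x) ux vx mulr0 addr0.
Qed.

HB.instance Definition _ := GRing.isSubmodClosed.Build R[i] sqfun ae_null
  null_submod_closed.


Lemma Lfun_meas (h : R -> R) : h \in Lfun mu 2%:E -> measurable_fun setT h.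
Proof. by move=> /andP[]; rewrite inE. Qed.

Lemma Lfun_fin (h : R -> R) : h \in Lfun mu 2%:E -> ('N[mu]_2%:E[EFin \o h] < +oo)%E.
Proof. by move=> /andP[_]; rewrite inE. Qed.

Lemma normcE (z : R[i]) : normc z = Num.sqrt (Re z ^+ 2 + Im z ^+ 2).
Proof. by case: z. Qed.

Lemma measurable_normc f : f \in sqint -> measurable_fun setT (normc \o f).
Proof.
move=> /andP[/Lfun_meas mr /Lfun_meas mi].
have -> : normc \o f = (fun x => ((Re \o f) x ^+ 2 + (Im \o f) x ^+ 2) `^ 2^-1).
  by apply/funext => x; rewrite /= normcE powR12_sqrt// addr_ge0// sqr_ge0.
apply: (measurableT_comp (measurable_powR _)).
by apply: measurable_funD; apply: measurable_funX.
Qed.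

Lemma normc_ge0 (z : R[i]) : 0 <= normc z.
Proof. by case: z => *; exact: sqrtr_ge0. Qed.

Lemma le_Lnorm2 (h k : R -> R) : measurable_fun setT h -> measurable_fun setT k ->
  (forall x, 0 <= h x <= k x) ->
  ('N[mu]_2%:E[EFin \o h] <= 'N[mu]_2%:E[EFin \o k])%E.
Proof.
move=> mh mk hk; rewrite unlock /=.
have m (l : R -> R) : measurable_fun setT l ->
    measurable_fun setT (fun x => (`|l x| `^ 2)%:E).
  move=> ml; apply/measurable_EFinP; apply: (measurableT_comp (measurable_powR _)).
  exact: measurableT_comp.
have pow0 (l : R -> R) x : (0 <= (`|l x| `^ 2)%:E)%E by rewrite lee_fin powR_ge0.
apply: gt0_ler_poweR; rewrite ?invr_ge0// ?in_itv/= ?leey ?andbT.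
- exact: integral_ge0.
- exact: integral_ge0.
- apply: ge0_le_integral => //; [exact: m|exact: m|].
  move=> x _; have /andP[h0 hkx] := hk x.
  rewrite lee_fin ge0_ler_powR ?nnegrE//.
  by rewrite !ger0_norm// (le_trans h0).
Qed.

Lemma normc_Lfun f : f \in sqint -> normc \o f \in Lfun mu 2%:E.
Proof.
move=> fL; have mf := measurable_normc fL; move/andP: fL => [fr fi].
apply/andP; split; rewrite inE//=.
have nL (h : R -> R) : h \in Lfun mu 2%:E ->
    measurable_fun setT (Num.norm \o h) /\
    ('N[mu]_2%:E[EFin \o (Num.norm \o h)] < +oo)%E.
  move=> hL; split; first by apply: measurableT_comp => //; exact: Lfun_meas.
  have <- : 'N[mu]_2%:E[EFin \o h]%E = 'N[mu]_2%:E[EFin \o (Num.norm \o h)]%E.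
    by rewrite -Lnorm_abse.
  exact: Lfun_fin.
have [mr lr] := nL _ fr; have [mi li] := nL _ fi.
have mD : measurable_fun setT ((Num.norm \o (Re \o f)) \+ (Num.norm \o (Im \o f))).
  exact: measurable_funD.
have le_f x : 0 <= (normc \o f) x <=
    ((Num.norm \o (Re \o f)) \+ (Num.norm \o (Im \o f))) x.
  rewrite normc_ge0 /= normcE.
  rewrite -[leRHS]ger0_norm ?addr_ge0// -sqrtr_sqr ler_wsqrtr//.
  by rewrite sqrrD !real_normK ?num_real// addrAC lerDl mulrn_wge0// mulr_ge0.
have le12 : (1 : R) <= 2 by rewrite ler1n.
have := le_trans (le_Lnorm2 mf mD le_f) (minkowski_EFin mu mr mi le12).
by move=> /le_lt_trans; apply; exact: lte_add_pinfty.
Qed.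

Lemma norm2E f : f \in sqint -> (norm2 f)%:E = 'N[mu]_2%:E[EFin \o (normc \o f)]%E.
Proof.
move=> fL; rewrite fineK// ge0_fin_numE ?Lnorm_ge0//.
by have /andP[_] := normc_Lfun fL; rewrite inE.
Qed.

Fact norm2D f g : f \in sqint -> g \in sqint ->
  norm2 (f + g) <= norm2 f + norm2 g.
Proof.
move=> fL gL; have fgL : f + g \in sqint by exact: rpredD.
rewrite -lee_fin EFinD !norm2E//.
have mf := measurable_normc fL; have mg := measurable_normc gL.
have mD : measurable_fun setT ((normc \o f) \+ (normc \o g)).
  exact: measurable_funD.
have le_fg x : 0 <= (normc \o (f + g)) x <= ((normc \o f) \+ (normc \o g)) x.
  by rewrite normc_ge0/=; exact: (@le_normcD R (f x) (g x)).
have le12 : (1 : R) <= 2 by rewrite ler1n.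
exact: le_trans (le_Lnorm2 (measurable_normc fgL) mD le_fg)
  (minkowski_EFin mu mf mg le12).
Qed.

Fact norm2Z a f : f \in sqint -> norm2 (a *: f) = normc a * norm2 f.
Proof.
move=> fL; have afL : a *: f \in sqint by exact: rpredZ.
apply: EFin_inj; rewrite EFinM !norm2E//.
have := LnormZ (Lfun_Sub le1_2 (normc_Lfun fL)) (normc a).
rewrite Lfun_valP ger0_norm ?normc_ge0// => <-; congr Lnorm.
by apply/funext => x /=; rewrite Normc.normcM.
Qed.

Fact norm2_eq0 (u : sqfun) : norm2 u = 0 <-> u \in ae_null.
Proof.
have uL : (u : R -> R[i]) \in sqint by case: u.
have mu0 := measurable_normc uL.
split => [u0|/asboolP u0]; last first.
  apply: EFin_inj; rewrite norm2E//.
  transitivity ('N[mu]_2%:E[cst 0])%E; last by rewrite Lnorm0// gt_eqF// lte_fin.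
  rewrite unlock; congr (_ `^ _)%E.
  apply: ge0_ae_eq_integral => //.
  - apply: (measurableT_comp (measurable_poweR _)).
    by apply: measurableT_comp => //; exact/measurable_EFinP.
  - by move=> x _; exact: poweR_ge0.
  - by move=> x _; exact: poweR_ge0.
  - apply: (@filterS _ _ (ae_filter_ringOfSetsType mu) _ _ _ u0) => x /= ux _.
    by rewrite ux Normc.normc0.
have H : 'N[mu]_2%:E[EFin \o (normc \o u)]%E = 0 by rewrite -norm2E// u0.
apply/asboolP.
have me : measurable_fun setT (EFin \o (normc \o u)) by exact/measurable_EFinP.
have lt02 : (0%R < 2%:E :> \bar R)%E by rewrite lte_fin.
have := Lnorm_eq0_eq0 (T := measurableTypeR R) me lt02 H.
apply: (@filterS _ _ (ae_filter_ringOfSetsType mu)) => x /(_ I)[].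
exact: Normc.eq0_normc.
Qed.

(* The normed space L^2(R; C): square integrable functions modulo equality
   almost everywhere. *)
Definition L2 := Quotient.quot (ae_null : zmodClosed sqfun).
HB.instance Definition _ := GRing.Zmodule.on L2.
HB.instance Definition _ := EqQuotient.on L2.

Local Open Scope quotient_scope.

Definition L2_scale a (u : L2) : L2 := \pi_L2 (a *: repr u).

Lemma eq_piP u v : \pi_L2 u = \pi_L2 v <-> u - v \in ae_null.
Proof. by rewrite Quotient.idealrBE; split=> [->|/eqP]. Qed.

Lemma pi_scale a u : L2_scale a (\pi_L2 u) = \pi_L2 (a *: u).
Proof.
by apply/eq_piP; rewrite -scalerBr rpredZ//; apply/eq_piP; rewrite reprK.
Qed.

Lemma piD u v : \pi_L2 (u + v) = \pi_L2 u + \pi_L2 v.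
Proof. by rewrite !piE. Qed.

Fact L2_scalerA a b (w : L2) : L2_scale a (L2_scale b w) = L2_scale (a * b) w.
Proof.
elim/quotW: w => w.
by rewrite (pi_scale b) (pi_scale a) (pi_scale (a * b)) scalerA.
Qed.

Fact L2_scale1r : left_id 1 L2_scale.
Proof. by elim/quotW => w; rewrite pi_scale scale1r. Qed.

Fact L2_scalerDr : right_distributive L2_scale +%R.
Proof.
move=> a; elim/quotW => u; elim/quotW => v.
by rewrite -piD 3!pi_scale scalerDr piD.
Qed.

Fact L2_scalerDl (w : L2) : {morph L2_scale^~ w : a b / a + b}.
Proof. by elim/quotW: w => w a b; rewrite 3!pi_scale scalerDl piD. Qed.

HB.instance Definition _ := GRing.Zmodule_isLmodule.Build R[i] L2
  L2_scalerA L2_scale1r L2_scalerDr L2_scalerDl.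

(* A norm over R[i] is R[i]-valued. *)
Definition L2_norm (u : L2) : R[i] := (norm2 (repr u))%:C%C.

Lemma sqfunP u : (u : R -> R[i]) \in sqint. Proof. by case: u. Qed.

Lemma norm2_null u v : u - v \in ae_null -> norm2 u <= norm2 v.
Proof.
move=> /norm2_eq0 uv.
have -> : (u : R -> R[i]) = ((u - v)%R : sqfun) + (v : R -> R[i]).
  by rewrite -[RHS]/(sqfun_val (u - v + v)) subrK.
by rewrite (le_trans (norm2D _ _)) ?sqfunP// uv add0r.
Qed.

Lemma norm_pi u : L2_norm (\pi_L2 u) = (norm2 u)%:C%C.
Proof.
congr (_%:C)%C; apply/eqP; rewrite eq_le; apply/andP; split; apply: norm2_null.
  by apply/eq_piP; rewrite reprK.
by apply/eq_piP; rewrite reprK.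
Qed.

Fact ler_L2_normD (u v : L2) : L2_norm (u + v) <= L2_norm u + L2_norm v.
Proof.
elim/quotW: u => u; elim/quotW: v => v.
by rewrite -piD !norm_pi -rmorphD lecR norm2D ?sqfunP.
Qed.

Fact L2_normZ a (u : L2) : L2_norm (a *: u) = `|a| * L2_norm u.
Proof.
elim/quotW: u => u; rewrite -[_ *: _]/(L2_scale _ _) pi_scale !norm_pi.
by rewrite norm2Z ?sqfunP// rmorphM normc_def normcE.
Qed.

Fact L2_norm_eq0 (u : L2) : L2_norm u = 0 -> u = 0.
Proof.
elim/quotW: u => u; rewrite norm_pi => -[] u0.
rewrite (_ : 0 = \pi_L2 0); last by rewrite piE.
by apply/eq_piP; rewrite subr0; apply/norm2_eq0.
Qed.

HB.instance Definition _ := Lmodule_isNormed.Build R[i] L2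
  ler_L2_normD L2_normZ L2_norm_eq0.

Definition L2_fun (u : L2) : R -> R[i] := sqfun_val (repr u).

(* Junk value: the class of [f] is 0 when [f] is not square integrable. *)
Definition L2_class (f : R -> R[i]) : L2 := \pi_L2 (insubd (0 : sqfun) f).

End L2.


Section operators.
Variables (R : realType) (X : normedModType R[i]).
Implicit Types (S T : X -> X) (z : R[i]).
Local Open Scope complex_scope.

Definition bounded_linear T : Prop :=
  linear T /\ exists M : R, forall x, `|T x| <= M%:C * `|x|.

(* Convergence for the norm of B(X): ||G i - T|| <= e eventually. *)
Definition cvg_opnorm (I : Type) (F : set_system I) (G : I -> X -> X) T : Prop :=
  forall e : R, 0 < e ->
    \forall i \near F, forall x, `|G i x - T x| <= e%:C * `|x|.

(* An operator defined on [dom] only: the values of [op] outside [dom] are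
   irrelevant. *)
Record unbounded_operator := UnboundedOperator {
  dom : set X;
  op :> X -> X }.

Implicit Type A : unbounded_operator.

Definition is_resolvent A z S : Prop :=
  [/\ bounded_linear S,
      forall x, dom A (S x) /\ z *: S x - A (S x) = x &
      forall x, dom A x -> S (z *: x - A x) = x].

Definition resolvent_set A : set R[i] :=
  [set z | exists S, is_resolvent A z S].

(* Unspecified when [z] is not in the resolvent set. *)
Definition resolvent A z : X -> X := get (is_resolvent A z).

End operators.

Section sectors.
Variable R : realType.
Local Open Scope complex_scope.
Implicit Type z : R[i].

(* The principal argument, with values in ]-pi, pi]. *)
Definition arg z : R :=
  let a := acos (Re z / normc z) in if 0 <= Im z then a else - a.

(* The vertex, at which the argument is undefined, is excluded. *)
Definition sector (c : R[i]) (a : R) : set R[i] :=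
  [set z | z != c /\ `|arg (z - c)| < a].

Definition cexp z : R[i] := (expR (Re z))%:C * (cos (Im z) +i* sin (Im z)).

End sectors.


Section semigroups.
Variables (R : realType) (X : normedModType R[i]).
Local Open Scope complex_scope.

Definition holomorphic_opnorm (U : set R[i]) (G : R[i] -> X -> X) : Prop :=
  forall z, U z -> exists2 G' : X -> X, bounded_linear G' &
    cvg_opnorm (0 : R[i])^' (fun h x => h^-1 *: (G (z + h) x - G z x)) G'.

(* The semigroup (T t), 0 <= t, extends to a semigroup (S z) on a sector around
   the positive axis, holomorphic in the open sector and strongly continuous at
   its vertex. The values of [T] at negative times are irrelevant. *)
Definition analytic_semigroup (T : R -> X -> X) : Prop :=
  exists (a : R) (S : R[i] -> X -> X),
    let Delta := sector 0 a in
    let Delta0 := Delta `|` [set 0] in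
    [/\ 0 < a <= pi / 2,
        forall t : R, 0 <= t -> S t%:C = T t &
        [/\ forall z, Delta0 z -> bounded_linear (S z),
            holomorphic_opnorm Delta S,
            S 0 = id,
            forall z w, Delta0 z -> Delta0 w -> S (z + w) = S z \o S w &
            forall x, S z x @[z --> within Delta (nbhs (0 : R[i]))] --> x]].

Definition is_generator (T : R -> X -> X) (A : unbounded_operator X) : Prop :=
  forall x y, (dom A x /\ A x = y) <->
    (h^-1)%:C *: (T h x - x) @[h --> (0 : R)^'+] --> y.

End semigroups.


Section curves.
Variables (R : realType) (X : normedModType R[i]).
Local Open Scope complex_scope.
Implicit Types (c : R -> R[i]) (G : R[i] -> X -> X) (I : X -> X).

(* A curve without end points has finite length between any two of its points. *)
Definition locally_rectifiable c : Prop :=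
  continuous c /\
  forall a b : R, a < b -> exists M : R, forall s : seq R, itv_partition a b s ->
    \sum_(i < size s) `|c (nth b s i) - c (nth b (a :: s) i)| <= M%:C.

(* The curve comes from infinity in the direction e^(i a) and goes to infinity
   in the direction e^(i b). *)
Definition joins_infinity c (a b : R) : Prop :=
  [/\ normc (c s) @[s --> -oo] --> +oo,
      c s / `|c s| @[s --> -oo] --> cos a +i* sin a,
      normc (c s) @[s --> +oo] --> +oo &
      c s / `|c s| @[s --> +oo] --> cos b +i* sin b].

Definition RS_sum c G (a b : R) (s : seq R) (xi : nat -> R) (x : X) : X :=
  \sum_(i < size s)
    (c (nth b s i) - c (nth b (a :: s) i)) *: G (c (xi i)) x.

(* The Riemann-Stieltjes integral of [G] along the arc c([a, b]): limit, in the
   operator norm, of Riemann sums as the mesh tends to 0. *)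
Definition is_arc_integral c G (a b : R) I : Prop :=
  forall e : R, 0 < e -> exists2 d : R, 0 < d &
    forall (s : seq R) (xi : nat -> R), itv_partition a b s ->
      (forall i, (i < size s)%N ->
        nth b s i - nth b (a :: s) i < d /\
        nth b (a :: s) i <= xi i <= nth b s i) ->
      forall x, `|RS_sum c G a b s xi x - I x| <= e%:C * `|x|.

Definition is_curve_integral c G I : Prop :=
  exists J : R -> R -> X -> X,
    (forall a b, a < b -> is_arc_integral c G a b (J a b)) /\
    cvg_opnorm (filter_prod (ninfty_nbhs R) (pinfty_nbhs R))
      (fun ab => J ab.1 ab.2) I.

(* Dunford's integral (2 pi i)^-1 \int_c e^(z t) (z - A)^-1 dz. *)
Definition is_dunford_integral (A : unbounded_operator X) c (t : R) (T : X -> X)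
    : Prop :=
  exists2 I, is_curve_integral c (fun z x => cexp (z * t%:C) *: resolvent A z x) I &
    forall x, T x = (0 +i* (2 * pi))^-1 *: I x.

End curves.


Section C2.
Variable R : realType.
Implicit Type g : R -> R.

(* Derivative relative to [0, 1], hence one-sided at 0 and 1. *)
Definition diffquot01 g (x y : R) : R := (g y - g x) / (y - x).

Definition near01 (x : R) : set_system R := within `[0, 1] x^'.

Definition derivable01 g : Prop :=
  forall x, x \in `[0, 1] -> cvg (diffquot01 g x y @[y --> near01 x]).

Definition deriv01 g (x : R) : R := lim (diffquot01 g x y @[y --> near01 x]).

Definition C2_01 g : Prop :=
  [/\ derivable01 g, derivable01 (deriv01 g) &
      {within `[0, 1], continuous (deriv01 (deriv01 g))}].

Definition C2 g : Prop :=
  [/\ forall x, derivable g x 1, forall x, derivable g^`()%classic x 1 &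
      continuous (g^`()^`())%classic].

End C2.


Section sobolev.
Variable R : realType.
Local Notation mu := (@lebesgue_measure R).
Local Open Scope complex_scope.
Implicit Types (w v : R -> R[i]) (psi : R -> R).

Definition test_function psi : Prop :=
  (forall n x, derivable psi^`(n)%classic x 1) /\
  exists M : R, forall x, M < `|x| -> psi x = 0.

Definition cintegral w : R[i] :=
  (\int[mu]_x Re (w x)) +i* (\int[mu]_x Im (w x)).

Definition weak_derivative n w v : Prop :=
  forall psi, test_function psi ->
    cintegral (fun x => w x * (psi^`(n)%classic x)%:C) =
    (-1) ^+ n * cintegral (fun x => v x * (psi x)%:C).

Definition H2 w : Prop :=
  w \in @sqint R /\
  forall n, (n <= 2)%N -> exists u : L2 R, weak_derivative n w (L2_fun u).

(* Unspecified when [w] has no square integrable weak second derivative. *)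
Definition weak_derivative2 w : L2 R :=
  get [set u : L2 R | weak_derivative 2 w (L2_fun u)].

End sobolev.


Section nagumo.
Variable R : realType.
Local Notation mu := (@lebesgue_measure R).
Local Open Scope complex_scope.
Implicit Types (D f phi : R -> R).

Definition nagumo_diffusion D : Prop :=
  [/\ C2_01 D, D 0 = 0, forall u, u \in `]0, 1] -> 0 < D u &
      forall u, u \in `[0, 1] -> 0 < deriv01 D u].

Definition nagumo_reaction f (alpha : R) : Prop :=
  [/\ C2_01 f,
      [/\ f 0 = 0, f alpha = 0 & f 1 = 0],
      [/\ deriv01 f 0 < 0, deriv01 f 1 < 0 & 0 < deriv01 f alpha],
      forall u, u \in `]alpha, 1[ -> 0 < f u &
      forall u, u \in `]0, alpha[ -> f u < 0].

Definition stationary_front D f phi : Prop :=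
  let P x : R := \int[mu]_(s in `[0, phi x]) D s in
  [/\ continuous phi /\ {homo phi : x y / x <= y >-> y <= x},
      forall x, 0 <= phi x <= 1,
      phi x @[x --> -oo] --> (1 : R) /\ phi x @[x --> +oo] --> (0 : R) &
      C2 P /\ forall x, (P^`()^`())%classic x = - f (phi x)].

Definition linearized_operator D f phi : unbounded_operator (L2 R) :=
  let Dphi (u : L2 R) x := (D (phi x))%:C * L2_fun u x in
  UnboundedOperator
    [set u | H2 (Dphi u)]
    (fun u => weak_derivative2 (Dphi u) +
              L2_class (fun x => (deriv01 f (phi x))%:C * L2_fun u x)).

End nagumo.

(* Main.v *)
(** The resolvent bound on the half plane [Re l > c] extends by Neumann series to
    the sector [Re (l - c) > - |Im (l - c)| / 8], with [||R(l)|| <= 8 / |l - c|].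
    For a direction [e] with [Re (e z) < 0], the integral of [cexp (l z) R(l)]
    along the ray from [l] in the direction [e] is, up to sign, a primitive of
    this function of [l] on a half plane, which is a consequence of the resolvent
    identity alone. Comparing the primitives of an upper and of a lower direction
    replaces Cauchy's theorem: on the intersection of their half planes they
    differ by a constant, which is [2 pi i] times the semigroup [T z]. The integral
    along any admissible curve telescopes to the variation of a primitive defined
    on the whole sector, and its value is that constant.

    Shifting the vertex to [c + 1 / Re z] bounds [T z]; comparison with the scalar
    family [(l - c)^-1], for which the contour integral is [cexp (c z)], gives
    [T z x -> x] on the domain; and [s |-> T ((1 - s) z) (T (w + s z) x)] has zero
    derivative, whence the semigroup law. The domain is dense because [L^2]
    satisfies the parallelogram law: for [mu] large, [mu R(mu) x] is bounded and
    the elements of almost minimal norm of suitable convex subsets of the domain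
    converge to [x]. *)

Require Import Defs.
From HB Require Import structures.
From mathcomp Require Import all_boot all_order all_algebra complex.
From mathcomp Require Import all_classical all_reals all_analysis measurable_realfun.
From mathcomp Require Import ring lra.

Set Implicit Arguments.
Unset Strict Implicit.
Unset Printing Implicit Defensive.

Import Order.TTheory GRing.Theory Num.Theory numFieldNormedType.Exports.

Local Open Scope classical_set_scope.
Local Open Scope ring_scope.
Local Open Scope complex_scope.

(** The curve in Dunford's formula is only continuous and locally rectifiable, and its total length
    is infinite, so no estimate may run along it up to infinity. The primitives therefore satisfy a
    strict form of differentiability, in which the tag of a step is independent of its end points:
    Riemann-Stieltjes sums over an arc then telescope up to a small multiple of its length. At
    infinity only the values of the primitive matter; they converge because the resolvent decays
    like the inverse of the modulus while the exponential stays bounded.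

    The sector is wider than a half plane, hence not convex, and is handled as the union of two half
    planes. Each of the two rays runs parallel to the edge of its half plane, so that it keeps its
    distance to this edge, and leans to the left, so that the exponential decays. For complex [z] in
    a cone half as steep this decay persists, which gives the analytic extension.

    Remainders are quadratic with explicit constants, and linear in [nrm x] where the operator norm
    is concerned. *)

Local Notation Re := (@complex.Re _).
Local Notation Im := (@complex.Im _).
Local Notation normc := (@Normc.normc _).

(** * Norms and the complex exponential *)

(* The square-zero extension of [K] by [V] is a commutative ring in which
   linear identities of the module [V] become ring identities. *)
Section square_zero_extension.
Variables (K : comNzRingType) (V : lmodType K).

Definition sqz := (K * V)%type.
HB.instance Definition _ := GRing.Zmodule.on sqz.

Definition sqz_mul (p q : sqz) : sqz := (p.1 * q.1, p.1 *: q.2 + q.1 *: p.2).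

Fact sqz_mulA : associative sqz_mul.
Proof.
move=> [a x] [b y] [c z]; rewrite /sqz_mul /= mulrA !scalerDr !scalerA addrA.
by rewrite (mulrC c a) (mulrC c b).
Qed.

Fact sqz_mulC : commutative sqz_mul.
Proof. by move=> [a x] [b y]; rewrite /sqz_mul /= mulrC addrC. Qed.

Fact sqz_mul1 : left_id ((1, 0) : sqz) sqz_mul.
Proof. by move=> [a x]; rewrite /sqz_mul /= mul1r scale1r scaler0 addr0. Qed.

Fact sqz_mulDl : left_distributive sqz_mul +%R.
Proof.
move=> [a x] [b y] [c z]; rewrite /sqz_mul /=; congr (_, _).
  by rewrite mulrDl.
by rewrite /= scalerDl scalerDr addrACA.
Qed.

Fact sqz_neq0 : ((1, 0) : sqz) != 0.
Proof. by apply/eqP => -[] /eqP; rewrite oner_eq0. Qed.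

HB.instance Definition _ := GRing.Zmodule_isComNzRing.Build sqz
  sqz_mulA sqz_mulC sqz_mul1 sqz_mulDl sqz_neq0.

Definition sqz_scal (a : K) : sqz := (a, 0).
Definition sqz_vec (x : V) : sqz := (0, x).

Fact sqz_scal_additive : additive sqz_scal.
Proof. by move=> a b; congr (_, _); rewrite /= oppr0 addr0. Qed.

Fact sqz_scal_multiplicative : multiplicative sqz_scal.
Proof. by split=> // a b; congr (_, _); rewrite /= !scaler0 addr0. Qed.

HB.instance Definition _ := GRing.isAdditive.Build K sqz sqz_scal
  sqz_scal_additive.
HB.instance Definition _ := GRing.isMultiplicative.Build K sqz sqz_scal
  sqz_scal_multiplicative.

Lemma sqz_vec_inj : injective sqz_vec.
Proof. by move=> x y []. Qed.

Lemma sqz_vecD x y : sqz_vec (x + y) = sqz_vec x + sqz_vec y.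
Proof. by congr (_, _); rewrite /= addr0. Qed.

Lemma sqz_vecN x : sqz_vec (- x) = - sqz_vec x.
Proof. by congr (_, _); rewrite /= oppr0. Qed.

Lemma sqz_vec0 : sqz_vec 0 = 0.
Proof. by []. Qed.

Lemma sqz_vecZ a x : sqz_vec (a *: x) = sqz_scal a * sqz_vec x.
Proof. by congr (_, _); rewrite /= ?mulr0 // scale0r addr0. Qed.

Definition sqz_vecE := (sqz_vecD, sqz_vecN, sqz_vec0, sqz_vecZ).
End square_zero_extension.

Ltac lmod := apply: sqz_vec_inj; rewrite !sqz_vecE; ring.

Section real_norm.
Variables (R : realType) (X : normedModType R[i]).
Implicit Types (x y : X) (a : R[i]) (r : R).

(** The norm of a module over [R[i]] takes its values in the partially ordered field [R[i]]. Its
    real part carries all the information and is accessible to [lra] and [nra]. *)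
Definition nrm x : R := Re `|x|.

Lemma nrmE x : `|x| = (nrm x)%:C.
Proof. by rewrite /nrm RRe_real // normr_real. Qed.

Lemma nrm_ge0 x : 0 <= nrm x.
Proof. by rewrite -ler0c -nrmE. Qed.

Lemma nrm0 : nrm 0 = 0.
Proof. by apply: complexI; rewrite -nrmE normr0. Qed.

Lemma nrm0_eq0 x : nrm x <= 0 -> x = 0.
Proof.
move=> x0; apply/eqP; rewrite -normr_eq0 nrmE.
by have /eqP -> : nrm x == 0 by rewrite eq_le x0 nrm_ge0.
Qed.

Lemma nrmN x : nrm (- x) = nrm x.
Proof. by apply: complexI; rewrite -!nrmE normrN. Qed.

Lemma nrmD x y : nrm (x + y) <= nrm x + nrm y.
Proof. by rewrite -lecR rmorphD /= -!nrmE ler_normD. Qed.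

Lemma nrmB x y : nrm (x - y) <= nrm x + nrm y.
Proof. by rewrite -(nrmN y) nrmD. Qed.

Lemma nrm_distC x y : nrm (x - y) = nrm (y - x).
Proof. by rewrite -nrmN opprB. Qed.

Lemma nrm_distD x y z : nrm (x - z) <= nrm (x - y) + nrm (y - z).
Proof. by apply: le_trans (nrmD _ _); rewrite addrA subrK. Qed.

Lemma nrm_distl x y : nrm x <= nrm y + nrm (x - y).
Proof. by apply: le_trans (nrmD _ _); rewrite addrC subrK. Qed.

Lemma normcC r : normc r%:C = `|r|.
Proof. by rewrite Defs.normcE /= expr0n addr0 sqrtr_sqr. Qed.

Lemma norm_normc a : `|a| = (normc a)%:C.
Proof. by rewrite normc_def Defs.normcE. Qed.

Lemma nrmZ a x : nrm (a *: x) = normc a * nrm x.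
Proof. by apply: complexI; rewrite -nrmE normrZ rmorphM /= -nrmE norm_normc. Qed.

Lemma nrmZr r x : nrm (r%:C *: x) = `|r| * nrm x.
Proof. by rewrite nrmZ normcC. Qed.

Lemma nrm_sum (n : nat) (F : 'I_n -> X) :
  nrm (\sum_(i < n) F i) <= \sum_(i < n) nrm (F i).
Proof.
elim/big_ind2 : _ => [|x r y s xr ys|//]; first by rewrite nrm0.
by rewrite (le_trans (nrmD _ _)) // lerD.
Qed.

Lemma nrm_sum_nat_le (p q : nat) (F : nat -> X) (c : R) :
  (forall k, (p <= k < q)%N -> nrm (F k) <= c) ->
  nrm (\sum_(p <= k < q) F k) <= (q - p)%:R * c.
Proof.
move=> Fc; have [qp|pq] := leqP q p.
  by rewrite big_geq // nrm0 (eqP qp) mul0r.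
rewrite mulr_natl -sumr_const_nat.
rewrite big_nat [leRHS]big_nat.
elim/big_ind2 : _ => [|x r y s xr ys|k]; [by rewrite nrm0| |exact: Fc].
by rewrite (le_trans (nrmD _ _)) // lerD.
Qed.

Lemma le_nrm_eps x r : (forall e : R, 0 < e -> nrm x <= r + e) -> nrm x <= r.
Proof. by move=> H; apply/ler_addgt0Pr. Qed.

End real_norm.

Section complex_modulus.
Variable R : realType.
Implicit Types (z w : R[i]) (r : R).

Lemma normc_distD x y z : normc (x - z) <= normc (x - y) + normc (y - z) :> R.
Proof. by apply: le_trans (le_normcD _ _); rewrite addrA subrK. Qed.

Lemma Re_le_normc z : `|Re z| <= normc z.
Proof. by rewrite Defs.normcE -sqrtr_sqr ler_wsqrtr // lerDl sqr_ge0. Qed.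

Lemma Im_le_normc z : `|Im z| <= normc z.
Proof. by rewrite Defs.normcE -sqrtr_sqr ler_wsqrtr // lerDr sqr_ge0. Qed.

Lemma normc_le_ReIm z : normc z <= `|Re z| + `|Im z|.
Proof.
rewrite Defs.normcE -[leRHS]ger0_norm ?addr_ge0 // -sqrtr_sqr ler_wsqrtr //.
by rewrite sqrrD !real_normK ?num_real // addrAC lerDl mulrn_wge0 // mulr_ge0.
Qed.

Lemma normc_sqr z : normc z ^+ 2 = Re z ^+ 2 + Im z ^+ 2.
Proof. by rewrite Defs.normcE sqr_sqrtr // addr_ge0 // sqr_ge0. Qed.

Lemma normc_eq0 z : (normc z == 0) = (z == 0).
Proof.
by apply/eqP/eqP => [/Normc.eq0_normc //|->]; rewrite Normc.normc0.
Qed.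

Lemma normc_gt0 z : (0 < normc z) = (z != 0).
Proof. by rewrite lt_neqAle normc_ge0 andbT eq_sym normc_eq0. Qed.

Lemma normcX z n : normc (z ^+ n) = normc z ^+ n.
Proof.
elim: n => [|n IH]; first by rewrite !expr0 Normc.normc1.
by rewrite !exprS Normc.normcM IH.
Qed.

Lemma ReD z w : Re (z + w) = Re z + Re w. Proof. by case: z w => ? ? []. Qed.
Lemma ImD z w : Im (z + w) = Im z + Im w. Proof. by case: z w => ? ? []. Qed.
Lemma ReN z : Re (- z) = - Re z. Proof. by case: z. Qed.
Lemma ImN z : Im (- z) = - Im z. Proof. by case: z. Qed.
Lemma ReM z w : Re (z * w) = Re z * Re w - Im z * Im w.
Proof. by case: z w => ? ? []. Qed.
Lemma ImM z w : Im (z * w) = Re z * Im w + Im z * Re w.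
Proof. by case: z w => ? ? []. Qed.

Definition ReImE := (ReD, ImD, ReN, ImN, ReM, ImM).

Lemma eqc z w : Re z = Re w -> Im z = Im w -> z = w.
Proof. by case: z w => a b [c d] /= -> ->. Qed.

Lemma expR_sub1_ge r : r <= expR r - 1.
Proof. by have := expR_ge1Dx r; lra. Qed.

Lemma expR_sub1_le r : expR r - 1 <= r * expR r.
Proof.
have h := expR_ge1Dx (- r); have p := expR_gt0 r.
have e : expR (- r) * expR r = 1 by rewrite -expRD addNr expR0.
nra.
Qed.

Lemma expR_abs_sub1 r : `|expR r - 1| <= `|r| * expR `|r|.
Proof.
have h1 := expR_sub1_ge r; have h2 := expR_sub1_le r.
have [r0|r0] := leP 0 r.
  by rewrite (ger0_norm r0) ger0_norm; lra.
have r1 : 1 <= expR (- r) by rewrite -expR0 ler_expR; lra.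
rewrite (ltr0_norm r0) ler0_norm; last by rewrite subr_le0 -expR0 ler_expR ltW.
nra.
Qed.

Lemma expR_sub1_lip r : r <= 0 -> `|expR r - 1| <= `|r|.
Proof.
move=> r0; have h1 := expR_sub1_ge r.
rewrite (ler0_norm r0) ler0_norm; first lra.
by rewrite subr_le0 -expR0 ler_expR.
Qed.

Lemma expR_sub1x r : `|expR r - 1 - r| <= r ^+ 2 * expR `|r|.
Proof.
have h1 := expR_sub1_ge r; have h2 := expR_sub1_le r; have p := expR_gt0 r.
rewrite ger0_norm; last lra.
have [r0|r0] := leP 0 r; first by rewrite (ger0_norm r0); nra.
rewrite (ltr0_norm r0).
have r1 : 1 <= expR (- r) by rewrite -expR0 ler_expR; lra.
nra.
Qed.

Lemma sin_le_abs r : `|sin r| <= `|r|.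
Proof.
wlog r0 : r / 0 <= r => [H|].
  have [|r0] := leP 0 r; first exact: H.
  by rewrite -normrN -sinN -[leRHS]normrN; apply: H; lra.
have dsin (x : R) : x \in `]0, r[ -> is_derive x 1 sin (cos x).
  by move=> _; exact: is_derive_sin.
have csin : {within `[0, r], continuous (@sin R)}.
  by apply: continuous_subspaceT => x; exact: continuous_sin.
have [c _] := MVT_segment r0 dsin csin.
rewrite sin0 !subr0 => ->; rewrite normrM ler_piMl //; exact: cos_max.
Qed.

Lemma cos_sub1E r : cos r - 1 = - (2 * sin (r / 2) ^+ 2).
Proof.
have e : r / 2 + r / 2 = r by field.
by rewrite -{1}e cosD; have := cos2Dsin2 (r / 2); lra.
Qed.

Lemma cos_sub1 r : `|cos r - 1| <= r ^+ 2.
Proof.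
rewrite cos_sub1E; have h := sin_le_abs (r / 2).
rewrite normrN ger0_norm; last by rewrite mulr_ge0 // sqr_ge0.
have : `|sin (r / 2)| ^+ 2 <= `|r / 2| ^+ 2 by rewrite ler_sqr ?nnegrE.
by rewrite !real_normK ?num_real //; have := sqr_ge0 r; nra.
Qed.

Lemma sin_subx r : `|sin r - r| <= r ^+ 2 .
Proof.
wlog r0 : r / 0 <= r => [H|].
  have [|r0] := leP 0 r; first exact: H.
  rewrite -normrN opprD -sinN -sqrrN; apply: H; lra.
have [r1|r1] := leP r 2; last first.
  have := sin_le_abs r; rewrite (ger0_norm r0) ler_norml => /andP[? ?].
  by rewrite ler_norml; apply/andP; split; nra.
pose g (x : R) := sin x - x.
have dg (x : R) : x \in `]0, r[ -> is_derive x 1 g (cos x - 1).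
  by move=> _; apply: is_deriveB.
have cg : {within `[0, r], continuous g}.
  apply: continuous_subspaceT => x; apply: cvgB; last exact: cvg_id.
  exact: continuous_sin.
have [c] := MVT_segment r0 dg cg; rewrite /g.
rewrite in_itv /= => /andP[c0 cr].
rewrite sin0 !subr0 => ->; rewrite normrM (ger0_norm r0) expr2 ler_wpM2r //.
have h := sin_le_abs (c / 2); have h1 := sin_max (c / 2).
rewrite cos_sub1E normrN ger0_norm; last by rewrite mulr_ge0 // sqr_ge0.
rewrite -[sin _ ^+ 2]real_normK ?num_real //.
move: h; rewrite (@ger0_norm _ (c / 2)); last lra.
have := normr_ge0 (sin (c / 2)); nra.
Qed.

End complex_modulus.

Lemma half_pow_small (R : realType) (Q e : R) : 0 < e -> exists n, Q * 2^-1 ^+ n <= e.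
Proof.
move=> e0; pose n := (Num.truncn (`|Q| / e)).+1; exists n.
rewrite exprVn ler_pdivrMr ?exprn_gt0 // (le_trans (ler_norm Q)) //.
rewrite mulrC -ler_pdivrMr //.
apply: le_trans (ltW (truncnS_gt _)) _.
by rewrite -natrX ler_nat ltnW // ltn_expl.
Qed.

Section complex_exponential.
Variable R : realType.
Implicit Types (z w h : R[i]) (r : R).

Lemma cexp0 : cexp (0 : R[i]) = 1.
Proof. by rewrite /cexp expR0 cos0 sin0 mul1r. Qed.

Lemma cexpD z w : cexp (z + w) = cexp z * cexp w.
Proof.
rewrite /cexp ReD ImD expRD cosD sinD; apply: eqc; rewrite !ReImE /=; ring.
Qed.

Lemma normc_cexp z : normc (cexp z) = expR (Re z).
Proof.
rewrite /cexp Normc.normcM normcC ger0_norm ?expR_ge0 // Defs.normcE /=.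
by rewrite cos2Dsin2 sqrtr1 mulr1.
Qed.

Lemma cexp_neq0 z : cexp z != 0.
Proof. by rewrite -normc_gt0 normc_cexp expR_gt0. Qed.

(** With [h = a + i b] and [n = normc h], the real and imaginary parts of the remainder split into
    four terms, each at most [n ^ 2 * expR n]; this is the constant 4. *)
Lemma cexp_sub1x h : normc (cexp h - 1 - h) <= 4 * normc h ^+ 2 * expR (normc h).
Proof.
case: h => a b; have ha := Re_le_normc (a +i* b); have hb := Im_le_normc (a +i* b).
have hn := normc_sqr (a +i* b); have n0 := normc_ge0 (a +i* b).
set n := normc (a +i* b) in ha hb hn n0 *.
rewrite /= in ha hb hn.
rewrite (le_trans (normc_le_ReIm _)) //.
rewrite !ReImE /= mul0r subr0 oppr0 !addr0 mul0r addr0.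
have -> : expR a * cos b - 1 - a = (expR a - 1 - a) + expR a * (cos b - 1) by ring.
have -> : expR a * sin b - b = expR a * (sin b - b) + (expR a - 1) * b by ring.
have ea : expR `|a| <= expR n by rewrite ler_expR.
have ea' : expR a <= expR n by rewrite ler_expR (le_trans (ler_norm _)).
have p := expR_gt0 a; have pn := expR_gt0 n.
have t1 : `|expR a - 1 - a| <= n ^+ 2 * expR n.
  rewrite (le_trans (expR_sub1x a)) // ler_pM ?sqr_ge0 ?expR_ge0 //.
  by rewrite hn lerDl sqr_ge0.
have b2 : b ^+ 2 <= n ^+ 2 by rewrite hn lerDr sqr_ge0.
have t2 : `|expR a * (cos b - 1)| <= n ^+ 2 * expR n.
  rewrite normrM gtr0_norm // mulrC ler_pM ?normr_ge0 ?expR_ge0 //.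
  by rewrite (le_trans (cos_sub1 b)).
have t3 : `|expR a * (sin b - b)| <= n ^+ 2 * expR n.
  rewrite normrM gtr0_norm // mulrC ler_pM ?normr_ge0 ?expR_ge0 //.
  by rewrite (le_trans (sin_subx b)).
have t4 : `|(expR a - 1) * b| <= n ^+ 2 * expR n.
  rewrite normrM expr2 mulrAC ler_pM //.
  by rewrite (le_trans (expR_abs_sub1 a)) // ler_pM ?expR_ge0.
have := ler_normD (expR a - 1 - a) (expR a * (cos b - 1)).
have := ler_normD (expR a * (sin b - b)) ((expR a - 1) * b).
lra.
Qed.

(** On the left half plane the real exponential is at most 1, so a global Lipschitz bound holds: one
    term is controlled by the real part of [z] and two by its imaginary part. *)
Lemma cexp_sub1_lip z : Re z <= 0 -> normc (cexp z - 1) <= 3 * normc z.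
Proof.
case: z => a b a0; rewrite /= in a0.
have ha := Re_le_normc (a +i* b); have hb := Im_le_normc (a +i* b).
set n := normc (a +i* b) in ha hb *.
rewrite /= in ha hb.
rewrite (le_trans (normc_le_ReIm _)) //.
rewrite !ReImE /= mul0r subr0 oppr0 !addr0 mul0r addr0.
have -> : expR a * cos b - 1 = (expR a - 1) * cos b + (cos b - 1) by ring.
have t1 : `|(expR a - 1) * cos b| <= `|a|.
  rewrite normrM -[leRHS]mulr1 ler_pM ?cos_max //; exact: expR_sub1_lip.
have t2 : `|expR a * sin b| <= `|b|.
  rewrite normrM -[leRHS]mul1r ler_pM ?sin_le_abs //.
  by rewrite ger0_norm ?expR_ge0 // -expR0 ler_expR.
have t3 : `|cos b - 1| <= `|b|.
  have [b1|b1] := leP `|b| 1.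
    rewrite (le_trans (cos_sub1 b)) // -real_normK ?num_real //.
    by rewrite expr2 ler_piMl.
  have h := sin_le_abs (b / 2); have h1 := sin_max (b / 2).
  rewrite cos_sub1E normrN ger0_norm; last by rewrite mulr_ge0 // sqr_ge0.
  rewrite -[sin _ ^+ 2]real_normK ?num_real //.
  move: h; rewrite normrM (@ger0_norm _ 2^-1) ?invr_ge0 //.
  have := normr_ge0 (sin (b / 2)); nra.
have := ler_normD ((expR a - 1) * cos b) (cos b - 1).
lra.
Qed.

End complex_exponential.

Section linear_maps.
Variables (R : realType) (X : normedModType R[i]) (B : X -> X).
Hypothesis linB : linear B.

Lemma lin0 : B 0 = 0.
Proof.
have := linB 1 0 0; rewrite !scale1r addr0 => e.
by apply: (addrI (B 0)); rewrite addr0 -e.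
Qed.

Lemma linZ a x : B (a *: x) = a *: B x.
Proof. by have := linB a x 0; rewrite !addr0 lin0 addr0. Qed.

Lemma linD x y : B (x + y) = B x + B y.
Proof. by have := linB 1 x y; rewrite !scale1r. Qed.

Lemma linN x : B (- x) = - B x.
Proof. by rewrite -scaleN1r linZ scaleN1r. Qed.

Lemma linS x y : B (x - y) = B x - B y.
Proof. by rewrite linD linN. Qed.

End linear_maps.

(** * Calculus in Banach spaces *)

Section banach_calculus.
Variables (R : realType) (X : normedModType R[i]).
Implicit Types (u v g : R -> X) (D : set R) (a b s t e d : R).

(* Equivalent to completeness: every Cauchy sequence has a subsequence converging
   at this rate. *)
Definition fast_complete : Prop :=
  forall (u : nat -> X) (C : R), (forall n, nrm (u n.+1 - u n) <= C * 2^-1 ^+ n) ->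
    exists l, forall n, nrm (u n - l) <= 2 * C * 2^-1 ^+ n.

(** The derivative is relative to [D], hence one-sided at the end points of an interval, and [g] is
    a datum, so that no junk value is involved. *)
Definition deriv_on D u g : Prop :=
  forall s, D s -> forall e, 0 < e -> exists2 d, 0 < d &
    forall t, D t -> `|t - s| < d ->
      nrm (u t - u s - (t - s)%:C *: g s) <= e * `|t - s|.

Definition icc a b : set R := [set s | a <= s <= b].
Definition ici : set R := [set s | 0 <= s].

Lemma deriv_on_sub D D' u g : D' `<=` D -> deriv_on D u g -> deriv_on D' u g.
Proof.
move=> sub du s Ds e e0; have [d d0 H] := du s (sub _ Ds) e e0.
by exists d => // t /sub Dt; exact: H.
Qed.

Lemma deriv_onD D u v g h : deriv_on D u g -> deriv_on D v h ->
  deriv_on D (fun s => u s + v s) (fun s => g s + h s).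
Proof.
move=> du dv s Ds e e0; have e2 : 0 < e / 2 by rewrite divr_gt0.
have [d d0 Hu] := du s Ds _ e2; have [d' d0' Hv] := dv s Ds _ e2.
exists (Num.min d d'); first by rewrite lt_min d0.
move=> t Dt; rewrite lt_min => /andP[td td'].
have -> : u t + v t - (u s + v s) - (t - s)%:C *: (g s + h s) =
  (u t - u s - (t - s)%:C *: g s) + (v t - v s - (t - s)%:C *: h s).
  by lmod.
rewrite (le_trans (nrmD _ _)) // (le_trans (lerD (Hu t Dt td) (Hv t Dt td'))) //.
lra.
Qed.

Lemma deriv_onM D u g (B : X -> X) (M : R) : linear B ->
  (forall x, nrm (B x) <= M * nrm x) -> deriv_on D u g ->
  deriv_on D (fun s => B (u s)) (fun s => B (g s)).
Proof.
move=> linB BM du s Ds e e0.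
have M1 : 0 < `|M| + 1 by rewrite ltr_pwDr.
have [d d0 H] := du s Ds _ (divr_gt0 e0 M1); exists d => // t Dt td.
have -> : B (u t) - B (u s) - (t - s)%:C *: B (g s) =
    B (u t - u s - (t - s)%:C *: g s).
  by rewrite !(linS linB) (linZ linB).
rewrite (le_trans (BM _)) //.
apply: (@le_trans _ _ ((`|M| + 1) * (e / (`|M| + 1) * `|t - s|))).
  apply: (@le_trans _ _ ((`|M| + 1) * nrm (u t - u s - (t - s)%:C *: g s))).
    by rewrite ler_wpM2r ?nrm_ge0 // (le_trans (ler_norm M)) // lerDl.
  by apply: ler_wpM2l; [exact: ltW | exact: H].
by rewrite mulrA mulrCA divff ?mulr1 // gt_eqF.
Qed.

(* Supremum argument: the inequality holds up to [e * (s - a)] on a maximal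
   initial segment. *)
Lemma mvt_ineq u (phi : R -> R) a b : a <= b ->
  (forall s t, a <= s -> s <= t -> t <= b -> phi s <= phi t) ->
  (forall s, icc a b s -> forall e, 0 < e -> exists2 d, 0 < d &
    forall t, icc a b t -> `|t - s| < d ->
      nrm (u t - u s) <= `|phi t - phi s| + e * `|t - s|) ->
  nrm (u b - u a) <= phi b - phi a.
Proof.
move=> ab phi_mono loc; apply: le_nrm_eps => e' e'0.
(* The summand 1 covers the case [a = b]. *)
pose e := e' / (b - a + 1).
have ba1 : 0 < b - a + 1 by lra.
have e0 : 0 < e by rewrite divr_gt0.
have {e'0} ee : e * (b - a) <= e'.
  have -> : e' = e * (b - a + 1) by rewrite /e mulfVK // gt_eqF.
  by rewrite ler_pM2l //; lra.
pose E := [set s | icc a b s /\ nrm (u s - u a) <= phi s - phi a + e * (s - a)].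
have Ea : E a by split; rewrite /icc /= ?lexx ?ab // !subrr nrm0 mulr0 addr0.
have ubE : ubound E b by move=> s [/andP[]].
have supE : has_sup E by split; [exists a|exists b].
set c := sup E.
have ac : a <= c by apply: sup_upper_bound.
have cb : c <= b by apply: ge_sup => //; exists a.
have Ic : icc a b c by apply/andP.
have [d d0 loc_c] := loc c Ic e e0.
have [s [Is Hs] cs] := sup_adherent d0 supE.
have sc : s <= c by apply: sup_upper_bound.
have /andP[as_ sb] := Is.
(* The local estimate at [c], applied to a point of [E] just below [c], shows that the supremum is
   attained. *)
have Ec : nrm (u c - u a) <= phi c - phi a + e * (c - a).
  have sd : `|s - c| < d by rewrite ler0_norm; move: cs; rewrite -/c; lra.
  have := loc_c s Is sd; have := phi_mono s c as_ sc cb.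
  rewrite (distrC s c) (@ger0_norm _ (c - s)) ?subr_ge0 // (distrC (phi s)) => pp.
  rewrite ger0_norm ?subr_ge0 // nrm_distC => H.
  by have := nrm_distD (u c) (u s) (u a); lra.
have [cb'|bc] := ltP c b; last first.
  have e1 : c = b by apply/eqP; rewrite eq_le cb bc.
  by rewrite e1 in Ec; lra.
exfalso; pose t := Num.min b (c + d / 2).
have tb : t <= b by rewrite ge_min lexx.
have td : t <= c + d / 2 by rewrite ge_min lexx orbT.
have ct : c < t by rewrite lt_min cb'; lra.
have It : icc a b t by apply/andP; split => //; lra.
have ttd : `|t - c| < d by rewrite gtr0_norm; lra.
have Et : E t.
  split=> //; have := loc_c t It ttd; have := phi_mono c t ac (ltW ct) tb => pp.
  rewrite (@gtr0_norm _ (t - c)) ?subr_gt0 // ger0_norm ?subr_ge0 // => H.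
  by have := nrm_distD (u t) (u c) (u a); lra.
by have := sup_upper_bound supE Et; rewrite -/c; lra.
Qed.

Lemma mvt_le u g a b (M : R) : a <= b -> deriv_on (icc a b) u g ->
  (forall s, icc a b s -> nrm (g s) <= M) -> nrm (u b - u a) <= M * (b - a).
Proof.
move=> ab du gM; rewrite mulrBr.
have M0 : 0 <= M by apply: le_trans (nrm_ge0 _) (gM a _); rewrite /icc /= lexx.
apply: (mvt_ineq (phi := fun s => M * s)) => // [s t _ st _|s Is e e0].
  exact: ler_wpM2l.
have [d d0 H] := du s Is e e0; exists d => // t It td.
rewrite -mulrBr normrM (ger0_norm M0).
rewrite (le_trans (nrm_distl _ ((t - s)%:C *: g s))) // nrmZr lerD ?H //.
by rewrite mulrC ler_wpM2r // gM.
Qed.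

Lemma mvt_const u a b : a <= b -> deriv_on (icc a b) u (fun=> 0) -> u b = u a.
Proof.
move=> ab du; apply/eqP; rewrite -subr_eq0; apply/eqP/nrm0_eq0.
by rewrite -[leRHS](mul0r (b - a)); apply: mvt_le du _ => // s _; rewrite nrm0.
Qed.

(** This is [mvt_ineq] for the primitive [phi] of the exponential bound. The work lies in checking
    that the increments of [phi] dominate those of [u] up to a small multiple of [|t - s|]. *)
Lemma mvt_exp u g a b (K sg : R) : 0 < sg -> a <= b -> deriv_on (icc a b) u g ->
  (forall s, icc a b s -> nrm (g s) <= K * expR (- (sg * s))) ->
  nrm (u b - u a) <= K / sg * (expR (- (sg * a)) - expR (- (sg * b))).
Proof.
move=> sg0 ab du gK.
have K0 : 0 <= K.
  have : 0 <= K * expR (- (sg * a)).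
    by apply: le_trans (nrm_ge0 _) (gK a _); rewrite /icc /= lexx.
  by rewrite pmulr_lge0 // expR_gt0.
have Ks0 : 0 <= K / sg by rewrite divr_ge0 // ltW.
pose phi s := - (K / sg * expR (- (sg * s))).
have -> : K / sg * (expR (- (sg * a)) - expR (- (sg * b))) = phi b - phi a.
  by rewrite /phi; ring.
apply: (mvt_ineq (phi := phi)) => // [s t _ st _|s Is e e0].
  by rewrite lerN2 ler_wpM2l // ler_expR lerN2 ler_wpM2l // ltW.
have e2 : 0 < e / 2 by rewrite divr_gt0.
have [d d0 H] := du s Is _ e2.
(* [Q * |y| ^ 2] bounds the second-order error of [phi]; the radius [sg^-1] keeps the exponent in
   this error below 1, whence the factor [expR 1]. *)
pose Q := K * sg * expR (- (sg * s)) * expR 1.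
have Q0 : 0 <= Q by rewrite !mulr_ge0 ?expR_ge0 // ltW.
pose d' := Num.min sg^-1 (e / 2 / (Q + 1)).
have Q1 : 0 < Q + 1 by rewrite ltr_wpDl.
have d'0 : 0 < d' by rewrite lt_min invr_gt0 sg0 !divr_gt0.
exists (Num.min d d'); first by rewrite lt_min d0.
move=> t It; rewrite !lt_min => /andP[td /andP[t1 t2]].
have {H} H := H t It td.
set y := t - s in td t1 t2 H *.
have hy : `|phi t - phi s| = K / sg * expR (- (sg * s)) * `|expR (- (sg * y)) - 1|.
  have kp : 0 <= K / sg * expR (- (sg * s)) by rewrite mulr_ge0 ?expR_ge0.
  rewrite -{1}(ger0_norm kp) -normrM -normrN.
  have -> : expR (- (sg * y)) = expR (- (sg * t)) / expR (- (sg * s)).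
    by rewrite -expRN -expRD; congr expR; rewrite /y; ring.
  by congr `|_|; rewrite /phi; field; rewrite !lt0r_neq0 ?expR_gt0.
have sy1 : `|sg * y| <= 1.
  rewrite normrM gtr0_norm // mulrC -ler_pdivlMr // mul1r ltW //.
have := expR_sub1x (- (sg * y)); rewrite opprK => h.
have h1 : `|sg * y| - (sg * y) ^+ 2 * expR 1 <= `|expR (- (sg * y)) - 1|.
  have h2 : (- (sg * y)) ^+ 2 * expR `|- (sg * y)| <= (sg * y) ^+ 2 * expR 1.
    by rewrite normrN sqrrN ler_wpM2l ?sqr_ge0 // ler_expR.
  have h3 : `|sg * y| <= `|expR (- (sg * y)) - 1| + `|expR (- (sg * y)) - 1 + sg * y|.
    rewrite -[X in X <= _]normrN -[X in _ + X]normrN.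
    apply: le_trans (ler_normD _ _); rewrite le_eqVlt; apply/orP; left; apply/eqP.
    by congr `|_|; ring.
  lra.
rewrite hy.
have lb : K * expR (- (sg * s)) * `|y| - Q * `|y| ^+ 2 <=
    K / sg * expR (- (sg * s)) * `|expR (- (sg * y)) - 1|.
  apply: le_trans (ler_wpM2l _ h1); last by rewrite mulr_ge0 ?expR_ge0.
  rewrite normrM (gtr0_norm sg0) exprMn -[y ^+ 2]real_normK ?num_real // /Q.
  rewrite le_eqVlt; apply/orP; left; apply/eqP; field; exact: lt0r_neq0.
have ub : nrm (u t - u s) <= K * expR (- (sg * s)) * `|y| + e / 2 * `|y|.
  rewrite (le_trans (nrm_distl _ (y%:C *: g s))) // nrmZr lerD //.
  by rewrite mulrC ler_wpM2r // gK.
have Qy : Q * `|y| ^+ 2 <= e / 2 * `|y|.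
  rewrite expr2 mulrA ler_wpM2r //.
  rewrite ltr_pdivlMr // in t2; rewrite mulrC.
  by apply: le_trans (ltW t2); rewrite ler_wpM2l // lerDl.
lra.
Qed.

End banach_calculus.

Arguments ici {R}.

(** * Primitives of Lipschitz functions by dyadic Riemann sums *)

Section primitives.
Variables (R : realType) (X : normedModType R[i]).
Hypothesis cX : fast_complete X.
Implicit Types (g P : R -> X) (s t e d : R).

Section riemann_sums.
Variables (g : R -> X) (B K : R).
Hypothesis gB : forall s, 0 <= s -> nrm (g s) <= B.
Hypothesis gK : forall s t, 0 <= s -> 0 <= t -> nrm (g t - g s) <= K * `|t - s|.

Definition dyadic_step n : R := 2^-1 ^+ n.
Local Notation h := dyadic_step.
Definition step_count n s := Num.truncn (s / h n).
Local Notation m := step_count.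
(** Only the cells of the dyadic grid that lie entirely in [[0, s]] are counted, each at its left
    end. The grid does not depend on [s], so that increments in [s] and refinements in [n] are again
    sums over cells, up to an error of at most [B * h n]. *)
Definition riemann_sum n s : X :=
  (h n)%:C *: \sum_(0 <= k < m n s) g (k%:R * h n).
Local Notation S := riemann_sum.

Let h0 n : 0 < h n. Proof. by rewrite exprn_gt0. Qed.
Let h_ge0 n : 0 <= h n. Proof. exact/ltW. Qed.
Let B0 : 0 <= B. Proof. exact: le_trans (nrm_ge0 _) (gB (lexx 0)). Qed.
Let K0 : 0 <= K.
Proof.
have := gK (lexx 0) (@ler01 R); rewrite subr0 normr1 mulr1.
exact: le_trans (nrm_ge0 _).
Qed.

Let m_itv n s : 0 <= s -> (m n s)%:R * h n <= s < (m n s).+1%:R * h n.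
Proof.
move=> s0; rewrite -ler_pdivlMr // -ltr_pdivrMr //.
by apply: truncn_itv; rewrite divr_ge0 // ltW.
Qed.

(** As [n] tends to infinity only the remainder [K * (t - s) ^ 2] survives, which makes the limit
    differentiable with derivative [g]. *)
Let S_incr n s t : 0 <= s -> s <= t ->
  nrm (S n t - S n s - (t - s)%:C *: g s) <= K * (t - s + h n) ^+ 2 + B * h n.
Proof.
move=> s0 st; have t0 := le_trans s0 st.
have /andP[ms sm] := m_itv n s0; have /andP[mt tm] := m_itv n t0.
set p := m n s in ms sm *; set q := m n t in mt tm *.
have pq : (p <= q)%N by apply: le_truncn; rewrite ler_pdivrMr // divfK ?gt_eqF.
have qp : (q - p)%:R * h n = q%:R * h n - p%:R * h n by rewrite natrB // mulrBl.
have b1 : (q - p)%:R * h n <= t - s + h n by rewrite qp; move: sm; rewrite -natr1; lra.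
have b2 : `|(q - p)%:R * h n - (t - s)| <= h n.
  by rewrite qp ler_norml; move: sm tm; rewrite -!natr1; lra.
have -> : S n t - S n s - (t - s)%:C *: g s =
  (h n)%:C *: (\sum_(p <= k < q) (g (k%:R * h n) - g s)) +
  ((q - p)%:R * h n - (t - s))%:C *: g s.
  rewrite /S -/p -/q (big_cat_nat (leq0n p) pq) //= big_split /= sumr_const_nat.
  rewrite -scaler_nat.
  have -> : ((q - p)%:R : R[i]) = ((q - p)%:R : R)%:C by rewrite rmorph_nat.
  by lmod.
rewrite (le_trans (nrmD _ _)) // lerD //; last first.
  rewrite nrmZr mulrC ler_pM ?nrm_ge0 //; exact: gB.
rewrite nrmZr gtr0_norm //.
rewrite (le_trans (ler_wpM2l (ltW (h0 n)) (nrm_sum_nat_le (c := K * (t - s + h n)) _))) //.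
  move=> k /andP[pk kq]; have kh0 : 0 <= k%:R * h n by rewrite mulr_ge0 // ltW.
  rewrite (le_trans (gK s0 kh0)) // ler_wpM2l //.
  have k1 : p%:R * h n <= k%:R * h n by rewrite ler_wpM2r ?ler_nat // ltW.
  have k2 : k%:R * h n <= q%:R * h n by rewrite ler_wpM2r ?ler_nat ?(ltnW kq) // ltW.
  have hn := h0 n; move: sm; rewrite -natr1 mulrDl mul1r => sm.
  rewrite ler_norml; apply/andP; split; first lra.
  by rewrite addrAC lerD2r (le_trans k2) // (le_trans mt) // lerDl ltW.
have -> : h n * ((q - p)%:R * (K * (t - s + h n))) =
  K * ((q - p)%:R * h n * (t - s + h n)) by ring.
rewrite expr2 ler_wpM2l // ler_wpM2r //.
by rewrite addr_ge0 ?subr_ge0 // ltW.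
Qed.

(** Halving the step splits each coarse cell in two; the sample point of the second half moves by
    [h n.+1], which costs [K * h n.+1]. At most one new fine cell appears at the end. *)
Let S_succ n s : 0 <= s -> nrm (S n.+1 s - S n s) <= (K * s + B) * h n.
Proof.
move=> s0; have hS : h n.+1 = h n / 2 by rewrite /dyadic_step exprSr.
have /andP[ms sm] := m_itv n s0; have /andP[mt tm] := m_itv n.+1 s0.
rewrite /riemann_sum; set p := m n s in ms sm *; set q := m n.+1 s in mt tm *.
rewrite -/(h n) -/(h n.+1).
have hn := h0 n.
have pq : (p.*2 <= q)%N.
  rewrite truncn_ge_nat ?divr_ge0 ?h_ge0 // ler_pdivlMr ?h0 //.
  by rewrite -muln2 natrM hS; lra.
have qp : (q <= p.*2.+1)%N.
  rewrite -ltnS truncn_lt_nat ?divr_ge0 ?h_ge0 // ltr_pdivrMr ?h0 //.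
  by move: sm; rewrite -muln2 -addn2 natrD natrM hS -natr1; lra.
pose T := \sum_(0 <= k < p.*2) g (k%:R * h n.+1).
have h2 : (h n)%:C = 2 * (h n.+1)%:C.
  by rewrite hS -[2](rmorph_nat (real_complex R)) -rmorphM mulrCA divff ?mulr1.
have Tp : nrm ((h n.+1)%:C *: T - (h n)%:C *: \sum_(0 <= k < p) g (k%:R * h n)) <=
    K * s * h n.
  have -> : (h n.+1)%:C *: T - (h n)%:C *: \sum_(0 <= k < p) g (k%:R * h n) =
    (h n.+1)%:C *: \sum_(0 <= k < p)
      (g (k%:R * h n + h n.+1) - g (k%:R * h n)).
    have -> : T = \sum_(0 <= k < p) (g (k%:R * h n) + g (k%:R * h n + h n.+1)).
      rewrite /T; elim: p {ms sm pq qp T} => [|p IH]; first by rewrite !big_geq.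
      rewrite doubleS !big_nat_recr //= -IH addrA; congr (_ + g _ + g _).
        by rewrite -muln2 natrM hS; lra.
      by rewrite -natr1 -muln2 natrM hS; lra.
    rewrite h2 !big_split /= sumrN.
    by lmod.
  rewrite nrmZr gtr0_norm ?h0 //.
  rewrite (le_trans (ler_wpM2l (ltW (h0 n.+1)) (nrm_sum_nat_le (c := K * h n.+1) _))) //.
    move=> k _; have k0 : 0 <= k%:R * h n by rewrite mulr_ge0 // ltW.
    have k1 : 0 <= k%:R * h n + h n.+1 by rewrite addr_ge0 // ltW.
    rewrite (le_trans (gK k0 k1)) // ler_wpM2l // addrAC subrr add0r.
    by rewrite gtr0_norm ?h0.
  rewrite subn0 hS.
  have a1 : K * (p%:R * h n) * h n <= K * s * h n by rewrite ler_wpM2r // ler_wpM2l.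
  have a0 : 0 <= K * (p%:R * h n) * h n by rewrite !mulr_ge0.
  have -> : h n / 2 * (p%:R * (K * (h n / 2))) = K * (p%:R * h n) * h n / 4 by field.
  lra.
have [->|q1] : q = p.*2 \/ q = p.*2.+1.
    move: qp; rewrite leq_eqVlt => /orP[/eqP->|]; first by right.
    by left; apply/eqP; rewrite eqn_leq pq andbT.
  by rewrite (le_trans Tp) // ler_wpM2r // lerDl.
rewrite q1 big_nat_recr //= -/T.
set w := g _.
have -> : (h n.+1)%:C *: (T + w) - (h n)%:C *: \sum_(0 <= k < p) g (k%:R * h n) =
  ((h n.+1)%:C *: T - (h n)%:C *: \sum_(0 <= k < p) g (k%:R * h n)) +
  (h n.+1)%:C *: w by lmod.
rewrite (le_trans (nrmD _ _)) // mulrDl lerD // nrmZr gtr0_norm ?h0 // mulrC.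
apply: ler_pM; rewrite ?nrm_ge0 ?h_ge0 //; last by rewrite hS; lra.
by apply: gB; rewrite mulr_ge0 // ltW.
Qed.

Lemma lipschitz_primitive : exists P, deriv_on ici P g /\ P 0 = 0.
Proof.
have lim s : exists l, 0 <= s -> forall n, nrm (S n s - l) <= 2 * (K * s + B) * h n.
  have [s0|s0] := leP 0 s; last by exists 0.
  have [|l Hl] := cX (u := fun n => S n s) (C := K * s + B).
    by move=> n; exact: S_succ.
  by exists l.
have [P HP] := choice lim.
have Pst s t : 0 <= s -> s <= t ->
    nrm (P t - P s - (t - s)%:C *: g s) <= K * (t - s) ^+ 2.
  move=> s0 st; have t0 := le_trans s0 st; apply: le_nrm_eps => e e0.
  have [n Hn] := half_pow_small (2 * (K * t + B) + 2 * (K * s + B) + B +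
    2 * K * (t - s) + K) e0.
  have h1 : h n <= 1 by rewrite exprn_ile1 // invf_le1 // ler1n.
  rewrite -/(h n) in Hn; have hn := h0 n.
  have -> : P t - P s - (t - s)%:C *: g s = (P t - S n t) + (S n s - P s) +
    (S n t - S n s - (t - s)%:C *: g s) by lmod.
  have a1 := HP t t0 n; have a2 := HP s s0 n; have a3 := S_incr n s0 st.
  rewrite nrm_distC in a1.
  have := nrmD (P t - S n t + (S n s - P s)) (S n t - S n s - (t - s)%:C *: g s).
  have := nrmD (P t - S n t) (S n s - P s).
  have : K * (h n * h n) <= K * h n by rewrite ler_wpM2l // ler_piMr // ltW.
  lra.
exists (fun s => P s - P 0); split; last by rewrite subrr.
move=> s s0 e e0; exists (e / (2 * K + 1)).
  by rewrite divr_gt0 // ltr_wpDl // mulr_ge0.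
move=> t t0; rewrite ltr_pdivlMr; last by rewrite ltr_wpDl // mulr_ge0.
move=> ts; have -> : P t - P 0 - (P s - P 0) = P t - P s by lmod.
suff H : nrm (P t - P s - (t - s)%:C *: g s) <= 2 * K * `|t - s| ^+ 2.
  rewrite (le_trans H) // expr2 mulrA ler_wpM2r //.
  by have := K0; have := normr_ge0 (t - s); lra.
have [st|ts'] := leP s t.
  rewrite (le_trans (Pst s t s0 st)) // real_normK ?num_real // ler_wpM2r ?sqr_ge0 //.
  by have := K0; lra.
(* The estimate is oriented, so for [t < s] it is applied from [t]; replacing [g t] by [g s] costs a
   second [K * (t - s) ^ 2]. *)
have -> : P t - P s - (t - s)%:C *: g s = - (P s - P t - (s - t)%:C *: g t) +
  (s - t)%:C *: (g s - g t) by lmod.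
rewrite (le_trans (nrmD _ _)) // nrmN nrmZr.
have := Pst t s t0 (ltW ts'); have := gK t0 s0.
rewrite (distrC t s) (@gtr0_norm _ (s - t)) ?subr_gt0 // => a1 a2.
have : (s - t) * nrm (g s - g t) <= (s - t) * (K * (s - t)).
  by rewrite ler_wpM2l // subr_ge0 ltW.
by lra.
Qed.
End riemann_sums.
End primitives.

(** * Integrals along rays *)

Section ray_integrals.
Variables (R : realType) (X : normedModType R[i]).
Implicit Types (g h P : R -> X) (m : R -> R[i]) (s t e sg tau K : R) (I J : X).

Definition tends_to P I : Prop :=
  forall e, 0 < e -> exists S, forall s, S <= s -> nrm (P s - I) <= e.

(* [I] is the integral of [g] over [0, +oo[. *)
Definition ray_int g I : Prop :=
  exists P, [/\ deriv_on ici P g, P 0 = 0 & tends_to P I].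

Lemma tends_toD P Q I J : tends_to P I -> tends_to Q J ->
  tends_to (fun s => P s + Q s) (I + J).
Proof.
move=> HP HQ e e0; have e2 : 0 < e / 2 by rewrite divr_gt0.
have [S HS] := HP _ e2; have [S' HS'] := HQ _ e2.
exists (Num.max S S') => s; rewrite ge_max => /andP[Ss S's].
have -> : P s + Q s - (I + J) = (P s - I) + (Q s - J) by lmod.
by rewrite (le_trans (nrmD _ _)) // [e]splitr lerD ?HS ?HS'.
Qed.

Lemma tends_to_cst I : tends_to (fun=> I) I.
Proof. by move=> e e0; exists 0 => s _; rewrite subrr nrm0 ltW. Qed.

Lemma tends_toM (B : X -> X) (M : R) P I : linear B ->
  (forall x, nrm (B x) <= M * nrm x) -> tends_to P I ->
  tends_to (fun s => B (P s)) (B I).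
Proof.
move=> linB BM HP e e0; have M1 : 0 < `|M| + 1 by rewrite ltr_wpDl.
have [S HS] := HP _ (divr_gt0 e0 M1); exists S => s Ss.
rewrite -linS // (le_trans (BM _)) //.
apply: (@le_trans _ _ ((`|M| + 1) * nrm (P s - I))).
  by rewrite ler_wpM2r ?nrm_ge0 // (le_trans (ler_norm M)) // lerDl.
by rewrite mulrC -ler_pdivlMr // HS.
Qed.

Lemma ray_intD g h I J : ray_int g I -> ray_int h J ->
  ray_int (fun s => g s + h s) (I + J).
Proof.
move=> [P [dP P0 PI]] [Q [dQ Q0 QJ]]; exists (fun s => P s + Q s); split.
- exact: deriv_onD.
- by rewrite P0 Q0 addr0.
- exact: tends_toD.
Qed.

Lemma ray_intM (B : X -> X) (M : R) g I : linear B ->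
  (forall x, nrm (B x) <= M * nrm x) -> ray_int g I ->
  ray_int (fun s => B (g s)) (B I).
Proof.
move=> linB BM [P [dP P0 PI]]; exists (fun s => B (P s)); split.
- exact: deriv_onM dP.
- by rewrite P0 lin0.
- exact: tends_toM PI.
Qed.

Lemma ray_intZ a g I : ray_int g I -> ray_int (fun s => a *: g s) (a *: I).
Proof.
apply: (@ray_intM (fun x => a *: x) (normc a)) => [b x y|x].
  by rewrite scalerDr !scalerA mulrC.
by rewrite nrmZ.
Qed.

Lemma ray_intB g h I J : ray_int g I -> ray_int h J ->
  ray_int (fun s => g s - h s) (I - J).
Proof.
move=> Hg /(@ray_intZ (-1)) Hh; have := ray_intD Hg Hh; rewrite scaleN1r.
by under eq_fun do rewrite scaleN1r.
Qed.

Lemma ray_int_eq g h I : (forall s, 0 <= s -> g s = h s) -> ray_int g I ->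
  ray_int h I.
Proof.
move=> gh [P [dP P0 PI]]; exists P; split=> // s s0 e e0.
by have [d d0 H] := dP s s0 e e0; exists d => // t t0; rewrite -gh //; exact: H.
Qed.

Lemma ray_int_ftc P g I : deriv_on ici P g -> tends_to P I ->
  ray_int g (I - P 0).
Proof.
move=> dP PI; exists (fun s => P s - P 0); split.
- move=> s s0 e e0; have [d d0 H] := dP s s0 e e0; exists d => // t t0 td.
  have -> : P t - P 0 - (P s - P 0) = P t - P s by lmod.
  exact: H.
- by rewrite subrr.
- exact: tends_toD (tends_to_cst (- P 0)).
Qed.

Lemma deriv_on_icc P g a b : 0 <= a -> deriv_on ici P g -> deriv_on (icc a b) P g.
Proof.
by move=> a0; apply: deriv_on_sub => s /andP[as_ _]; exact: le_trans as_.
Qed.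

Lemma primitive_decay P g K sg a b : 0 < sg -> 0 <= a -> a <= b ->
  (forall s, 0 <= s -> nrm (g s) <= K * expR (- (sg * s))) ->
  deriv_on ici P g -> nrm (P b - P a) <= K / sg * expR (- (sg * a)).
Proof.
move=> sg0 a0 ab gK dP.
have K0 : 0 <= K.
  have := le_trans (nrm_ge0 _) (gK 0 (lexx 0)).
  by rewrite mulr0 oppr0 expR0 mulr1.
have gK' s : icc a b s -> nrm (g s) <= K * expR (- (sg * s)).
  by move=> /andP[as_ _]; apply: gK; exact: le_trans as_.
rewrite (le_trans (mvt_exp sg0 ab (deriv_on_icc a0 dP) gK')) //.
rewrite ler_wpM2l ?divr_ge0 // ?(ltW sg0) // gerBl; exact: expR_ge0.
Qed.

Lemma ray_int_bound g I K sg : 0 < sg ->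
  (forall s, 0 <= s -> nrm (g s) <= K * expR (- (sg * s))) ->
  ray_int g I -> nrm I <= K / sg.
Proof.
move=> sg0 gK [P [dP P0 PI]]; apply: le_nrm_eps => e e0.
have [S HS] := PI _ e0; pose s := Num.max S 0.
have s0 : 0 <= s by rewrite le_max lexx orbT.
have Ss : S <= s by rewrite le_max lexx.
have := primitive_decay sg0 (lexx 0) s0 gK dP.
rewrite mulr0 oppr0 expR0 mulr1 P0 subr0.
have := HS s Ss; rewrite nrm_distC.
by have := nrm_distl I (P s); lra.
Qed.

Lemma ray_int_unique g I J : ray_int g I -> ray_int g J -> I = J.
Proof.
move=> gI gJ; apply/eqP; rewrite -subr_eq0; apply/eqP/nrm0_eq0.
have := ray_intB gI gJ; under eq_fun do rewrite subrr.
rewrite -[X in _ <= X](mul0r 1^-1); apply: ray_int_bound => // s _.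
by rewrite nrm0 mul0r.
Qed.

(** Meaningful only for a convergent integral, whose value is unique by [ray_int_unique]. *)
Definition rint g : X := get (ray_int g).

Lemma rintE g I : ray_int g I -> rint g = I.
Proof. by move=> gI; apply: ray_int_unique (getI gI) gI. Qed.

(* Exponential decay together with Lipschitz continuity decaying at the same
   rate [sg], which may be negative. *)
Definition decaying sg g : Prop := exists2 K, 0 <= K & forall s, 0 <= s ->
  nrm (g s) <= K * expR (- (sg * s)) /\
  forall t, s <= t -> nrm (g t - g s) <= K * (t - s) * expR (- (sg * s)).

Definition cdecaying tau m : Prop := exists2 K, 0 <= K & forall s, 0 <= s ->
  normc (m s) <= K * expR (- (tau * s)) /\
  forall t, s <= t -> normc (m t - m s) <= K * (t - s) * expR (- (tau * s)).

(** Rates add under products. The hypothesis [0 <= sg] lets the bound on [g] at the later time [t]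
    be replaced by the one at [s]. *)
Lemma decayingZ sg tau m g : 0 <= sg -> decaying sg g -> cdecaying tau m ->
  decaying (sg + tau) (fun s => m s *: g s).
Proof.
move=> sg0 [K K0 gK] [L L0 mL]; exists (2 * L * K); first by rewrite !mulr_ge0.
move=> s s0; have [g1 g2] := gK s s0; have [m1 m2] := mL s s0.
have -> : expR (- ((sg + tau) * s)) = expR (- (tau * s)) * expR (- (sg * s)).
  by rewrite -expRD; congr expR; ring.
have p1 := expR_gt0 (- (tau * s)); have p2 := expR_gt0 (- (sg * s)).
split.
  rewrite nrmZ; have := ler_pM (normc_ge0 (m s)) (nrm_ge0 (g s)) m1 g1.
  have : 0 <= L * K * (expR (- (tau * s)) * expR (- (sg * s))).
    by rewrite !mulr_ge0 // ltW.
  lra.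
move=> t st; have t0 := le_trans s0 st.
have [g1' _] := gK t t0.
have {}g1' : nrm (g t) <= K * expR (- (sg * s)).
  by rewrite (le_trans g1') // ler_wpM2l // ler_expR lerN2 ler_wpM2l.
have -> : m t *: g t - m s *: g s = (m t - m s) *: g t + m s *: (g t - g s).
  by lmod.
rewrite (le_trans (nrmD _ _)) // !nrmZ.
have := ler_pM (normc_ge0 (m t - m s)) (nrm_ge0 (g t)) (m2 t st) g1'.
have := ler_pM (normc_ge0 (m s)) (nrm_ge0 (g t - g s)) m1 (g2 t st).
lra.
Qed.

(** Linear growth costs an arbitrarily small loss [e] in the exponential rate, because
    [e * s <= expR (e * s)]. *)
Lemma cdecaying_affine (l d : R[i]) e : 0 < e ->
  cdecaying (- e) (fun s => l + s%:C * d).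
Proof.
move=> e0; exists (normc l + normc d / e + normc d).
  by rewrite !addr_ge0 ?divr_ge0 ?normc_ge0 // ltW.
move=> s s0; rewrite mulNr opprK.
have es0 : 0 <= e * s by rewrite mulr_ge0 // ltW.
have E1 : e * s <= expR (e * s) by have := expR_ge1Dx (e * s); lra.
have E2 : 1 <= expR (e * s) by have := expR_ge1Dx (e * s); lra.
have nl := normc_ge0 l; have nd := normc_ge0 d.
have nde : 0 <= normc d / e by rewrite divr_ge0 // ltW.
split.
  rewrite (le_trans (le_normcD _ _)) // Normc.normcM normcC ger0_norm //.
  have -> : s * normc d = normc d / e * (e * s) by field; exact: lt0r_neq0.
  have h1 := ler_wpM2l nl E2; have h2 := ler_wpM2l nde E1.
  have h3 := ler_wpM2l nd E2; lra.
move=> t st; have -> : l + t%:C * d - (l + s%:C * d) = (t - s)%:C * d by ring.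
rewrite Normc.normcM normcC ger0_norm ?subr_ge0 //.
apply: (@le_trans _ _ ((normc l + normc d / e + normc d) * (t - s))).
  by rewrite mulrC ler_wpM2r ?subr_ge0 // lerDr addr_ge0.
by rewrite ler_peMr // mulr_ge0 ?subr_ge0 // !addr_ge0.
Qed.

Lemma cdecaying_exp (l d z : R[i]) : Re (d * z) <= 0 ->
  cdecaying (- Re (d * z)) (fun s => cexp ((l + s%:C * d) * z)).
Proof.
move=> dz; pose K := expR (Re (l * z)) * (1 + 3 * normc (d * z)).
have e0 := expR_gt0 (Re (l * z)); have n0 := normc_ge0 (d * z).
exists K; first by rewrite mulr_ge0 ?expR_ge0 // addr_ge0 // mulr_ge0.
move=> s s0.
have E r : cexp ((l + r%:C * d) * z) = cexp (l * z) * cexp (r%:C * (d * z)).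
  by rewrite -cexpD; congr cexp; ring.
have nE r : normc (cexp (r%:C * (d * z))) = expR (- (- Re (d * z) * r)).
  by rewrite normc_cexp; congr expR; rewrite !ReImE /= mul0r; ring.
have p0 := expR_gt0 (- (- Re (d * z) * s)).
split.
  rewrite E Normc.normcM nE normc_cexp ler_wpM2r ?expR_ge0 // ler_pMr //.
  by rewrite lerDl mulr_ge0.
move=> t st; rewrite !E.
have -> : cexp (t%:C * (d * z)) = cexp (s%:C * (d * z)) * cexp ((t - s)%:C * (d * z)).
  by rewrite -cexpD; congr cexp; rewrite rmorphB /=; ring.
have -> : cexp (l * z) * (cexp (s%:C * (d * z)) * cexp ((t - s)%:C * (d * z))) -
    cexp (l * z) * cexp (s%:C * (d * z)) = cexp (l * z) *
    (cexp (s%:C * (d * z)) * (cexp ((t - s)%:C * (d * z)) - 1)) by ring.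
set A := cexp (l * z); set B := cexp (s%:C * (d * z)).
rewrite (Normc.normcM A) (Normc.normcM B) /B (nE s) /A (normc_cexp (l * z)).
have : normc (cexp ((t - s)%:C * (d * z)) - 1) <= 3 * ((t - s) * normc (d * z)).
  rewrite (le_trans (cexp_sub1_lip _)) //.
    by rewrite !ReImE /= mul0r subr0 -ReM mulr_ge0_le0 // subr_ge0.
  by rewrite Normc.normcM normcC ger0_norm ?subr_ge0.
have ts0 : 0 <= t - s by rewrite subr_ge0.
rewrite /K => H.
apply: (@le_trans _ _ (expR (Re (l * z)) *
    (expR (- (- Re (d * z) * s)) * (3 * ((t - s) * normc (d * z)))))).
  by rewrite !ler_wpM2l ?expR_ge0.
have -> : expR (Re (l * z)) * (1 + 3 * normc (d * z)) * (t - s) *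
    expR (- (- Re (d * z) * s)) = expR (Re (l * z)) *
    (expR (- (- Re (d * z) * s)) * ((t - s) + 3 * ((t - s) * normc (d * z)))).
  by ring.
by rewrite !ler_wpM2l ?expR_ge0 // lerDr.
Qed.

Hypothesis cX : fast_complete X.

Lemma ray_int_ex sg g : 0 < sg -> decaying sg g -> exists I, ray_int g I.
Proof.
move=> sg0 [K K0 gK].
have e1 s : 0 <= s -> expR (- (sg * s)) <= 1.
  by move=> s0; rewrite -expR0 ler_expR oppr_le0 mulr_ge0 // ltW.
have gB s : 0 <= s -> nrm (g s) <= K.
  by move=> s0; have [H _] := gK s s0; rewrite (le_trans H) // ler_piMr // e1.
have gL s t : 0 <= s -> 0 <= t -> nrm (g t - g s) <= K * `|t - s|.
  wlog st : s t / s <= t => [H s0 t0|s0 _].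
    have [|/ltW] := leP s t; first by move/H; exact.
    by rewrite nrm_distC distrC => /H; exact.
  have [_ H] := gK s s0; rewrite (le_trans (H t st)) // ger0_norm ?subr_ge0 //.
  by rewrite ler_piMr ?e1 // mulr_ge0 // subr_ge0.
have [P [dP P0]] := lipschitz_primitive cX gB gL.
have gE s : 0 <= s -> nrm (g s) <= K * expR (- (sg * s)).
  by move=> s0; have [] := gK s s0.
(* The exponential bound halves over each time [tau], so the values of the primitive at the
   multiples of [tau] converge at the rate required by [fast_complete]. *)
pose tau := ln 2 / sg.
have ln2 : 0 < ln 2 :> R by rewrite ln_gt0 // ltr1n.
have tau0 : 0 <= tau by rewrite divr_ge0 // ltW.
have En n : expR (- (sg * (n%:R * tau))) = 2^-1 ^+ n.
  have -> : - (sg * (n%:R * tau)) = n%:R * (- ln 2).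
    by rewrite /tau; field; exact: lt0r_neq0.
  by rewrite expRM_natl expRN lnK // posrE.
have nt0 n : 0 <= n%:R * tau by rewrite mulr_ge0.
have [|I HI] := cX (u := fun n => P (n%:R * tau)) (C := K / sg).
  move=> n; rewrite -En; apply: (primitive_decay sg0 (nt0 n) _ gE dP).
  by rewrite ler_wpM2r // ler_nat.
exists I; exists P; split=> //; move=> e e0.
have [n Hn] := half_pow_small (3 * (K / sg)) e0.
exists (n%:R * tau) => s Hs; have := primitive_decay sg0 (nt0 n) Hs gE dP.
rewrite En => H1; have H2 := HI n.
have := nrm_distD (P s) (P (n%:R * tau)) I; lra.
Qed.

Lemma rintP sg g : 0 < sg -> decaying sg g -> ray_int g (rint g).
Proof. by move=> sg0 /(ray_int_ex sg0)[I gI]; rewrite (rintE gI). Qed.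

End ray_integrals.

(** * Pseudo-resolvents *)

Section half_planes.
Variable R : realType.
Implicit Types (a b c e l h nu : R[i]).

Definition dot a b : R := Re a * Re b + Im a * Im b.

(** With [dot] the inner product of the plane, [nu] is an inner normal and [c] a boundary point, so
    that [dot (l - c) nu / normc nu] is the distance from [l] to the edge. The condition
    [0 <= dot e nu] says that rays in the direction [e] do not approach the edge. *)
Definition half_plane c nu : set R[i] := [set l | 0 < dot (l - c) nu].

Lemma dot_le a b : dot a b <= normc a * normc b.
Proof.
have [d0|d0] := leP (dot a b) 0.
  by rewrite (le_trans d0) // mulr_ge0 ?normc_ge0.
rewrite -ler_sqr ?nnegrE ?mulr_ge0 ?normc_ge0 ?(ltW d0) //.
rewrite exprMn !normc_sqr /dot -subr_ge0.
have -> : (Re a ^+ 2 + Im a ^+ 2) * (Re b ^+ 2 + Im b ^+ 2) -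
  (Re a * Re b + Im a * Im b) ^+ 2 = (Re a * Im b - Im a * Re b) ^+ 2 by ring.
exact: sqr_ge0.
Qed.

Lemma dotDl a b nu : dot (a + b) nu = dot a nu + dot b nu.
Proof. by rewrite /dot !ReImE; ring. Qed.

Lemma dot_ray a (s : R) e nu : dot (a + s%:C * e) nu = dot a nu + s * dot e nu.
Proof. by rewrite /dot !ReImE /=; ring. Qed.

Lemma half_plane_dist c nu l : half_plane c nu l ->
  0 < dot (l - c) nu / normc nu /\ dot (l - c) nu / normc nu <= normc (l - c).
Proof.
rewrite /half_plane /= => d0; have := dot_le (l - c) nu => d1.
have n0 : 0 < normc nu.
  rewrite lt_neqAle normc_ge0 andbT eq_sym; apply/eqP => n0.
  by move: d1; rewrite n0 mulr0 leNgt d0.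
by rewrite divr_gt0 // ler_pdivrMr.
Qed.

Lemma half_plane_ray c nu e l (s : R) : 0 <= dot e nu -> 0 <= s ->
  half_plane c nu l -> half_plane c nu (l + s%:C * e) /\
  dot (l - c) nu / normc nu <= normc (l + s%:C * e - c).
Proof.
move=> e0 s0; rewrite /half_plane /= => l0.
have E : l + s%:C * e - c = (l - c) + s%:C * e by ring.
have D : dot (l - c) nu <= dot (l + s%:C * e - c) nu.
  by rewrite E dot_ray lerDl mulr_ge0.
have D' := lt_le_trans l0 D; split=> //.
apply: le_trans (half_plane_dist D').2.
by rewrite ler_wpM2r // invr_ge0 normc_ge0.
Qed.
End half_planes.

Section pseudo_resolvents.
Variables (R : realType) (X : normedModType R[i]).
Implicit Types (c e l h z nu : R[i]) (M : R) (H : set R[i]) (x : X).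
Implicit Types (J : R[i] -> X -> X) (q : R[i] -> X).

(* The multiples [(l - c)^-1 *: x] form such a family as well as resolvents. *)
Definition pseudo_resolvent c M H J : Prop :=
  [/\ forall l, H l -> linear (J l),
      forall l x, H l -> normc (l - c) * nrm (J l x) <= M * nrm x &
      forall l m x, H l -> H m -> J l x - J m x = (m - l) *: J l (J m x)].

(* Primitive in [l] of [cexp (l * z) *: q l], integrated from infinity along
   the direction [e]. *)
Definition ray_transform e z q l : X :=
  - e *: rint (fun s : R => cexp ((l + s%:C * e) * z) *: q (l + s%:C * e)).

Lemma Re_ray l e z (s : R) : Re ((l + s%:C * e) * z) = Re (l * z) + s * Re (e * z).
Proof. by rewrite !ReImE /= mul0r; ring. Qed.

Lemma ray_transform_bound e z q l (Q : R) : Re (e * z) < 0 ->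
  (forall s, 0 <= s -> nrm (q (l + s%:C * e)) <= Q) ->
  (exists I, ray_int (fun s : R => cexp ((l + s%:C * e) * z) *: q (l + s%:C * e)) I) ->
  nrm (ray_transform e z q l) <= normc e * (Q * expR (Re (l * z)) / (- Re (e * z))).
Proof.
move=> ez qQ [I HI]; rewrite /ray_transform (rintE HI) scaleNr nrmN nrmZ.
rewrite ler_wpM2l ?normc_ge0 //.
apply: ray_int_bound HI; first by rewrite oppr_gt0.
move=> s s0; rewrite nrmZ normc_cexp Re_ray.
have -> : - (- Re (e * z) * s) = s * Re (e * z) by ring.
have p := expR_ge0 (Re (l * z) + s * Re (e * z)).
rewrite -mulrA -expRD mulrC ler_wpM2r //; exact: qQ.
Qed.

Section half_plane_family.
Variables (c nu e z : R[i]) (M : R) (J : R[i] -> X -> X).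
Hypothesis cX : fast_complete X.
Hypothesis HJ : pseudo_resolvent c M (half_plane c nu) J.
Hypothesis M0 : 0 <= M.
Hypothesis e_nu : 0 <= dot e nu.
Hypothesis ez : Re (e * z) < 0.

Let H := half_plane c nu.

Lemma pr_bound l x (d : R) : H l -> 0 < d -> d <= normc (l - c) ->
  nrm (J l x) <= M / d * nrm x.
Proof.
move=> Hl d0 dl; have [_ B _] := HJ; have := B l x Hl => Bl.
rewrite mulrAC ler_pdivlMr // mulrC; apply: le_trans Bl.
by rewrite ler_wpM2r ?nrm_ge0.
Qed.

(** The distance to the edge does not decrease along the ray, which gives boundedness; Lipschitz
    continuity then follows from the resolvent identity. The rate is 0: decay is left to the
    exponential factor. *)
Lemma pr_decaying l x : H l ->
  decaying 0 (fun s : R => J (l + s%:C * e) x).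
Proof.
move=> Hl; have [d0 dl] := half_plane_dist Hl.
set d := _ / _ in d0 dl.
have m0 : 0 <= M / d by rewrite divr_ge0 // ltW.
have Hs s : 0 <= s -> H (l + s%:C * e) by move=> /(half_plane_ray e_nu)/(_ Hl)[].
have Bs s y : 0 <= s -> nrm (J (l + s%:C * e) y) <= M / d * nrm y.
  move=> s0; have [Hs' ds'] := half_plane_ray e_nu s0 Hl.
  exact: pr_bound Hs' d0 ds'.
move: (M / d) m0 Bs => m m0 Bs.
have n0 := nrm_ge0 x; have ne0 := normc_ge0 e.
exists (m * nrm x + normc e * (m * (m * nrm x))).
  by rewrite addr_ge0 ?mulr_ge0.
move=> s s0; rewrite mul0r oppr0 expR0 !mulr1; split.
  by rewrite (le_trans (Bs s x s0)) // lerDl !mulr_ge0.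
move=> t st; have t0 := le_trans s0 st.
have [_ _ RJ] := HJ; rewrite (RJ _ _ _ (Hs t t0) (Hs s s0)).
have -> : l + s%:C * e - (l + t%:C * e) = (s - t)%:C * e by ring.
rewrite nrmZ Normc.normcM normcC distrC ger0_norm ?subr_ge0 //.
rewrite mulr1 -mulrA [leLHS]mulrC ler_wpM2r ?subr_ge0 //.
rewrite (@le_trans _ _ (normc e * (m * (m * nrm x)))) //.
  by rewrite ler_wpM2l // (le_trans (Bs t _ t0)) // ler_wpM2l // Bs.
by rewrite lerDr mulr_ge0.
Qed.

Let F x l := cexp (l * z) *: J l x.
(** The derivative of [F x] in [l]: by the resolvent identity that of [J l x] is [- J l (J l x)]. *)
Let F' x l := cexp (l * z) *: (z *: J l x - J l (J l x)).

Let sg := - Re (e * z).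
Let sg0 : 0 < sg. Proof. by rewrite oppr_gt0. Qed.

Lemma pr_exp_decaying l x : H l ->
  decaying sg (fun s : R => cexp ((l + s%:C * e) * z) *: J (l + s%:C * e) x).
Proof.
move=> Hl; rewrite -[sg]add0r; apply: decayingZ => //; first exact: pr_decaying.
by apply: cdecaying_exp; rewrite ltW.
Qed.

Lemma pr_ray_int l x : H l ->
  ray_int (fun s : R => cexp ((l + s%:C * e) * z) *: J (l + s%:C * e) x)
    (rint (fun s : R => cexp ((l + s%:C * e) * z) *: J (l + s%:C * e) x)).
Proof. by move=> Hl; apply: rintP (pr_exp_decaying x Hl). Qed.

Let taylor_cst (m : R) := 4 * normc z ^+ 2 * expR (normc z) * m + m ^+ 3 + normc z * m ^+ 2.

Let taylor_cst_ge0 m : 0 <= m -> 0 <= taylor_cst m.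
Proof.
move=> m0; rewrite /taylor_cst; have nz := normc_ge0 z.
by rewrite !addr_ge0 // ?mulr_ge0 ?expR_ge0 ?sqr_ge0 // exprn_ge0.
Qed.

(** Two applications of the resolvent identity expand [J (l + h) x] to second order with an explicit
    remainder. The bound depends on [l] only through [d] and the exponential factor, so that it can
    be integrated along a ray. *)
Let taylor l h x (d : R) : H l -> H (l + h) -> 0 < d -> d <= normc (l - c) ->
  d <= normc (l + h - c) -> normc h <= 1 ->
  nrm (F x (l + h) - F x l - h *: F' x l) <=
    expR (Re (l * z)) * (taylor_cst (M / d) * normc h ^+ 2 * nrm x).
Proof.
move=> Hl Hlh d0 dl dlh h1; have [_ _ RJ] := HJ.
have m0 : 0 <= M / d by rewrite divr_ge0 // ltW.
have Bl y : nrm (J l y) <= M / d * nrm y by exact: pr_bound.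
have Blh y : nrm (J (l + h) y) <= M / d * nrm y by exact: pr_bound.
move: (M / d) m0 Bl Blh => m m0 Bl Blh.
pose r1 := cexp (h * z) - 1 - h * z.
have E1 y : J (l + h) y = J l y - h *: J (l + h) (J l y).
  have := RJ (l + h) l y Hlh Hl; have -> : l - (l + h) = - h by ring.
  by move=> e1; rewrite -[LHS](subrK (J l y)) e1; lmod.
have -> : F x (l + h) - F x l - h *: F' x l = cexp (l * z) *:
  (r1 *: J (l + h) x + h ^+ 2 *: J (l + h) (J l (J l x)) -
   (h ^+ 2 * z) *: J (l + h) (J l x)).
  rewrite /F /F' /r1 mulrDl cexpD.
  have e2 := E1 (J l x); have e1 := E1 x.
  move: e1 e2; set a := J (l + h) x; set b := J (l + h) (J l x).
  set u := J (l + h) _; move=> -> ->.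
  by lmod.
rewrite nrmZ normc_cexp ler_wpM2l ?expR_ge0 //.
have n0 := nrm_ge0 x; have nz := normc_ge0 z; have nh := normc_ge0 h.
have hz : normc (h * z) <= normc z by rewrite Normc.normcM ler_piMl.
have t1 : nrm (r1 *: J (l + h) x) <=
    4 * normc z ^+ 2 * expR (normc z) * normc h ^+ 2 * (m * nrm x).
  rewrite nrmZ ler_pM ?normc_ge0 ?nrm_ge0 //.
  rewrite (le_trans (cexp_sub1x _)) // Normc.normcM exprMn.
  have -> : 4 * normc z ^+ 2 * expR (normc z) * normc h ^+ 2 =
    4 * (normc h ^+ 2 * normc z ^+ 2) * expR (normc z) by ring.
  by rewrite ler_wpM2l ?mulr_ge0 ?sqr_ge0 // ler_expR -Normc.normcM.
have t2 : nrm (h ^+ 2 *: J (l + h) (J l (J l x))) <=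
    normc h ^+ 2 * (m * (m * (m * nrm x))).
  rewrite nrmZ normcX ler_wpM2l ?sqr_ge0 // (le_trans (Blh _)) //.
  by rewrite ler_wpM2l // (le_trans (Bl _)) // ler_wpM2l.
have t3 : nrm ((h ^+ 2 * z) *: J (l + h) (J l x)) <=
    normc h ^+ 2 * normc z * (m * (m * nrm x)).
  rewrite nrmZ Normc.normcM normcX ler_wpM2l ?mulr_ge0 ?sqr_ge0 //.
  by rewrite (le_trans (Blh _)) // ler_wpM2l.
rewrite (le_trans (nrmB _ _)) //.
rewrite (le_trans (lerD (le_trans (nrmD _ _) (lerD t1 t2)) t3)) //.
by rewrite le_eqVlt; apply/orP; left; apply/eqP; rewrite /taylor_cst; ring.
Qed.

(** Fundamental theorem of calculus: the integrand is the derivative in [s] of [F x] along the ray,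
    and [F x] vanishes at its far end. *)
Let ray_deriv l x : H l ->
  ray_int (fun s : R => e *: F' x (l + s%:C * e)) (- F x l).
Proof.
move=> Hl; have [d0 dl] := half_plane_dist Hl.
set d := _ / _ in d0 dl.
have -> : - F x l = 0 - F x (l + 0%:C * e) by rewrite mul0r addr0 sub0r.
apply: (ray_int_ftc (P := fun s : R => F x (l + s%:C * e))) => [s s0 eps eps0|eps eps0].
  have ne0 := normc_ge0 e.
  pose C := expR (Re (l * z)) * (taylor_cst (M / d) * normc e ^+ 2 * nrm x).
  exists (Num.min (normc e + 1)^-1 (eps / (`|C| + 1))).
    by rewrite lt_min invr_gt0 ltr_wpDl // divr_gt0 // ltr_wpDl.
  move=> t t0; rewrite lt_min => /andP[ts1 ts2].
  have [Hs ds] := half_plane_ray e_nu s0 Hl; have [Ht dt] := half_plane_ray e_nu t0 Hl.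
  have E : l + t%:C * e = l + s%:C * e + (t - s)%:C * e by ring.
  rewrite E in Ht dt *.
  have h1 : normc ((t - s)%:C * e) <= 1.
    rewrite Normc.normcM normcC; move: ts1; rewrite -div1r ltr_pdivlMr ?ltr_wpDl //.
    have := normr_ge0 (t - s); lra.
  rewrite scalerA (le_trans (taylor x Hs Ht d0 ds dt h1)) //.
  rewrite Normc.normcM normcC exprMn Re_ray.
  have le1 : expR (Re (l * z) + s * Re (e * z)) <= expR (Re (l * z)).
    by rewrite ler_expR gerDl mulr_ge0_le0 // ltW.
  have m0 : 0 <= M / d by rewrite divr_ge0 // ltW.
  have T0 : 0 <= taylor_cst (M / d) * (`|t - s| ^+ 2 * normc e ^+ 2) * nrm x.
    by rewrite mulr_ge0 ?nrm_ge0 // mulr_ge0 ?taylor_cst_ge0 // mulr_ge0 ?sqr_ge0.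
  rewrite (le_trans (ler_wpM2r T0 le1)) //.
  have -> : expR (Re (l * z)) * (taylor_cst (M / d) * (`|t - s| ^+ 2 * normc e ^+ 2) *
    nrm x) = C * `|t - s| * `|t - s| by rewrite /C; ring.
  rewrite ler_wpM2r //.
  apply: (@le_trans _ _ ((`|C| + 1) * `|t - s|)).
    by rewrite ler_wpM2r // (le_trans (ler_norm C)) // lerDl.
  by rewrite mulrC -ler_pdivlMr ?ltW // ltr_wpDl.
have [K K0 HK] := pr_exp_decaying x Hl.
(* Since [expR u >= u], the bound [K * expR (- u)] with [u = sg * s] is at most [eps] as soon as
   [u >= K / eps]. *)
pose S := Num.max 0 ((K / eps) / sg).
exists S => s; rewrite ge_max => /andP[s0 Ss]; rewrite subr0.
have [H1 _] := HK s s0; rewrite (le_trans H1) //.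
rewrite expRN ler_pdivrMr ?expR_gt0 // mulrC -ler_pdivrMr //.
apply: (@le_trans _ _ (sg * s)); first by rewrite [leRHS]mulrC -ler_pdivrMr.
by have := expR_ge1Dx (sg * s); lra.
Qed.

(** Differentiation under the integral sign: [taylor] bounds the remainder of the integrand along
    the whole ray, and [ray_deriv] evaluates the integral of the derivative as [- F x l], a sign
    that the one in [ray_transform] cancels. *)
Lemma ray_transform_primitive l : H l -> exists C rho : R, [/\ 0 <= C, 0 < rho &
  forall h, normc h < rho -> H (l + h) /\ forall x,
    nrm (ray_transform e z (J^~ x) (l + h) - ray_transform e z (J^~ x) l -
         h *: (cexp (l * z) *: J l x)) <= C * normc h ^+ 2 * nrm x].
Proof.
move=> Hl; have [d0 dl] := half_plane_dist Hl.
set d := _ / _ in d0 dl.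
have n0 : 0 < normc nu.
  rewrite normc_gt0; apply/eqP => n0.
  by move: d0; rewrite /d n0 Normc.normc0 invr0 mulr0 ltxx.
have d2 : 0 < d / 2 by rewrite divr_gt0.
have m0 : 0 <= M / (d / 2) by rewrite divr_ge0 // ltW.
pose T := expR (Re (l * z)) * taylor_cst (M / (d / 2)).
have T0 : 0 <= T.
  by rewrite mulr_ge0 ?expR_ge0 // taylor_cst_ge0.
exists (normc e * T / sg), (Num.min 1 (d / 2)); split.
- by apply: divr_ge0 (mulr_ge0 (normc_ge0 e) T0) (ltW sg0).
- by rewrite lt_min ltr01.
move=> h; rewrite lt_min => /andP[h1 h2].
(* A shift shorter than [d / 2] leaves half of the distance to the edge, at the origin of the ray
   and hence along it. *)
have dh : d / 2 <= dot (l + h - c) nu / normc nu.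
  have -> : l + h - c = (l - c) + h by ring.
  rewrite dotDl mulrDl -/d.
  have := dot_le (- h) nu; rewrite normcN -ler_pdivrMr //.
  have -> : dot (- h) nu = - dot h nu by rewrite /dot !ReImE; ring.
  rewrite mulNr; move: h2; lra.
have Hlh : H (l + h).
  rewrite /H /half_plane /=; have := lt_le_trans d2 dh.
  by rewrite pmulr_lgt0 // invr_gt0.
split=> // x; rewrite /ray_transform.
set I1 := rint _; set I2 := rint _.
have R1 : ray_int (fun s : R => F x (l + h + s%:C * e)) I1 by exact: pr_ray_int.
have R2 : ray_int (fun s : R => F x (l + s%:C * e)) I2 by exact: pr_ray_int.
have := ray_intB (ray_intZ e (ray_intB R1 R2)) (ray_intZ h (ray_deriv x Hl)).
move=> /(ray_int_bound sg0 (K := normc e * T * normc h ^+ 2 * nrm x)) bd.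
have -> : - e *: I1 - - e *: I2 - h *: (cexp (l * z) *: J l x) =
  - (e *: (I1 - I2) - h *: (- F x l)) by rewrite /F; lmod.
rewrite nrmN (le_trans (bd _)) // => [s s0|]; last first.
  by rewrite le_eqVlt; apply/orP; left; apply/eqP; ring.
have [Hs ds] := half_plane_ray e_nu s0 Hl.
have [Hs' ds'] := half_plane_ray e_nu s0 Hlh.
have E : l + h + s%:C * e = l + s%:C * e + h by ring.
rewrite E in Hs' ds' *.
have -> : e *: (F x (l + s%:C * e + h) - F x (l + s%:C * e)) -
  h *: (e *: F' x (l + s%:C * e)) =
  e *: (F x (l + s%:C * e + h) - F x (l + s%:C * e) - h *: F' x (l + s%:C * e)) by lmod.
have ds2 : d / 2 <= normc (l + s%:C * e - c) by move: ds; rewrite -/d; lra.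
have ds2' := le_trans dh ds'.
rewrite nrmZ (le_trans (ler_wpM2l (normc_ge0 e) (taylor x Hs Hs' d2 ds2 ds2' (ltW h1)))) //.
rewrite Re_ray expRD /T mulNr opprK (mulrC (Re (e * z))).
by rewrite le_eqVlt; apply/orP; left; apply/eqP; ring.
Qed.

End half_plane_family.
End pseudo_resolvents.

(** * Contour integrals *)

Section contours.
Variables (R : realType) (X : normedModType R[i]).
Hypothesis cX : fast_complete X.
Implicit Types (e l h z nu : R[i]) (M : R) (H : set R[i]) (x : X).
Implicit Types (J : R[i] -> X -> X) (q : R[i] -> X).

Lemma pseudo_resolvent_sub c M H H' J : H' `<=` H ->
  pseudo_resolvent c M H J -> pseudo_resolvent c M H' J.
Proof.
move=> sub [LJ BJ RJ]; split.
- by move=> l /sub; exact: LJ.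
- by move=> l x /sub; exact: BJ.
- by move=> l m x /sub Hl /sub; exact: RJ.
Qed.

Lemma half_plane_segment (c nu l l' : R[i]) (s : R) : 0 <= s <= 1 ->
  half_plane c nu l -> half_plane c nu l' ->
  half_plane c nu (l + s%:C * (l' - l)).
Proof.
move=> /andP[s0 s1]; rewrite /half_plane /= => Hl Hl'.
have -> : dot (l + s%:C * (l' - l) - c) nu =
    (1 - s) * dot (l - c) nu + s * dot (l' - c) nu.
  by rewrite /dot !ReImE /=; ring.
have [s00|s00] := eqVneq s 0; first by rewrite s00 subr0 mul1r mul0r addr0.
have sp : 0 < s by rewrite lt_neqAle eq_sym s00.
by rewrite ltr_wpDl // ?mulr_gt0 // mulr_ge0 ?subr_ge0 // ltW.
Qed.

Section along_paths.
Variables (c nu e z : R[i]) (M : R) (J : R[i] -> X -> X) (x : X).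
Hypothesis HJ : pseudo_resolvent c M (half_plane c nu) J.
Hypothesis M0 : 0 <= M.
Hypothesis e_nu : 0 <= dot e nu.
Hypothesis ez : Re (e * z) < 0.

(** Combines the quadratic remainder of the path with that of [ray_transform_primitive]. It serves
    for segments, where [K = 0], and for half circles around the pole. *)
Lemma ray_transform_path (p p' : R -> R[i]) (K : R) (s : R) :
  (forall t, `|t - s| <= 1 ->
    normc (p t - p s - (t - s)%:C * p' s) <= K * `|t - s| ^+ 2) ->
  half_plane c nu (p s) ->
  forall eps : R, 0 < eps -> exists2 d, 0 < d & forall t, `|t - s| < d ->
    nrm (ray_transform e z (J^~ x) (p t) - ray_transform e z (J^~ x) (p s) -
      (t - s)%:C *: (p' s *: (cexp (p s * z) *: J (p s) x))) <= eps * `|t - s|.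
Proof.
move=> pK Hs eps eps0.
have [C [rho [C0 rho0 G]]] := ray_transform_primitive cX HJ M0 e_nu ez Hs.
set y := cexp (p s * z) *: J (p s) x.
have K0 : 0 <= K.
  have := pK (s + 1); have -> : s + 1 - s = 1 by ring.
  rewrite normr1 expr1n mulr1 => /(_ (lexx 1)); apply: le_trans; exact: normc_ge0.
pose L := K + normc (p' s).
have L0 : 0 <= L by rewrite addr_ge0 // normc_ge0.
pose Q := C * L ^+ 2 * nrm x + K * nrm y.
have Q0 : 0 <= Q by rewrite addr_ge0 ?mulr_ge0 ?nrm_ge0 // sqr_ge0.
have L1 : 0 < L + 1 by rewrite ltr_wpDl.
have Q1 : 0 < Q + 1 by rewrite ltr_wpDl.
exists (Num.min 1 (Num.min (rho / (L + 1)) (eps / (Q + 1)))).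
  by rewrite !lt_min ltr01 !divr_gt0.
move=> t; rewrite !lt_min => /and3P[t1 t2 t3].
have n0 := normr_ge0 (t - s).
have pts := pK t (ltW t1).
have hL : normc (p t - p s) <= L * `|t - s|.
  have := normc_distD (p t - p s) ((t - s)%:C * p' s) 0.
  rewrite !subr0 Normc.normcM normcC => H1.
  rewrite (le_trans H1) // mulrDl (mulrC `|t - s|) lerD2r (le_trans pts) //.
  by rewrite expr2 mulrA ler_piMr ?mulr_ge0 // ltW.
have hrho : normc (p t - p s) < rho.
  apply: le_lt_trans hL _; rewrite ltr_pdivlMr // in t2.
  apply: le_lt_trans t2; rewrite mulrC ler_wpM2l // lerDl //.
have [_ /(_ x)] := G _ hrho; rewrite (addrC (p s)) subrK -/y => B1.
set a := ray_transform _ _ _ (p t) in B1 *; set b := ray_transform _ _ _ (p s) in B1 *.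
have -> : a - b - (t - s)%:C *: (p' s *: y) = (a - b - (p t - p s) *: y) +
  (p t - p s - (t - s)%:C * p' s) *: y by lmod.
rewrite (le_trans (nrmD _ _)) // nrmZ.
have B2 : C * normc (p t - p s) ^+ 2 * nrm x <= C * L ^+ 2 * nrm x * `|t - s| ^+ 2.
  rewrite mulrAC [leRHS](_ : _ = C * nrm x * (L * `|t - s|) ^+ 2); last by ring.
  by rewrite ler_wpM2l ?mulr_ge0 ?nrm_ge0 // ler_sqr ?nnegrE ?normc_ge0 // mulr_ge0.
have B3 : normc (p t - p s - (t - s)%:C * p' s) * nrm y <= K * nrm y * `|t - s| ^+ 2.
  by rewrite mulrAC ler_wpM2r ?nrm_ge0.
rewrite (le_trans (lerD (le_trans B1 B2) B3)) // -mulrDl -/Q expr2 mulrA ler_wpM2r //.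
rewrite ltr_pdivlMr // in t3; apply: le_trans (ltW t3).
by rewrite mulrC ler_wpM2l // lerDl.
Qed.

Lemma ray_transform_segment l l' : half_plane c nu l -> half_plane c nu l' ->
  deriv_on (icc 0 1) (fun s : R => ray_transform e z (J^~ x) (l + s%:C * (l' - l)))
    (fun s : R => (l' - l) *: (cexp ((l + s%:C * (l' - l)) * z) *:
      J (l + s%:C * (l' - l)) x)).
Proof.
move=> Hl Hl' s Is eps eps0.
have [||d d0 Hd] := @ray_transform_path (fun s => l + s%:C * (l' - l))
  (fun=> l' - l) 0 s _ _ eps eps0.
- move=> t _; rewrite mul0r.
  have -> : l + t%:C * (l' - l) - (l + s%:C * (l' - l)) - (t - s)%:C * (l' - l) = 0.
    by ring.
  by rewrite Normc.normc0.
- exact: half_plane_segment.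
by exists d => // t _; exact: Hd.
Qed.
End along_paths.

(* Both transforms are primitives of the same function. *)
Lemma ray_transform_diff (c nu1 nu2 e1 e2 z : R[i]) M J x l l' :
  pseudo_resolvent c M (half_plane c nu1) J ->
  pseudo_resolvent c M (half_plane c nu2) J -> 0 <= M ->
  0 <= dot e1 nu1 -> 0 <= dot e2 nu2 -> Re (e1 * z) < 0 -> Re (e2 * z) < 0 ->
  half_plane c nu1 l -> half_plane c nu2 l ->
  half_plane c nu1 l' -> half_plane c nu2 l' ->
  ray_transform e1 z (J^~ x) l' - ray_transform e2 z (J^~ x) l' =
  ray_transform e1 z (J^~ x) l - ray_transform e2 z (J^~ x) l.
Proof.
move=> J1 J2 M0 en1 en2 ez1 ez2 H1 H2 H1' H2'.
pose u (s : R) := ray_transform e1 z (J^~ x) (l + s%:C * (l' - l)) -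
  ray_transform e2 z (J^~ x) (l + s%:C * (l' - l)).
have : u 1 = u 0.
  apply: mvt_const => //.
  have D1 := ray_transform_segment x J1 M0 en1 ez1 H1 H1'.
  have D2 := ray_transform_segment x J2 M0 en2 ez2 H2 H2'.
  move=> s Is eps eps0; have eps2 : 0 < eps / 2 by rewrite divr_gt0.
  have [d1 d10 B1] := D1 s Is _ eps2; have [d2 d20 B2] := D2 s Is _ eps2.
  exists (Num.min d1 d2); first by rewrite lt_min d10.
  move=> t It; rewrite lt_min => /andP[td1 td2].
  have := B1 t It td1; have := B2 t It td2; rewrite /u.
  set a1 := ray_transform e1 z _ _; set a2 := ray_transform e2 z _ _.
  set b1 := ray_transform e1 z _ _; set b2 := ray_transform e2 z _ _.
  set y := (_ - _) *: _ => h2 h1.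
  have -> : a1 - a2 - (b1 - b2) - (t - s)%:C *: 0 =
    (a1 - b1 - (t - s)%:C *: y) - (a2 - b2 - (t - s)%:C *: y) by lmod.
  by rewrite (le_trans (nrmB _ _)) //; lra.
rewrite /u mul0r addr0 mul1r.
by have -> : l + (l' - l) = l' by ring.
Qed.

(* With this value the Neumann series extending a resolvent bounded by [2 / d]
   across the line [Re l = c0] has ratio [1 / 2]. *)
Definition slope : R := 8^-1.

Lemma slope_gt0 : 0 < slope.
Proof. by rewrite /slope invr_gt0. Qed.

Definition sgn (b : bool) : R := if b then 1 else -1.
(** [edir b] is orthogonal to [normal b]: its rays run parallel to the edge of
    [half_plane c (normal b)]. The upper direction is the one of [true]. *)
Definition edir (b : bool) : R[i] := (- slope) +i* sgn b.
Definition normal (b : bool) : R[i] := 1 +i* (slope * sgn b).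

Lemma sgn_sqr b : sgn b * sgn b = 1.
Proof. by case: b; rewrite /sgn; ring. Qed.

Lemma edir_normal b : dot (edir b) (normal b) = 0.
Proof.
rewrite /dot /= -[X in _ + X](_ : slope * (sgn b * sgn b) = _); last by ring.
by rewrite sgn_sqr; ring.
Qed.

Lemma edir_left b : dot (edir b) (-1) = slope.
Proof. by rewrite /dot /=; ring. Qed.

Lemma normc_edir b : normc (edir b) <= 2.
Proof.
rewrite (le_trans (normc_le_ReIm _)) //= normrN /slope /sgn.
by rewrite ger0_norm ?invr_ge0 //; case: b; rewrite ?normrN normr1; lra.
Qed.

Lemma normc_normal b : 0 < normc (normal b) <= 2.
Proof.
apply/andP; split.
  by rewrite normc_gt0; apply/eqP => -[] /eqP; rewrite oner_eq0.
rewrite (le_trans (normc_le_ReIm _)) //= normrM normr1 /slope /sgn.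
by rewrite ger0_norm ?invr_ge0 //; case: b; rewrite ?normrN normr1; lra.
Qed.

(** With half the slope of the rays, the decay rate [- Re (edir b * z)] along both of them keeps at
    least half of [slope * Re z], its value when [z] is real. *)
Definition time_cone : set R[i] := [set z | 0 < Re z /\ `|Im z| <= slope / 2 * Re z].

Lemma edir_time b z : time_cone z -> slope / 2 * Re z <= - Re (edir b * z).
Proof.
move=> [z0 zI]; rewrite !ReImE /=; move: zI; rewrite ler_norml => /andP[? ?].
by case: b; rewrite /sgn; lra.
Qed.

Lemma edir_time_lt0 b z : time_cone z -> Re (edir b * z) < 0.
Proof.
move=> zc; have := edir_time b zc; have [z0 _] := zc.
have : 0 < slope / 2 * Re z by rewrite mulr_gt0 // divr_gt0 // invr_gt0.
by lra.
Qed.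

(** The union of the two half planes [half_plane c (normal b)]. It is not convex, whence the
    separate treatment of the half planes, in which segments are available. *)
Definition sectorial c : set R[i] :=
  [set l | - (slope * `|Im (l - c)|) < Re (l - c)].

Lemma half_plane_normalE c b l : half_plane c (normal b) l =
  (0 < Re (l - c) + slope * sgn b * Im (l - c)) :> Prop.
Proof. by rewrite /half_plane /dot /= mulr1 (mulrC (Im _)). Qed.

Lemma half_plane_sectorial c b : half_plane c (normal b) `<=` sectorial c.
Proof.
move=> l; rewrite half_plane_normalE /sectorial /=.
have := ler_norm (Im (l - c)); have := ler_norm (- Im (l - c)); rewrite normrN.
have : 0 < slope by rewrite /slope invr_gt0.
by case: b; rewrite /sgn; nra.
Qed.

Lemma edir_transform_bound b z q l (Q : R) : time_cone z ->
  (forall s : R, 0 <= s -> nrm (q (l + s%:C * edir b)) <= Q) ->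
  (exists I, ray_int (fun s : R => cexp ((l + s%:C * edir b) * z) *:
    q (l + s%:C * edir b)) I) ->
  nrm (ray_transform (edir b) z q l) <=
    2 * (Q * expR (Re (l * z)) / (slope / 2 * Re z)).
Proof.
move=> zc qQ ex; have ez := edir_time_lt0 b zc; have [z0 _] := zc.
have p0 : 0 < slope / 2 * Re z by rewrite mulr_gt0 // divr_gt0 // invr_gt0.
have Q0 : 0 <= Q := le_trans (nrm_ge0 _) (qQ 0 (lexx 0)).
have E0 : 0 <= Q * expR (Re (l * z)) by rewrite mulr_ge0 // expR_ge0.
rewrite (le_trans (ray_transform_bound ez qQ ex)) //.
apply: ler_pM; rewrite ?normc_ge0 ?normc_edir //.
  by apply: divr_ge0 => //; rewrite oppr_ge0 ltW.
apply: ler_wpM2l => //; rewrite lef_pV2 ?posrE ?oppr_gt0 //.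
exact: edir_time.
Qed.

Lemma half_plane_real (c : R[i]) b (r : R) : 0 < r -> half_plane c (normal b) (c + r%:C).
Proof.
by move=> r0; rewrite half_plane_normalE addrAC subrr add0r /= mulr0 addr0.
Qed.

(* [(2 pi i)^-1] times the integral of [cexp (m * z) *: q m] along the two rays
   from [l] in the directions [edir], the lower one reversed. *)
Definition contour z q l : X := (0 +i* (2 * pi))^-1 *:
  (ray_transform (edir false) z q l - ray_transform (edir true) z q l).

(** The points [c + r] lie in both half planes, where the two transforms differ by a constant. This
    freedom allows the vertex to be adapted to [z] in the estimates. *)
Lemma contour_vertex (c : R[i]) (z : R[i]) M J x (r r' : R) :
  pseudo_resolvent c M (sectorial c) J -> 0 <= M -> time_cone z ->
  0 < r -> 0 < r' ->
  contour z (J^~ x) (c + r%:C) = contour z (J^~ x) (c + r'%:C).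
Proof.
move=> HJ M0 zc r0 r'0; rewrite /contour; congr (_ *: _).
have Jb b := pseudo_resolvent_sub (@half_plane_sectorial c b) HJ.
by apply: (ray_transform_diff x (Jb false) (Jb true)) => //;
  rewrite ?edir_normal //; do ?[exact: edir_time_lt0 | exact: half_plane_real].
Qed.

(** * The contour integral around a simple pole *)

Section scalar_family.
Variable c : R[i].
Implicit Types (b : bool) (r : R).

Definition scalar_family l x : X := (l - c)^-1 *: x.

Lemma scalar_family_resolvent H : ~ H c -> pseudo_resolvent c 1 H scalar_family.
Proof.
move=> Hc; have Hl0 l : H l -> l - c != 0.
  by move=> Hl; rewrite subr_eq0; apply/eqP => lc; rewrite lc in Hl.
split.
- by move=> l _ a x y; rewrite /scalar_family scalerDr !scalerA mulrC.
- move=> l x /Hl0 l0; rewrite /scalar_family nrmZ mulrA -Normc.normcM divff //.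
  by rewrite Normc.normc1.
- move=> l m x /Hl0 l0 /Hl0 m0; rewrite /scalar_family !scalerA -scalerBl.
  by congr (_ *: _); field; rewrite l0 m0.
Qed.

Lemma half_plane_vertex nu : ~ half_plane c nu c.
Proof. by rewrite /half_plane /= subrr /dot /= !mul0r addr0 ltxx. Qed.

Lemma sectorial_vertex : ~ sectorial c c.
Proof. by rewrite /sectorial /= subrr /= normr0 mulr0 oppr0 ltxx. Qed.

Variables (z : R[i]) (x : X).
Hypothesis zc : time_cone z.

Let G b l := ray_transform (edir b) z (scalar_family^~ x) l.

Let scalar_pr nu := scalar_family_resolvent (@half_plane_vertex nu).

(* On the negative half axis both rays stay in a half plane that avoids the pole,
   so that the two transforms agree there; the integral around the pole is then
   computed on two half circles of radius tending to 0. *)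
Let left_bound b r : 0 < r ->
  nrm (G b (c - r%:C)) <= 2 * (expR (Re (c * z)) * nrm x / (slope / 2 * Re z)) / r.
Proof.
move=> r0; have Hl : half_plane c (-1) (c - r%:C).
  by rewrite /half_plane /= addrAC subrr add0r /dot /= oppr0 mul0r addr0 mulrNN mulr1.
have e0 : 0 <= dot (edir b) (-1) by rewrite edir_left /slope invr_ge0.
have ez := edir_time_lt0 b zc.
have [z0 _] := zc.
have p0 : 0 < slope / 2 * Re z by rewrite mulr_gt0 // divr_gt0 // invr_gt0.
have dl (s : R) : 0 <= s -> r <= normc (c - r%:C + s%:C * edir b - c).
  move=> s0; have [_] := half_plane_ray e0 s0 Hl; apply: le_trans.
  rewrite addrAC subrr add0r normcN Normc.normc1 divr1 /dot /=.
  by rewrite oppr0 mul0r addr0 mulrNN mulr1.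
have qQ (s : R) : 0 <= s ->
    nrm (scalar_family (c - r%:C + s%:C * edir b) x) <= r^-1 * nrm x.
  move=> s0; have [Hs _] := half_plane_ray e0 s0 Hl; rewrite -[r^-1]mul1r.
  exact: (pr_bound (@scalar_pr (-1)) x Hs r0 (dl s s0)).
have := @edir_transform_bound b z (scalar_family^~ x) (c - r%:C) _ zc qQ.
move=> /(_ (ex_intro _ _ (pr_ray_int cX (@scalar_pr (-1)) ler01 e0 ez x Hl))) H.
rewrite (le_trans H) //; move: p0; set p := slope / 2 * Re z => p0.
have -> : 2 * (expR (Re (c * z)) * nrm x / p) / r =
  2 * (r^-1 * nrm x * expR (Re (c * z)) / p) by ring.
rewrite ler_wpM2l // ler_wpM2r ?invr_ge0 ?(ltW p0) // ler_wpM2l //.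
  by rewrite mulr_ge0 ?nrm_ge0 // invr_ge0 ltW.
rewrite ler_expR !ReImE /= oppr0 addr0.
by have := mulr_gt0 r0 z0; lra.
Qed.

(** The difference of the two transforms is constant on the negative half axis, while at [c - t]
    both are [O(1 / t)]; with [t] large it is arbitrarily small. *)
Let left_eq r : 0 < r -> G true (c - r%:C) = G false (c - r%:C).
Proof.
have e0 b : 0 <= dot (edir b) (-1) by rewrite edir_left /slope invr_ge0.
have Hl t : 0 < t -> half_plane c (-1) (c - t%:C).
  move=> t0; rewrite /half_plane /= addrAC subrr add0r /dot /= oppr0 mul0r addr0.
  by rewrite mulrNN mulr1.
move=> r0; apply/eqP; rewrite -subr_eq0; apply/eqP/nrm0_eq0; apply: le_nrm_eps.
move=> eps eps0; rewrite add0r.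
set K := 2 * (expR (Re (c * z)) * nrm x / (slope / 2 * Re z)).
have K0 : 0 <= K.
  have [z0 _] := zc.
  by rewrite !mulr_ge0 ?nrm_ge0 ?expR_ge0 // invr_ge0 !mulr_ge0 ?invr_ge0 // ltW.
pose t := (2 * K + 1) / eps.
have t0 : 0 < t by rewrite divr_gt0 // ltr_wpDl // mulr_ge0.
have := ray_transform_diff x (@scalar_pr (-1)) (@scalar_pr (-1)) ler01 (e0 true)
  (e0 false) (edir_time_lt0 true zc) (edir_time_lt0 false zc)
  (Hl t t0) (Hl t t0) (Hl r r0) (Hl r r0).
rewrite -/(G true _) -/(G false _) => ->; rewrite (le_trans (nrmB _ _)) //.
rewrite (le_trans (lerD (left_bound true t0) (left_bound false t0))) // -/K.
rewrite -mulrDl ler_pdivrMr // /t mulrC divfK ?lt0r_neq0 //; lra.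
Qed.

(** On the half circle [p], the quotient of [p'] by [p - c] is the constant [w 1], that is [i] times
    [sgn b], so that the integrand differs by [O(r)] from its value at the pole. *)
Let circle b r : 0 < r -> r <= 1 ->
  nrm (G b (c - r%:C) - G b (c + r%:C) -
       (0 +i* (sgn b * pi)) *: (cexp (c * z) *: x)) <=
  pi * (r * (expR (Re (c * z)) * nrm x *
    (normc z + 4 * normc z ^+ 2 * expR (normc z)))).
Proof.
move=> r0 r1.
pose w (t : R) : R[i] := 0 +i* (sgn b * t).
pose p (t : R) := c + r%:C * cexp (w t).
pose p' (t : R) := r%:C * (w 1 * cexp (w t)).
(* Subtracting the expected linear growth leaves a function whose derivative is [O(r)]. *)
pose u (t : R) := G b (p t) - t%:C *: (w 1 *: (cexp (c * z) *: x)).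
have wE (t : R) : w t = t%:C * w 1 by apply: eqc; rewrite !ReImE /=; ring.
have wD (t s : R) : w (t + s) = w t + w s by apply: eqc; rewrite !ReImE /=; ring.
have nw t : normc (cexp (w t)) = 1 by rewrite normc_cexp /= expR0.
have nw1 t : normc (w t) = `|t|.
  rewrite Defs.normcE /= expr0n add0r exprMn expr2 sgn_sqr mul1r.
  by rewrite sqrtr_sqr.
have ppi := pi_gt0 R.
have pquad s t : `|t - s| <= 1 ->
    normc (p t - p s - (t - s)%:C * p' s) <= 4 * expR 1 * `|t - s| ^+ 2.
  move=> ts; have E : cexp (w t) = cexp (w s) * cexp (w (t - s)).
    by rewrite -cexpD -wD; congr (cexp (w _)); ring.
  have -> : p t - p s - (t - s)%:C * p' s =
    r%:C * (cexp (w s) * (cexp (w (t - s)) - 1 - w (t - s))).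
    by rewrite /p /p' E (wE (t - s)); ring.
  rewrite (Normc.normcM r%:C) (Normc.normcM (cexp (w s))) nw mul1r normcC gtr0_norm //.
  rewrite (le_trans (ler_piMl (normc_ge0 _) r1)) // (le_trans (cexp_sub1x _)) // nw1.
  by rewrite mulrAC ler_wpM2r ?sqr_ge0 // ler_wpM2l // ler_expR.
(* The end points are antipodal, so no half plane with [c] on its edge contains the half circle: the
   left one is used where [cos t < 0], that of [normal b] elsewhere. *)
have Hp (t : R) : icc 0 pi t -> exists2 nu, 0 <= dot (edir b) nu & half_plane c nu (p t).
  move=> /andP[t0 tpi]; have s0 : 0 <= sin t by apply: sin_ge0_pi; rewrite t0.
  have E : p t - c = r%:C * (cos t +i* (sgn b * sin t)).
    rewrite /p addrAC subrr add0r /cexp /w /= expR0 mul1r; congr (_ * (_ +i* _)).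
      by case: (b); rewrite /sgn ?mul1r // mulN1r cosN.
    by case: (b); rewrite /sgn ?mul1r // !mulN1r sinN.
  have [c0|c0] := ltP (cos t) 0.
    exists (-1); first by rewrite edir_left /slope invr_ge0.
    rewrite /half_plane /= E /dot !ReImE /=; nra.
  exists (normal b); first by rewrite edir_normal.
  rewrite half_plane_normalE E !ReImE /= !mul0r subr0 addr0.
  have -> : r * cos t + slope * sgn b * (r * (sgn b * sin t)) =
    r * (cos t + slope * (sgn b * sgn b) * sin t) by ring.
  rewrite sgn_sqr mulr1 mulr_gt0 //.
  have := cos2Dsin2 t; have : 0 < slope by rewrite /slope invr_gt0.
  move: c0; rewrite le_eqVlt => /orP[/eqP<-|c0] k0.
    rewrite expr0n add0r => /eqP; rewrite sqrf_eq1 => /orP[/eqP->|/eqP s1].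
      by rewrite add0r mulr1.
    by rewrite s1 in s0; lra.
  by move=> _; rewrite ltr_pwDl // mulr_ge0 // ltW.
set Q := expR (Re (c * z)) * nrm x * (normc z + 4 * normc z ^+ 2 * expR (normc z)).
pose g (t : R) := p' t *: (cexp (p t * z) *: scalar_family (p t) x) -
  w 1 *: (cexp (c * z) *: x).
have du : deriv_on (icc 0 pi) u g.
  move=> s Is eps eps0; have [nu e0 Hs] := Hp s Is.
  have [d d0 Hd] := ray_transform_path x (@scalar_pr nu) ler01 e0 (edir_time_lt0 b zc)
    (pquad s) Hs eps0.
  exists d => // t It td; have := Hd t td; rewrite -/(G b _) -/(G b _) /u /g.
  set a1 := G b (p t); set a2 := G b (p s); set y := w 1 *: _.
  set y' := p' s *: _.
  by have -> : a1 - t%:C *: y - (a2 - s%:C *: y) - (t - s)%:C *: (y' - y) =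
    a1 - a2 - (t - s)%:C *: y' by lmod.
have gQ t : icc 0 pi t -> nrm (g t) <= r * Q.
  move=> It; pose v := r%:C * cexp (w t) * z.
  have rne : r%:C * cexp (w t) != 0.
    by rewrite mulf_neq0 ?cexp_neq0 // -normc_gt0 normcC gtr0_norm.
  have -> : g t = (w 1 * cexp (c * z) * (cexp v - 1)) *: x.
    rewrite /g /scalar_family !scalerA -scalerBl; congr (_ *: _).
    have -> : p t - c = r%:C * cexp (w t) by rewrite /p addrAC subrr add0r.
    have -> : cexp (p t * z) = cexp (c * z) * cexp v.
      by rewrite -cexpD /v /p; congr cexp; ring.
    rewrite /p'; move: rne; set rr := r%:C; set W := cexp (w t) => rne.
    have -> : rr * (w 1 * W) = (rr * W) * w 1 by ring.
    move: rne; set rW := rr * W => rne.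
    by field.
  rewrite nrmZ (Normc.normcM (w 1 * _)) (Normc.normcM (w 1)) nw1 normr1 mul1r.
  rewrite (normc_cexp (c * z)).
  have nv : normc v = r * normc z.
    by rewrite /v (Normc.normcM (_ * _)) (Normc.normcM r%:C) nw mulr1 normcC gtr0_norm.
  have nz := normc_ge0 z.
  have vz : normc v <= normc z by rewrite nv ler_piMl.
  have H1 : normc (cexp v - 1) <= r * (normc z + 4 * normc z ^+ 2 * expR (normc z)).
    have := normc_distD (cexp v - 1) v 0; rewrite !subr0 => H.
    rewrite (le_trans H) // mulrDr addrC nv lerD2l (le_trans (cexp_sub1x _)) // nv.
    have E1 : expR (r * normc z) <= expR (normc z) by rewrite ler_expR -nv.
    have -> : 4 * (r * normc z) ^+ 2 * expR (r * normc z) =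
      r * (4 * normc z ^+ 2 * (r * expR (r * normc z))) by ring.
    rewrite ler_wpM2l ?(ltW r0) // ler_wpM2l ?mulr_ge0 ?sqr_ge0 //.
    by rewrite (le_trans _ E1) // ler_piMl // expR_ge0.
  have -> : r * Q = expR (Re (c * z)) *
    (r * (normc z + 4 * normc z ^+ 2 * expR (normc z))) * nrm x by rewrite /Q; ring.
  by rewrite ler_wpM2r ?nrm_ge0 // ler_wpM2l ?expR_ge0.
have := mvt_le (ltW ppi) du gQ; rewrite subr0 mulrC /u.
have -> : p pi = c - r%:C.
  have cb : cos (sgn b * pi) = -1 :> R.
    by case: (b); rewrite /sgn ?mul1r ?mulN1r ?cosN cospi.
  have sb : sin (sgn b * pi) = 0 :> R.
    by case: (b); rewrite /sgn ?mul1r ?mulN1r ?sinN sinpi ?oppr0.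
  by rewrite /p /cexp /w /= expR0 cb sb; apply: eqc; rewrite !ReImE /=; ring.
have -> : p 0 = c + r%:C.
  by rewrite /p (_ : w 0 = 0) ?cexp0 ?mulr1 // /w mulr0.
have -> : G b (c - r%:C) - pi%:C *: (w 1 *: (cexp (c * z) *: x)) -
  (G b (c + r%:C) - 0%:C *: (w 1 *: (cexp (c * z) *: x))) =
  G b (c - r%:C) - G b (c + r%:C) - (pi%:C * w 1) *: (cexp (c * z) *: x).
  by rewrite rmorph0 scale0r subr0; lmod.
by rewrite -wE.
Qed.

(** The transforms agree at [c - t], so by [circle] they differ at [c + t] by [2 pi i] times the
    right-hand side, up to [O(t)]. The contour does not depend on its vertex, so [t] may be taken
    arbitrarily small. *)
Lemma contour_scalar r : 0 < r ->
  contour z (scalar_family^~ x) (c + r%:C) = cexp (c * z) *: x.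
Proof.
have pi0 : (0 +i* (2 * pi) : R[i]) != 0.
  rewrite -normc_gt0 Defs.normcE /= expr0n add0r sqrtr_gt0 exprn_gt0 //.
  by rewrite mulr_gt0 // pi_gt0.
move=> r0; rewrite (@contour_vertex c z 1 _ x r 1) //; last first.
  exact: scalar_family_resolvent sectorial_vertex.
have vert t : 0 < t -> contour z (scalar_family^~ x) (c + 1%:C) =
    contour z (scalar_family^~ x) (c + t%:C).
  move=> t0; apply: contour_vertex => //.
  exact: scalar_family_resolvent sectorial_vertex.
apply/eqP; rewrite -subr_eq0; apply/eqP/nrm0_eq0; apply: le_nrm_eps.
move=> eps eps0; rewrite add0r.
set Q := pi * (expR (Re (c * z)) * nrm x *
    (normc z + 4 * normc z ^+ 2 * expR (normc z))).
have Q0 : 0 <= Q.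
  rewrite /Q mulr_ge0 ?pi_ge0 // mulr_ge0 ?mulr_ge0 ?nrm_ge0 ?expR_ge0 //.
  by rewrite addr_ge0 ?normc_ge0 // mulr_ge0 ?expR_ge0 // mulr_ge0 // sqr_ge0.
pose t := Num.min 1 (eps / (2 * Q + 1)).
have Q1 : 0 < 2 * Q + 1 by rewrite ltr_wpDl // mulr_ge0.
have t0 : 0 < t by rewrite lt_min ltr01 divr_gt0.
have t1 : t <= 1 by rewrite ge_min lexx.
have te : t * (2 * Q + 1) <= eps by rewrite -ler_pdivlMr // ge_min lexx orbT.
rewrite (vert t t0) /contour -/(G false _) -/(G true _).
have := circle true t0 t1; have := circle false t0 t1; rewrite (left_eq t0).
set g0 := G false (c - t%:C); set g1 := G false _; set g2 := G true _.
set y := cexp _ *: x => H1 H2.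
set W := 0 +i* (2 * pi) in pi0 *.
have W1 : 1 <= normc W.
  rewrite /W Defs.normcE /= expr0n add0r sqrtr_sqr ger0_norm ?mulr_ge0 ?pi_ge0 //.
  by have := pi_ge2 R; lra.
have -> : W^-1 *: (g1 - g2) - y = W^-1 *: (g1 - g2 - W *: y).
  by rewrite [RHS]scalerBr scalerA mulVf // scale1r.
rewrite nrmZ Normc.normcV.
have E : g1 - g2 - W *: y = (g0 - g2 - (0 +i* (sgn true * pi)) *: y) -
   (g0 - g1 - (0 +i* (sgn false * pi)) *: y).
  have -> : W = 0 +i* (sgn true * pi) - 0 +i* (sgn false * pi).
    by apply: eqc; rewrite !ReImE /= /sgn; ring.
  by lmod.
rewrite (@le_trans _ _ (nrm (g1 - g2 - W *: y))) //.
  by rewrite ler_piMl ?nrm_ge0 // invf_le1 // (lt_le_trans ltr01).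
rewrite E (le_trans (nrmB _ _)) // (le_trans (lerD H2 H1)) // (le_trans _ te) //.
rewrite /Q; lra.
Qed.
End scalar_family.
End contours.

(** * Linearity and bounds of the contour integral *)

Section contour_calculus.
Variables (R : realType) (X : normedModType R[i]).
Implicit Types (l z : R[i]) (x : X) (q : R[i] -> X) (b : bool) (s K Q : R).

Definition contour_integrand z q l b s : X :=
  cexp ((l + s%:C * edir R b) * z) *: q (l + s%:C * edir R b).

Definition integrable_contour z q l : Prop :=
  forall b, exists I, ray_int (contour_integrand z q l b) I.

Lemma integrable_contourD z q q' l : integrable_contour z q l ->
  integrable_contour z q' l -> integrable_contour z (fun l => q l + q' l) l.
Proof.
move=> Iq Iq' b; have [I HI] := Iq b; have [I' HI'] := Iq' b; exists (I + I').
by apply: ray_int_eq (ray_intD HI HI') => s _; rewrite /contour_integrand scalerDr.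
Qed.

Lemma integrable_contourM z q l (B : X -> X) (M : R) : linear B ->
  (forall x, nrm (B x) <= M * nrm x) ->
  integrable_contour z q l -> integrable_contour z (fun l => B (q l)) l.
Proof.
move=> linB BM Iq b; have [I HI] := Iq b; exists (B I).
by apply: ray_int_eq (ray_intM linB BM HI) => s _; rewrite /contour_integrand linZ.
Qed.

Lemma scaler_linear a : linear (fun x => a *: x).
Proof. by move=> k x y; rewrite scalerDr !scalerA mulrC. Qed.

Lemma scaler_bounded a x : nrm (a *: x) <= normc a * nrm x.
Proof. by rewrite nrmZ. Qed.

Lemma integrable_contourZ z q l a : integrable_contour z q l ->
  integrable_contour z (fun l => a *: q l) l.
Proof. exact: integrable_contourM (@scaler_linear a) (@scaler_bounded a). Qed.

Lemma contourD z q q' l : integrable_contour z q l -> integrable_contour z q' l ->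
  contour z (fun l => q l + q' l) l = contour z q l + contour z q' l.
Proof.
move=> Iq Iq'; rewrite /contour /ray_transform.
have H b : rint (contour_integrand z (fun l => q l + q' l) l b) =
    rint (contour_integrand z q l b) + rint (contour_integrand z q' l b).
  have [I HI] := Iq b; have [I' HI'] := Iq' b; rewrite (rintE HI) (rintE HI').
  apply: rintE; apply: ray_int_eq (ray_intD HI HI') => s _.
  by rewrite /contour_integrand scalerDr.
have := H true; have := H false; rewrite /contour_integrand => -> ->; lmod.
Qed.

Lemma contourM z q l (B : X -> X) (M : R) : linear B ->
  (forall x, nrm (B x) <= M * nrm x) -> integrable_contour z q l ->
  contour z (fun l => B (q l)) l = B (contour z q l).
Proof.
move=> linB BM Iq; rewrite /contour /ray_transform.
have H b : rint (contour_integrand z (fun l => B (q l)) l b) =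
    B (rint (contour_integrand z q l b)).
  have [I HI] := Iq b; rewrite (rintE HI).
  apply: rintE; apply: ray_int_eq (ray_intM linB BM HI) => s _.
  by rewrite /contour_integrand linZ.
have := H true; have := H false; rewrite /contour_integrand => -> ->.
by rewrite (linZ linB) (linS linB) !(linZ linB).
Qed.

Lemma contourZ z q l a : integrable_contour z q l ->
  contour z (fun l => a *: q l) l = a *: contour z q l.
Proof. exact: contourM (@scaler_linear a) (@scaler_bounded a). Qed.

Lemma contourB z q q' l : integrable_contour z q l -> integrable_contour z q' l ->
  contour z (fun l => q l - q' l) l = contour z q l - contour z q' l.
Proof.
move=> Iq Iq'; have Iq'' := integrable_contourZ (-1) Iq'.
have -> : (fun l => q l - q' l) = (fun l => q l + (-1) *: q' l).
  by apply/funext => m; rewrite scaleN1r.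
by rewrite contourD // contourZ // scaleN1r.
Qed.

Lemma eq_contour z z' q q' l :
  (forall b s, 0 <= s -> contour_integrand z q l b s = contour_integrand z' q' l b s) ->
  integrable_contour z q l -> contour z q l = contour z' q' l.
Proof.
move=> qq' Iq; rewrite /contour /ray_transform.
have H b : rint (contour_integrand z q l b) = rint (contour_integrand z' q' l b).
  have [I HI] := Iq b; rewrite (rintE HI); apply/esym/rintE.
  by apply: ray_int_eq HI => s; exact: qq'.
by have := H true; have := H false; rewrite /contour_integrand => -> ->.
Qed.

Lemma contour_bound z q l K sg : 0 < sg -> integrable_contour z q l ->
  (forall b s, 0 <= s -> nrm (contour_integrand z q l b s) <= K * expR (- (sg * s))) ->
  nrm (contour z q l) <= 2 * (K / sg).
Proof.
move=> sg0 Iq qK.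
have H b : nrm (ray_transform (edir R b) z q l) <= 2 * (K / sg).
  have [I HI] := Iq b; rewrite /ray_transform -/(contour_integrand z q l b) (rintE HI).
  rewrite scaleNr nrmN nrmZ ler_pM ?normc_ge0 ?nrm_ge0 ?normc_edir //.
  by apply: ray_int_bound HI => // s; exact: qK.
rewrite /contour nrmZ Normc.normcV.
have pi2 := pi_ge2 R.
have -> : normc (0 +i* (2 * pi) : R[i]) = 2 * pi.
  by rewrite Defs.normcE /= expr0n add0r sqrtr_sqr ger0_norm // mulr_ge0 ?pi_ge0.
rewrite mulrC ler_pdivrMr ?mulr_gt0 ?pi_gt0 //.
have := H true; have := H false.
set a := ray_transform _ _ _ _; set a' := ray_transform _ _ _ _.
have := nrmB a a'; have := nrm_ge0 a; nra.
Qed.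

Lemma contour_bound_cone z q l Q : time_cone z -> integrable_contour z q l ->
  (forall b s, 0 <= s -> nrm (q (l + s%:C * edir R b)) <= Q) ->
  nrm (contour z q l) <= 2 * (Q * expR (Re (l * z)) / (slope R / 2 * Re z)).
Proof.
move=> zc Iq qQ; have [z0 _] := zc.
have p0 : 0 < slope R / 2 * Re z by rewrite mulr_gt0 // divr_gt0 // invr_gt0.
apply: contour_bound => // b s s0; rewrite nrmZ normc_cexp Re_ray expRD.
rewrite mulrC -[leRHS]mulrA ler_pM ?nrm_ge0 ?mulr_ge0 ?expR_ge0 ?qQ //.
rewrite ler_wpM2l ?expR_ge0 // ler_expR.
have := ler_wpM2l s0 (edir_time b zc); lra.
Qed.

Lemma cexp_line_deriv (a d : R[i]) (x : X) : Re d <= 0 ->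
  deriv_on ici (fun s : R => cexp (a + s%:C * d) *: x)
    (fun s : R => (d * cexp (a + s%:C * d)) *: x).
Proof.
move=> d0 s s0 eps eps0.
pose C := 4 * normc d ^+ 2 * expR (normc d) * expR (Re a) * nrm x.
have C0 : 0 <= C.
  rewrite /C mulr_ge0 ?nrm_ge0 // mulr_ge0 ?expR_ge0 // mulr_ge0 ?expR_ge0 //.
  by rewrite mulr_ge0 // sqr_ge0.
have C1 : 0 < C + 1 by rewrite ltr_wpDl.
exists (Num.min 1 (eps / (C + 1))); first by rewrite lt_min ltr01 divr_gt0.
move=> t t0; rewrite lt_min => /andP[t1 t2].
have E : cexp (a + t%:C * d) = cexp (a + s%:C * d) * cexp ((t - s)%:C * d).
  by rewrite -cexpD; congr cexp; ring.
rewrite E; set A := cexp (a + s%:C * d); set W := (t - s)%:C * d.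
have -> : (A * cexp W) *: x - A *: x - (t - s)%:C *: ((d * A) *: x) =
  (A * (cexp W - 1 - W)) *: x by rewrite /W; lmod.
rewrite nrmZ (Normc.normcM A).
have nA : normc A <= expR (Re a).
  by rewrite /A normc_cexp ler_expR !ReImE /= mul0r subr0 gerDl mulr_ge0_le0.
have nW : normc W = `|t - s| * normc d by rewrite /W (Normc.normcM _%:C) normcC.
have nd := normc_ge0 d.
have nW1 : normc W <= normc d by rewrite nW ler_piMl // ltW.
have B : normc (cexp W - 1 - W) <= 4 * normc d ^+ 2 * expR (normc d) * `|t - s| ^+ 2.
  rewrite (le_trans (cexp_sub1x _)) // nW exprMn.
  have -> : 4 * (`|t - s| ^+ 2 * normc d ^+ 2) = 4 * normc d ^+ 2 * `|t - s| ^+ 2 by ring.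
  rewrite [leRHS]mulrAC ler_wpM2l ?mulr_ge0 ?sqr_ge0 // ler_expR -nW //.
have H := ler_pM (normc_ge0 A) (normc_ge0 _) nA B.
rewrite (le_trans (ler_wpM2r (nrm_ge0 x) H)) //.
have -> : expR (Re a) * (4 * normc d ^+ 2 * expR (normc d) * `|t - s| ^+ 2) * nrm x =
  C * `|t - s| * `|t - s| by rewrite /C; ring.
rewrite ler_wpM2r // (@le_trans _ _ ((C + 1) * `|t - s|)) //.
  by rewrite ler_wpM2r // lerDl.
by rewrite mulrC -ler_pdivlMr // ltW.
Qed.

(* Both rays contribute the same primitive [z^-1 *: cexp (l * z) *: x]. *)
Lemma contour_cst z l x : time_cone z ->
  integrable_contour z (fun=> x) l /\ contour z (fun=> x) l = 0.
Proof.
move=> zc; have [z0 _] := zc.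
have zn0 : z != 0 by apply/eqP => ze; move: z0; rewrite ze ltxx.
have H b : ray_int (contour_integrand z (fun=> x) l b)
    (- ((edir R b * z)^-1 * cexp (l * z)) *: x).
  have ez := edir_time_lt0 b zc.
  have dn0 : edir R b * z != 0 by apply/eqP => de; move: ez; rewrite de ltxx.
  set d := edir R b * z in dn0 ez *.
  have T : tends_to (fun s : R => cexp (l * z + s%:C * d) *: (d^-1 *: x)) 0.
    pose K := expR (Re (l * z)) * nrm (d^-1 *: x).
    have K0 : 0 <= K by rewrite mulr_ge0 ?expR_ge0 ?nrm_ge0.
    move=> e e0; exists (Num.max 0 (K / e / (- Re d))) => s.
    rewrite ge_max => /andP[s0 Ks]; rewrite subr0 nrmZ normc_cexp.
    have -> : Re (l * z + s%:C * d) = Re (l * z) - (- Re d) * s.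
      by rewrite ReD !ReM /= mul0r; ring.
    rewrite expRD mulrAC -/K expRN ler_pdivrMr ?expR_gt0 //.
    rewrite mulrC -ler_pdivrMr //.
    rewrite ler_pdivrMr ?oppr_gt0 // in Ks.
    by have := expR_ge1Dx (- Re d * s); lra.
  have := ray_int_ftc (cexp_line_deriv (l * z) (d^-1 *: x) (ltW ez)) T.
  rewrite mul0r addr0 sub0r scalerA -scaleNr (mulrC _ d^-1).
  apply: ray_int_eq => s s0; rewrite /contour_integrand scalerA.
  congr (_ *: _); rewrite mulrAC divff // mul1r; congr cexp.
  by rewrite /d; ring.
split=> [b|]; first by eexists; exact: H.
rewrite /contour /ray_transform.
have E b : - edir R b *: rint (contour_integrand z (fun=> x) l b) =
    (z^-1 * cexp (l * z)) *: x.
  rewrite (rintE (H b)) scalerA mulrNN mulrA; congr ((_ * _) *: _).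
  have en0 : edir R b != 0.
    by apply/eqP => -[_] /eqP; case: (b); rewrite /sgn ?oppr_eq0 oner_eq0.
  by field; rewrite en0 zn0.
have := E true; have := E false; rewrite /contour_integrand => -> ->.
by rewrite subrr scaler0.
Qed.

End contour_calculus.

(** * The semigroup *)

Section semigroup_estimates.
Variables (R : realType) (X : normedModType R[i]).
Hypothesis cX : fast_complete X.
Variables (c0 M : R) (J : R[i] -> X -> X).
Let c : R[i] := c0%:C.
Hypothesis M0 : 0 <= M.
Hypothesis HJ : pseudo_resolvent c M (sectorial c) J.
Implicit Types (l z w : R[i]) (x y : X) (b : bool) (s r : R).

Let Jb b : pseudo_resolvent c M (half_plane c (normal R b)) J.
Proof. exact: pseudo_resolvent_sub (@half_plane_sectorial _ c b) HJ. Qed.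

Let edn b : 0 <= dot (edir R b) (normal R b).
Proof. by rewrite edir_normal. Qed.

Lemma ray_sectorial b s r : 0 < r -> 0 <= s ->
  half_plane c (normal R b) (c + r%:C + s%:C * edir R b) /\
  r / 2 <= normc (c + r%:C + s%:C * edir R b - c).
Proof.
move=> r0 s0; have Hr := half_plane_real c b r0.
have [H1 H2] := half_plane_ray (edn b) s0 Hr; split=> //.
apply: le_trans H2; rewrite addrAC subrr add0r /dot /= mul0r addr0 mulr1.
have /andP[n0 n2] := normc_normal R b.
by rewrite ler_wpM2l ?(ltW r0) // lef_pV2 ?posrE.
Qed.

Lemma J_ray_bound b s r x : 0 < r -> 0 <= s ->
  nrm (J (c + r%:C + s%:C * edir R b) x) <= 2 * M / r * nrm x.
Proof.
move=> r0 s0; have [Hs ds] := ray_sectorial b r0 s0.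
have r2 : 0 < r / 2 by rewrite divr_gt0.
have := pr_bound (Jb b) x Hs r2 ds.
by have -> : M / (r / 2) = 2 * M / r by field; exact: lt0r_neq0.
Qed.

Lemma J_integrable z x r : time_cone z -> 0 < r ->
  integrable_contour z (J^~ x) (c + r%:C).
Proof.
move=> zc r0 b; exists (rint (contour_integrand z (J^~ x) (c + r%:C) b)).
have H := pr_ray_int cX (Jb b) M0 (edn b) (edir_time_lt0 b zc) x (half_plane_real c b r0).
exact: H.
Qed.

(* The half rate of decay is lost to the factor [l]. *)
Lemma lJ_integrable z x r : time_cone z -> 0 < r ->
  integrable_contour z (fun l => l *: J l x) (c + r%:C).
Proof.
move=> zc r0 b; have ez := edir_time_lt0 b zc.
have D := pr_exp_decaying (Jb b) M0 (edn b) ez x (half_plane_real c b r0).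
have e0 : 0 < - Re (edir R b * z) / 2 by rewrite divr_gt0 // oppr_gt0.
have := decayingZ _ D (cdecaying_affine (c + r%:C) (edir R b) e0).
have -> : - Re (edir R b * z) + - (- Re (edir R b * z) / 2) =
  - Re (edir R b * z) / 2 by field.
move=> /(_ (ltW _))/(ray_int_ex cX e0)[]; first by rewrite oppr_gt0.
move=> I HI; exists I; apply: ray_int_eq HI => s s0.
by rewrite /contour_integrand !scalerA mulrC.
Qed.

Definition sg_op z x : X := contour z (J^~ x) (c + 1%:C).
(** The derivative of [sg_op] in [z], taken under the integral sign; for a resolvent it is also the
    image of [sg_op z x] under the operator. *)
Definition sg_der z x : X := contour z (fun l => l *: J l x) (c + 1%:C).

Lemma sg_op_vertex z x r : time_cone z -> 0 < r ->
  sg_op z x = contour z (J^~ x) (c + r%:C).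
Proof. by move=> zc r0; apply: contour_vertex HJ M0 zc _ r0. Qed.

Let JlinZ l (a : R[i]) x : sectorial c l -> J l (a *: x) = a *: J l x.
Proof. by have [LJ _ _] := HJ => /LJ H; rewrite (linZ H). Qed.

Let on_ray b s : 0 <= s -> sectorial c (c + 1%:C + s%:C * edir R b).
Proof.
by move=> s0; have [Hs _] := ray_sectorial b ltr01 s0; exact: half_plane_sectorial Hs.
Qed.

Lemma sg_op_linear z : time_cone z -> linear (sg_op z).
Proof.
move=> zc a x y; have Ix := J_integrable x zc ltr01; have Iy := J_integrable y zc ltr01.
rewrite /sg_op -contourZ // -contourD //; last exact: integrable_contourZ.
have [LJ _ _] := HJ; apply: eq_contour (J_integrable _ zc ltr01) => b s s0.
by rewrite /contour_integrand (LJ _ (on_ray b s0)).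
Qed.

Lemma sg_der_linear z : time_cone z -> linear (sg_der z).
Proof.
move=> zc a x y; have Ix := lJ_integrable x zc ltr01; have Iy := lJ_integrable y zc ltr01.
rewrite /sg_der -contourZ // -contourD //; last exact: integrable_contourZ.
have [LJ _ _] := HJ; apply: eq_contour (lJ_integrable _ zc ltr01) => b s s0.
by rewrite /contour_integrand (LJ _ (on_ray b s0)); lmod.
Qed.

Let rez z r : Re ((c + r%:C) * z) = c0 * Re z + r * Re z.
Proof. by rewrite ReM ReD ImD /=; ring. Qed.

Lemma sg_op_bound : exists2 C, 0 <= C & forall z x, time_cone z ->
  nrm (sg_op z x) <= C * expR (c0 * Re z) * nrm x.
Proof.
pose C := 2 * (2 * M * expR 1 / (slope R / 2)).
have k0 : 0 < slope R / 2 by rewrite divr_gt0 // invr_gt0.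
exists C; first by rewrite mulr_ge0 // divr_ge0 ?(ltW k0) // !mulr_ge0 ?expR_ge0.
(* At distance [1 / Re z] from [c], the factor [Re z] in the bound of [J] cancels the [1 / Re z]
   from the integration along the rays, and the exponential only gains the factor [expR 1]. *)
move=> z x zc; have [z0 _] := zc; have r0 : 0 < (Re z)^-1 by rewrite invr_gt0.
rewrite (sg_op_vertex x zc r0).
have qQ b s : 0 <= s -> nrm (J (c + (Re z)^-1%:C + s%:C * edir R b) x) <=
    2 * M / (Re z)^-1 * nrm x by move=> s0; exact: J_ray_bound.
apply: le_trans (contour_bound_cone zc (J_integrable x zc r0) qQ) _.
rewrite rez mulVf ?lt0r_neq0 // expRD invrK.
rewrite le_eqVlt; apply/orP; left; apply/eqP; rewrite /C.
by field; rewrite !lt0r_neq0 // slope_gt0.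
Qed.

Lemma sg_der_bound z : time_cone z -> exists2 C, 0 <= C & forall x,
  nrm (sg_der z x) <= C * nrm x.
Proof.
move=> zc; have [z0 _] := zc.
have k0 : 0 < slope R / 2 by rewrite divr_gt0 // invr_gt0.
pose g := slope R / 2 * Re z; have g0 : 0 < g by rewrite mulr_gt0.
have g2 : 0 < g / 2 by rewrite divr_gt0.
pose E := expR (Re ((c + 1%:C) * z)); have E0 : 0 <= E := expR_ge0 _.
(* [normc l] grows linearly along the rays: [L * expR (g / 2 * s)] dominates it and uses up half of
   the rate [g]. *)
pose L := normc (c + 1%:C) + 2 / (g / 2).
have L0 : 0 <= L by rewrite addr_ge0 ?normc_ge0 // divr_ge0 // ltW.
pose K := L * E * (2 * M); have K0 : 0 <= K by rewrite !mulr_ge0.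
exists (2 * (K / (g / 2))); first by rewrite mulr_ge0 // divr_ge0 // ltW.
move=> x; have -> : 2 * (K / (g / 2)) * nrm x = 2 * (K * nrm x / (g / 2)) by ring.
apply: contour_bound => //; first exact: lJ_integrable.
move=> b s s0; rewrite !nrmZ normc_cexp Re_ray expRD -/E.
have e1 : expR (s * Re (edir R b * z)) <= expR (- (g * s)).
  by rewrite ler_expR; have := ler_wpM2l s0 (edir_time b zc); rewrite -/g; lra.
have J1 := J_ray_bound b x ltr01 s0; rewrite divr1 in J1.
have l1 : normc (c + 1%:C + s%:C * edir R b) <= L * expR (g / 2 * s).
  rewrite (le_trans (le_normcD _ _)) // mulrDl lerD //.
    by rewrite ler_peMr ?normc_ge0 // -[leLHS]expR0 ler_expR mulr_ge0 // ltW.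
  rewrite (Normc.normcM s%:C) normcC ger0_norm //.
  have h1 : g / 2 * s <= expR (g / 2 * s) by have := expR_ge1Dx (g / 2 * s); lra.
  have h2 : s <= expR (g / 2 * s) / (g / 2) by rewrite ler_pdivlMr // mulrC.
  have -> : 2 / (g / 2) * expR (g / 2 * s) = expR (g / 2 * s) / (g / 2) * 2 by ring.
  by rewrite ler_pM ?normc_ge0 // normc_edir.
have -> : K * nrm x * expR (- (g / 2 * s)) =
    E * expR (- (g * s)) * (L * expR (g / 2 * s) * (2 * M * nrm x)).
  have -> : - (g / 2 * s) = - (g * s) + g / 2 * s by field.
  by rewrite expRD /K; ring.
apply: ler_pM; rewrite ?mulr_ge0 ?normc_ge0 ?nrm_ge0 ?expR_ge0 //.
  by rewrite ler_wpM2l.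
by apply: ler_pM; rewrite ?normc_ge0 ?nrm_ge0.
Qed.

Lemma sg_op_comm z x (B : X -> X) (N : R) : time_cone z -> linear B ->
  (forall x, nrm (B x) <= N * nrm x) ->
  (forall l x, sectorial c l -> J l (B x) = B (J l x)) ->
  sg_op z (B x) = B (sg_op z x).
Proof.
move=> zc linB BN comm; rewrite /sg_op.
rewrite -(contourM linB BN (J_integrable x zc ltr01)).
apply: eq_contour (J_integrable (B x) zc ltr01) => b s s0.
by rewrite /contour_integrand comm //; exact: on_ray.
Qed.

Lemma J_comm l m x : sectorial c l -> sectorial c m -> J l (J m x) = J m (J l x).
Proof.
move=> Hl Hm; have [->//|lm] := eqVneq l m.
have [_ _ RJ] := HJ; have := RJ l m x Hl Hm; have := RJ m l x Hm Hl.
move=> e1 e2; have : (m - l) *: (J l (J m x) - J m (J l x)) = 0.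
  rewrite scalerBr -e2 -[X in _ - X]opprK -scaleNr opprB -e1; lmod.
move=> /eqP; rewrite scaler_eq0 subr_eq0 eq_sym (negPf lm) /= subr_eq0.
by move/eqP.
Qed.

Let J_bdd m x : sectorial c m -> nrm (J m x) <= M / normc (m - c) * nrm x.
Proof.
move=> Hm; have [_ BJ _] := HJ; have := BJ m x Hm.
have m0 : 0 < normc (m - c).
  rewrite normc_gt0 subr_eq0; apply/eqP => mc.
  by move: Hm; rewrite mc; exact: sectorial_vertex.
by rewrite mulrAC ler_pdivlMr // mulrC.
Qed.

Lemma sg_op_J z m x : time_cone z -> sectorial c m ->
  sg_op z (J m x) = J m (sg_op z x).
Proof.
move=> zc Hm; have [LJ _ _] := HJ.
apply: sg_op_comm (LJ m Hm) (fun y => J_bdd y Hm) _ => // l y Hl.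
exact: J_comm.
Qed.

(** For a resolvent this says that the operator sends [sg_op z x] to [sg_der z x]. Under the
    integral, the resolvent identity produces [J l x - J m x], and the constant [J m x] integrates
    to 0 by [contour_cst]. *)
Lemma sg_derE z m x : time_cone z -> sectorial c m ->
  J m (m *: sg_op z x - sg_der z x) = sg_op z x.
Proof.
move=> zc Hm; have [LJ _ RJ] := HJ.
have Ix := J_integrable x zc ltr01; have Ilx := lJ_integrable x zc ltr01.
have Imx := integrable_contourZ m Ix.
have Iml := integrable_contourD Imx (integrable_contourZ (-1) Ilx).
have [Ic c00] := contour_cst (c + 1%:C) (J m x) zc.
have -> : m *: sg_op z x - sg_der z x =
    contour z (fun l => m *: J l x + -1 *: (l *: J l x)) (c + 1%:C).
  by rewrite contourD ?contourZ // ?scaleN1r //; exact: integrable_contourZ.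
rewrite -(contourM (LJ m Hm) (fun y => J_bdd y Hm) Iml).
have -> : sg_op z x = contour z (fun l => J l x - J m x) (c + 1%:C).
  by rewrite contourB // c00 subr0.
apply: eq_contour => [b s s0|]; last exact: integrable_contourM (LJ m Hm) (fun y => J_bdd y Hm) Iml.
rewrite /contour_integrand; congr (_ *: _).
have Hl := on_ray b s0; set l := c + 1%:C + _ in Hl *.
rewrite (RJ l m x Hl Hm) (J_comm x Hl Hm) -(JlinZ (m - l) (J l x) Hm).
by congr (J m _); lmod.
Qed.

(** The hypothesis is met by [x] in the domain and [y = A x - c *: x]. The difference with the
    scalar family is then of second order in the inverse of [normc (l - c)], which gains a factor
    [Re z] for a vertex at distance [1 / Re z]; the scalar family itself contributes exactly the
    exponential term. *)
Lemma sg_op_near : exists2 C, 0 <= C & forall z x y, time_cone z ->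
  (forall l, sectorial c l -> J l x - (l - c)^-1 *: x = (l - c)^-1 *: J l y) ->
  nrm (sg_op z x - cexp (c * z) *: x) <= C * Re z * expR (c0 * Re z) * nrm y.
Proof.
pose C := 2 * (4 * M * expR 1 / (slope R / 2)).
have k0 : 0 < slope R / 2 by rewrite divr_gt0 // invr_gt0.
exists C; first by rewrite mulr_ge0 // divr_ge0 ?(ltW k0) // !mulr_ge0 ?expR_ge0.
move=> z x y zc xy; have [z0 _] := zc; have r0 : 0 < (Re z)^-1 by rewrite invr_gt0.
have Ix := J_integrable x zc r0.
rewrite (sg_op_vertex x zc r0) -(contour_scalar cX c x zc r0).
have SF := @scalar_family_resolvent R X c (sectorial c) (@sectorial_vertex R c).
have Is : integrable_contour z ((scalar_family c)^~ x) (c + (Re z)^-1%:C).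
  move=> b; exists (rint (contour_integrand z ((scalar_family c)^~ x)
    (c + (Re z)^-1%:C) b)).
  have SFb := pseudo_resolvent_sub (@half_plane_sectorial _ c b) SF.
  have H := pr_ray_int cX SFb ler01 (edn b) (edir_time_lt0 b zc) x
    (half_plane_real c b r0).
  exact: H.
rewrite -contourB //.
have Id := integrable_contourD Ix (integrable_contourZ (-1) Is).
have {}Id : integrable_contour z (fun l => J l x - scalar_family c l x) (c + (Re z)^-1%:C).
  move=> b; have [I HI] := Id b; exists I; apply: ray_int_eq HI => s _.
  by rewrite /contour_integrand scaleN1r.
have H b s : 0 <= s -> nrm (J (c + (Re z)^-1%:C + s%:C * edir R b) x -
    scalar_family c (c + (Re z)^-1%:C + s%:C * edir R b) x) <=
    2 * Re z * (2 * M * Re z * nrm y).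
  move=> s0; have [Hs ds] := ray_sectorial b r0 s0.
  rewrite /scalar_family xy; last exact: half_plane_sectorial Hs.
  rewrite nrmZ Normc.normcV; apply: ler_pM; rewrite ?invr_ge0 ?normc_ge0 ?nrm_ge0 //.
    rewrite invf_ple ?posrE ?mulr_gt0 //; last by rewrite (lt_le_trans _ ds) // divr_gt0.
    by rewrite invfM mulrC.
  by have := J_ray_bound b y r0 s0; rewrite invrK.
apply: le_trans (contour_bound_cone zc Id H) _.
rewrite rez mulVf ?lt0r_neq0 // expRD.
rewrite le_eqVlt; apply/orP; left; apply/eqP; rewrite /C.
by field; rewrite !lt0r_neq0 // slope_gt0.
Qed.

Lemma sg_op_deriv z : time_cone z -> exists C rho : R, [/\ 0 <= C, 0 < rho &
  forall w x, normc w < rho -> time_cone (z + w) ->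
    nrm (sg_op (z + w) x - sg_op z x - w *: sg_der z x) <= C * normc w ^+ 2 * nrm x].
Proof.
move=> zc; have [z0 _] := zc.
have k0 : 0 < slope R / 2 by rewrite divr_gt0 // invr_gt0.
pose g := slope R / 2 * Re z; have g0 : 0 < g by rewrite mulr_gt0.
pose l0 := c + 1%:C; pose n0 := normc l0.
have n00 : 0 <= n0 := normc_ge0 _.
pose E := expR (Re (l0 * z)); have E0 : 0 <= E := expR_ge0 _.
(* Two factors [expR (e * s)] bound [normc l ^ 2], and [expR (2 * e * s)] comes from the exponential
   of [normc (l * w)]: in total [4 * e = g / 2], half of the available rate. *)
pose rho := g / 8; have rho0 : 0 < rho by rewrite divr_gt0.
pose e := g / 8; have e0 : 0 < e by rewrite divr_gt0.
pose L := n0 + 2 / e; have L0 : 0 <= L by rewrite addr_ge0 // divr_ge0 // ltW.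
pose K := E * (4 * L ^+ 2 * expR (n0 * rho)) * (2 * M).
have K0 : 0 <= K by rewrite !mulr_ge0 ?sqr_ge0 ?expR_ge0.
have g2 : 0 < g / 2 by rewrite divr_gt0.
exists (2 * (K / (g / 2))), rho; split=> //.
  by rewrite mulr_ge0 // divr_ge0 // ltW.
move=> w x wr zwc; have nw0 := normc_ge0 w.
pose q l := cexp (l * w) *: J l x.
have EqI b s : contour_integrand (z + w) (J^~ x) l0 b s = contour_integrand z q l0 b s.
  by rewrite /contour_integrand /q mulrDr cexpD scalerA.
have Iz := J_integrable x zc ltr01; have Iw := J_integrable x zwc ltr01.
have Il := lJ_integrable x zc ltr01.
have Iq : integrable_contour z q l0.
  by move=> b; have [I HI] := Iw b; exists I; apply: ray_int_eq HI => s _; rewrite -EqI.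
have -> : sg_op (z + w) x = contour z q l0 by apply: eq_contour.
rewrite /sg_op /sg_der -/l0 -/c -contourZ //.
have IN1 := integrable_contourZ (-1) Iz.
have IN2 := integrable_contourZ (-1) (integrable_contourZ w Il).
have H1 : contour z q l0 - contour z (J^~ x) l0 - contour z (fun l => w *: (l *: J l x)) l0
  = contour z (fun l => q l + -1 *: J l x + -1 *: (w *: (l *: J l x))) l0.
  rewrite contourD //; last exact: integrable_contourD.
  rewrite contourD // !(@contourZ _ _ _ _ _ (-1)) ?scaleN1r //.
  exact: integrable_contourZ.
rewrite H1.
have -> : 2 * (K / (g / 2)) * normc w ^+ 2 * nrm x =
  2 * (K * normc w ^+ 2 * nrm x / (g / 2)) by ring.
apply: contour_bound => //.
  by apply: integrable_contourD => //; exact: integrable_contourD.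
move=> b s s0; rewrite /contour_integrand /q.
set l := l0 + s%:C * edir R b.
have -> : cexp (l * w) *: J l x + -1 *: J l x + -1 *: (w *: (l *: J l x)) =
  (cexp (l * w) - 1 - l * w) *: J l x by lmod.
rewrite !nrmZ normc_cexp {1}/l Re_ray expRD -/E.
have e1 : expR (s * Re (edir R b * z)) <= expR (- (g * s)).
  by rewrite ler_expR; have := ler_wpM2l s0 (edir_time b zc); rewrite -/g; lra.
have J1 := J_ray_bound b x ltr01 s0; rewrite divr1 in J1.
have nl : normc l <= n0 + 2 * s.
  rewrite (le_trans (le_normcD _ _)) // lerD2l (Normc.normcM s%:C) normcC ger0_norm //.
  by rewrite mulrC ler_wpM2r // normc_edir.
have l1 : normc l <= L * expR (e * s).
  have h0 : 1 <= expR (e * s) by rewrite -expR0 ler_expR mulr_ge0 // ltW.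
  have h1 : e * s <= expR (e * s) by have := expR_ge1Dx (e * s); lra.
  have h2 : s <= expR (e * s) / e by rewrite ler_pdivlMr // mulrC.
  have h3 := ler_wpM2l n00 h0; rewrite /L.
  have -> : (n0 + 2 / e) * expR (e * s) = n0 * expR (e * s) + 2 * (expR (e * s) / e) by ring.
  lra.
have lw : normc (l * w) <= n0 * rho + 2 * e * s.
  rewrite Normc.normcM (le_trans (ler_pM (normc_ge0 _) nw0 nl (ltW wr))) //.
  by rewrite /rho /e; lra.
have x1 : normc (cexp (l * w) - 1 - l * w) <=
    4 * L ^+ 2 * expR (n0 * rho) * normc w ^+ 2 * expR (4 * e * s).
  rewrite (le_trans (cexp_sub1x _)) // (Normc.normcM l w).
  have -> : 4 * L ^+ 2 * expR (n0 * rho) * normc w ^+ 2 * expR (4 * e * s) =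
    4 * (L * expR (e * s) * normc w) ^+ 2 * expR (n0 * rho + 2 * e * s).
    have -> : 4 * e * s = e * s + e * s + 2 * e * s by ring.
    by rewrite !expRD; ring.
  apply: ler_pM; [by rewrite mulr_ge0 // sqr_ge0 | exact: expR_ge0 | |].
    rewrite ler_wpM2l // ler_sqr ?nnegrE ?mulr_ge0 ?normc_ge0 ?expR_ge0 //.
    by rewrite ler_wpM2r.
  by rewrite ler_expR -Normc.normcM.
have -> : K * normc w ^+ 2 * nrm x * expR (- (g / 2 * s)) =
  E * expR (- (g * s)) * (4 * L ^+ 2 * expR (n0 * rho) * normc w ^+ 2 * expR (4 * e * s) *
    (2 * M * nrm x)).
  have -> : - (g / 2 * s) = - (g * s) + 4 * e * s by rewrite /e; field.
  by rewrite expRD /K; ring.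
apply: ler_pM; rewrite ?mulr_ge0 ?normc_ge0 ?nrm_ge0 ?expR_ge0 //.
  by rewrite ler_wpM2l.
by apply: ler_pM; rewrite ?normc_ge0 ?nrm_ge0.
Qed.

End semigroup_estimates.

(** * Extension of the resolvent and density of the domain *)

Section resolvents.
Variables (R : realType) (X : normedModType R[i]) (A : unbounded_operator X).
Implicit Types (l m z : R[i]) (x y : X) (S : X -> X).

Lemma bounded_linearP S : bounded_linear S <->
  linear S /\ exists M : R, forall x, nrm (S x) <= M * nrm x.
Proof.
have E (M : R) x : (`|S x| <= M%:C * `|x|) = (nrm (S x) <= M * nrm x).
  by rewrite !nrmE -rmorphM lecR.
by split=> -[LS [M SM]]; split=> //; exists M => x; have := SM x; rewrite E.
Qed.

Lemma is_resolvent_unique z S S' : is_resolvent A z S -> is_resolvent A z S' -> S = S'.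
Proof.
move=> [_ _ HS] [_ HS' _]; apply/funext => x; have [dx ex] := HS' x.
by rewrite -[in LHS]ex HS.
Qed.

Lemma resolventP z : resolvent_set A z -> is_resolvent A z (resolvent A z).
Proof. by move=> [S HS]; rewrite /resolvent; exact: getI HS. Qed.

Lemma resolventE z S : is_resolvent A z S -> resolvent A z = S.
Proof. by move=> HS; exact: is_resolvent_unique (resolventP (ex_intro _ S HS)) HS. Qed.

Lemma resolvent_identity l m x : resolvent_set A l -> resolvent_set A m ->
  resolvent A l x - resolvent A m x = (m - l) *: resolvent A l (resolvent A m x).
Proof.
move=> /resolventP[[Ll _] _ Hl] /resolventP[_ Hm _].
have [dv ev] := Hm x; set v := resolvent A m x in dv ev *.
have -> : x = (m - l) *: v + (l *: v - A v) by rewrite -ev; lmod.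
by rewrite (linD Ll) (linZ Ll) Hl // addrK.
Qed.

Lemma resolvent_inj z x : resolvent_set A z -> resolvent A z x = 0 -> x = 0.
Proof.
move=> /resolventP[[L _] H1 _] x0.
have [d0 e0] := H1 0; rewrite (lin0 L) in d0 e0.
by have [_ e] := H1 x; rewrite x0 in e; rewrite -e.
Qed.

Lemma dom_resolvent z x : resolvent_set A z ->
  dom A x -> resolvent A z (z *: x - A x) = x.
Proof. by move=> /resolventP[_ _]; exact. Qed.

Lemma resolvent_dom z x : resolvent_set A z -> dom A (resolvent A z x).
Proof. by move=> /resolventP[_ H _]; have [] := H x. Qed.

Lemma op_resolvent z x : resolvent_set A z ->
  A (resolvent A z x) = z *: resolvent A z x - x.
Proof.
move=> /resolventP[_ H _]; have [_ e] := H x.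
by rewrite -[X in _ = _ - X]e; lmod.
Qed.

Hypothesis cX : fast_complete X.

(** The iteration [u n.+1 = y + B (u n)] contracts by [2^-1], the ratio for which [fast_complete] is
    stated. *)
Lemma neumann_inverse (B : X -> X) : linear B -> (forall x, nrm (B x) <= 2^-1 * nrm x) ->
  exists V : X -> X, [/\ linear V, forall x, V x - B (V x) = x,
    forall x, V (x - B x) = x & forall x, nrm (V x) <= 2 * nrm x].
Proof.
move=> LB HB.
have inj x y : x - B x = y - B y -> x = y.
  move=> e; apply/eqP; rewrite -subr_eq0; apply/eqP/nrm0_eq0.
  have : x - y = B (x - y).
    by rewrite linS // -{1}(subrK (B x) x) e; lmod.
  move=> e'; have := HB (x - y); rewrite -e'; have := nrm_ge0 (x - y); lra.
have ex y : exists v, v - B v = y.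
  pose u := fix u n := if n is n'.+1 then y + B (u n') else y.
  have [|l Hl] := cX (u := u) (C := 2^-1 * nrm y).
    elim=> [|n IH]; first by rewrite /= expr0 mulr1 addrAC subrr add0r.
    have -> : u n.+2 - u n.+1 = B (u n.+1 - u n) by rewrite linS //=; lmod.
    rewrite (le_trans (HB _)) // exprS mulrCA ler_wpM2l ?invr_ge0 //.
  exists l; apply/eqP; rewrite -subr_eq0; apply/eqP/nrm0_eq0; apply: le_nrm_eps.
  move=> e e0; rewrite add0r.
  have [n Hn] := half_pow_small (2 * nrm y) e0.
  have -> : l - B l - y = (l - u n.+1) + B (u n - l) by rewrite linS //=; lmod.
  have h1 := Hl n; have h2 := Hl n.+1; have h3 := HB (u n - l).
  rewrite nrm_distC in h2; rewrite exprS in h2.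
  have p : 0 <= (2^-1 : R) ^+ n by rewrite exprn_ge0 // invr_ge0.
  have := mulr_ge0 p (nrm_ge0 y).
  rewrite (le_trans (nrmD _ _)) //; lra.
have [V HV] := choice ex; exists V; split=> //.
- move=> a x y; apply: inj; rewrite HV (LB a) -[in LHS](HV x) -[in LHS](HV y); lmod.
- by move=> x; apply: inj; rewrite HV.
- move=> x; have := nrm_distl (V x) (x); rewrite -[X in V x - X](HV x).
  have -> : V x - (V x - B (V x)) = B (V x) by lmod.
  have := HB (V x); lra.
Qed.

(** [z - A] is [z0 - A] followed by [id - B], where [B] is [z0 - z] times [S0], of norm at most
    [2^-1]. *)
Lemma neumann_resolvent z0 z S0 (m : R) : is_resolvent A z0 S0 ->
  (forall x, nrm (S0 x) <= m * nrm x) -> normc (z - z0) * m <= 2^-1 ->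
  resolvent_set A z /\ forall x, nrm (resolvent A z x) <= 2 * m * nrm x.
Proof.
move=> [[L0 _] H1 H2] S0m zm.
pose B x := (z0 - z) *: S0 x.
have LB : linear B by move=> a x y; rewrite /B (L0 a); lmod.
have HB x : nrm (B x) <= 2^-1 * nrm x.
  rewrite nrmZ -normcN opprB (le_trans (ler_wpM2l (normc_ge0 _) (S0m x))) //.
  by rewrite mulrA ler_wpM2r ?nrm_ge0.
have [V [LV V1 V2 V3]] := neumann_inverse LB HB.
have SV x : nrm (S0 (V x)) <= 2 * m * nrm x.
  (* The sign of [m] is not given; a nonzero vector forces it. *)
  have [n0|n0] := eqVneq (nrm x) 0.
    have -> : x = 0 by apply: nrm0_eq0; rewrite n0.
    by rewrite (lin0 LV) (lin0 L0) !nrm0 mulr0.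
  have m0 : 0 <= m.
    by have := le_trans (nrm_ge0 _) (S0m x); rewrite pmulr_lge0 // lt_neqAle eq_sym n0 nrm_ge0.
  rewrite (le_trans (S0m _)) // -mulrA mulrCA ler_wpM2l //.
have HS : is_resolvent A z (S0 \o V).
  split.
  - apply/bounded_linearP; split; last by exists (2 * m); exact: SV.
    by move=> a x y; rewrite /= (LV a) (L0 a).
  - move=> x; have [d e] := H1 (V x); split=> //=.
    rewrite -[RHS]V1 /B -[X in _ = X - _]e; lmod.
  - move=> x dx /=; rewrite -[RHS](H2 x dx); congr S0.
    by rewrite -[RHS]V2 /B (H2 x dx); congr V; lmod.
by split; [exists (S0 \o V)|move=> x; rewrite (resolventE HS); exact: SV].
Qed.

Variable c0 : R.
Let c : R[i] := c0%:C.
Hypothesis half_plane_resolvent : forall z, c0 < Re z ->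
  resolvent_set A z /\ forall x, nrm (resolvent A z x) <= 2 / normc (z - c) * nrm x.

Lemma sectorial_resolvent z : sectorial c z ->
  resolvent_set A z /\ forall x, normc (z - c) * nrm (resolvent A z x) <= 8 * nrm x.
Proof.
rewrite /sectorial /= /slope => Hz; have [z0|z0] := ltP 0 (Re (z - c)).
  have zc : c0 < Re z by move: z0; rewrite !ReImE /=; lra.
  have [H1 H2] := half_plane_resolvent zc; split=> // x.
  have n0 : 0 < normc (z - c).
    by rewrite (lt_le_trans z0) // (le_trans (ler_norm _)) // Re_le_normc.
  rewrite mulrC -ler_pdivlMr // (le_trans (H2 x)) // mulrAC ler_wpM2r ?invr_ge0 ?(ltW n0) //.
  by have := nrm_ge0 x; lra.
set a := Re (z - c) in Hz z0; set b := Im (z - c) in Hz.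
have b0 : 0 < `|b| by lra.
(* The centre of the expansion has the height of [z] and lies as far to the right of the line as [z]
   may lie to its left: the distance is at most [|b| / 4], against a resolvent bound of
   [2 / |b|]. *)
pose zz := c + (`|b| / 8 +i* b).
have zz0 : c0 < Re zz by rewrite /zz ReD /=; lra.
have [[S HS] bd] := half_plane_resolvent zz0.
rewrite (resolventE HS) in bd.
have nzz : `|b| <= normc (zz - c).
  have -> : zz - c = `|b| / 8 +i* b by rewrite /zz addrAC subrr add0r.
  exact: (Im_le_normc (`|b| / 8 +i* b)).
have bd2 x : nrm (S x) <= 2 / `|b| * nrm x.
  rewrite (le_trans (bd x)) // ler_wpM2r ?nrm_ge0 // ler_wpM2l //.
  by rewrite lef_pV2 ?posrE // (lt_le_trans b0).
have dz : z - zz = (a - `|b| / 8)%:C.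
  by apply: eqc; rewrite /zz /a /b !ReImE /=; ring.
have near : normc (z - zz) * (2 / `|b|) <= 2^-1.
  rewrite dz normcC mulrA ler_pdivrMr // ler0_norm; lra.
have [H1 H2] := neumann_resolvent HS bd2 near; split=> // x.
have nz : normc (z - c) <= 2 * `|b|.
  rewrite (le_trans (normc_le_ReIm _)) // -/a -/b (ler0_norm z0); lra.
rewrite (le_trans (ler_wpM2l (normc_ge0 _) (H2 x))) //.
rewrite (le_trans (ler_wpM2r _ nz)) //.
  by rewrite !mulr_ge0 ?nrm_ge0 // invr_ge0.
have -> : 2 * `|b| * (2 * (2 / `|b|) * nrm x) = 8 * nrm x; last exact: lexx.
by field; rewrite gt_eqF.
Qed.

Lemma resolvent_pseudo : pseudo_resolvent c 8 (sectorial c) (resolvent A).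
Proof.
split.
- by move=> l /sectorial_resolvent[/resolventP[[L _] _ _] _].
- by move=> l x /sectorial_resolvent[_].
- move=> l m x /sectorial_resolvent[Hl _] /sectorial_resolvent[Hm _].
  exact: resolvent_identity.
Qed.

End resolvents.

Section density.
Variables (R : realType) (X : normedModType R[i]).
Hypothesis cX : fast_complete X.
Hypothesis parallelogram : forall x y : X,
  nrm (x + y) ^+ 2 + nrm (x - y) ^+ 2 = 2 * nrm x ^+ 2 + 2 * nrm y ^+ 2.
Implicit Types x y : X.

(* Elements of almost minimal norm of the convex sets
   [{y in D | nrm y <= B, nrm (S (y - x)) <= e}] form a Cauchy sequence as [e]
   tends to 0, which converges to [x] because [S] is injective: this replaces the
   weak compactness of balls. *)
Lemma weak_approx_strong (D : set X) (S : X -> X) (N B : R) x :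
  (forall y y', D y -> D y' -> D (2^-1%:C *: (y + y'))) ->
  linear S -> (forall y, nrm (S y) <= N * nrm y) -> (forall y, S y = 0 -> y = 0) ->
  (forall e, 0 < e -> exists y, [/\ D y, nrm y <= B & nrm (S (y - x)) <= e]) ->
  forall e, 0 < e -> exists2 y, D y & nrm (y - x) <= e.
Proof.
move=> Dmid LS SN Sinj ex.
pose h : R[i] := 2^-1%:C.
have hh : h + h = 1 by rewrite /h -rmorphD -[RHS](rmorph1 (real_complex R)); congr (_%:C); lra.
have nh : normc h = 2^-1 by rewrite normcC ger0_norm // invr_ge0.
pose K (e : R) := [set y | [/\ D y, nrm y <= B & nrm (S (y - x)) <= e]].
have Ksub e e' : e <= e' -> K e `<=` K e'.
  by move=> ee y [Dy yB Sy]; split=> //; exact: le_trans ee.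
have Kmid e y y' : K e y -> K e y' -> K e (h *: (y + y')).
  move=> [Dy yB Sy] [Dy' yB' Sy']; split; first exact: Dmid.
    by rewrite nrmZ nh; have := nrmD y y'; lra.
  have -> : h *: (y + y') - x = h *: ((y - x) + (y' - x)).
    by rewrite -[X in _ - X]scale1r -hh; lmod.
  rewrite (linZ LS) (linD LS) nrmZ nh.
  by have := nrmD (S (y - x)) (S (y' - x)); lra.
pose V e := [set nrm y ^+ 2 | y in K e].
have B0 : 0 <= B by have [y [_ yB _]] := ex 1 ltr01; exact: le_trans (nrm_ge0 _) yB.
have Vinf e : 0 < e -> has_inf (V e).
  move=> e0; split; first by have [y Ky] := ex e e0; exists (nrm y ^+ 2); exists y.
  by exists 0 => _ [y _ <-]; exact: sqr_ge0.
pose m e := inf (V e).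
have m_le e y : 0 < e -> K e y -> m e <= nrm y ^+ 2.
  by move=> e0 Ky; apply: ge_inf; [exact: (Vinf e e0).2 | exists y].
(* The infima [m e] increase as [e] decreases and are bounded, so [s] is their limit as [e] tends to
   0. *)
pose W := [set m e | e in [set e : R | 0 < e]].
have Wsup : has_sup W.
  split; first by exists (m 1); exists 1 => //=.
  exists (B ^+ 2) => _ [e e0 <-]; have [y Ky] := ex e e0.
  apply: le_trans (m_le e y e0 Ky) _.
  by have [_ yB _] := Ky; rewrite ler_sqr ?nnegrE ?nrm_ge0.
pose s := sup W.
have ms e : 0 < e -> m e <= s by move=> e0; apply: sup_upper_bound => //; exists e.
pose d n : R := 2^-1 ^+ n.
have d0 n : 0 < d n by rewrite exprn_gt0 // invr_gt0.
have exE n : exists e, 0 < e /\ s - d n ^+ 2 < m e.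
  have [_ [e e0 <-] He] := sup_adherent (exprn_gt0 2 (d0 n)) Wsup.
  by exists e.
have [E HE] := choice exE.
(* Running minima make the sets [K (F n)] decrease, so that [y n] and [y n.+1] both lie in
   [K (E n)]. *)
pose F := fix F n := if n is n'.+1 then Num.min (F n') (Num.min (E n) (d n))
                     else Num.min (E 0) (d 0).
have F0 n : 0 < F n.
  by elim: n => [|n IH] /=; rewrite !lt_min ?IH d0 ?(HE _).1 // (HE 0).1.
have FE n : F n <= E n by case: n => [|n] /=; rewrite !ge_min lexx ?orbT.
have Fd n : F n <= d n by case: n => [|n] /=; rewrite !ge_min lexx ?orbT.
have FS n : F n.+1 <= F n by rewrite /= ge_min lexx.
have exy n : exists y, K (F n) y /\ nrm y ^+ 2 < s + d n ^+ 2.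
  have [_ [y Ky <-] Hy] := inf_adherent (exprn_gt0 2 (d0 n)) (Vinf _ (F0 n)).
  exists y; split=> //; apply: lt_le_trans Hy _.
  by rewrite lerD2r; exact: ms.
have [y Hy] := choice exy.
have yE n : K (E n) (y n) by apply: Ksub (FE n) _ (Hy n).1.
have yE' n : K (E n) (y n.+1).
  exact: Ksub (le_trans (FS n) (FE n)) _ (Hy n.+1).1.
(* The midpoint has squared norm above [s - d n ^ 2], the two points have theirs below
   [s + d n ^ 2]: by the parallelogram law the squared distance is at most [8 * d n ^ 2], hence the
   constant 3. *)
have [|l Hl] := cX (u := y) (C := 3).
  move=> n; rewrite -/(d n); have H1 := m_le _ _ (HE n).1 (Kmid _ _ _ (yE n) (yE' n)).
  have H2 := parallelogram (y n.+1) (y n).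
  rewrite nrmZ nh exprMn (addrC (y n)) in H1.
  have [_ H3] := HE n; have [_ H4] := Hy n; have [_ H5] := Hy n.+1.
  have H6 : d n.+1 ^+ 2 <= d n ^+ 2.
    rewrite ler_sqr ?nnegrE ?(ltW (d0 _)) // /d exprS ler_piMl ?(ltW (d0 n)) //.
    by rewrite invf_le1 // ler1n.
  rewrite -ler_sqr ?nnegrE ?nrm_ge0 ?mulr_ge0 ?(ltW (d0 n)) // exprMn.
  have := sqr_ge0 (d n); lra.
have lx : l = x.
  apply/eqP; rewrite -subr_eq0; apply/eqP/Sinj/nrm0_eq0; apply: le_nrm_eps.
  move=> e e0; rewrite add0r; have [n Hn] := half_pow_small (1 + `|N| * 6) e0.
  have -> : l - x = (y n - x) - (y n - l) by lmod.
  rewrite (linS LS) (le_trans (nrmB _ _)) //.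
  have [[_ _ H1] _] := Hy n; have H2 := Fd n.
  have H3 : nrm (S (y n - l)) <= `|N| * (2 * 3 * d n).
    rewrite (le_trans (SN _)) // (@le_trans _ _ (`|N| * nrm (y n - l))) //.
      by rewrite ler_wpM2r ?nrm_ge0 // ler_norm.
    by rewrite ler_wpM2l //; exact: Hl.
  rewrite -/(d n) in Hn; lra.
move=> e e0; have [n Hn] := half_pow_small (2 * 3) e0.
exists (y n); first by have [[]] := Hy n.
by rewrite -lx (le_trans (Hl n)).
Qed.

End density.

Section dense_domain.
Variables (R : realType) (X : normedModType R[i]) (A : unbounded_operator X).
Variable c0 : R.
Hypothesis cX : fast_complete X.
Hypothesis parallelogram : forall x y : X,
  nrm (x + y) ^+ 2 + nrm (x - y) ^+ 2 = 2 * nrm x ^+ 2 + 2 * nrm y ^+ 2.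
Let c : R[i] := c0%:C.
Hypothesis half_plane_resolvent : forall z, c0 < Re z ->
  resolvent_set A z /\ forall x, nrm (resolvent A z x) <= 2 / normc (z - c) * nrm x.

(** The injective operator is the resolvent at [c + 1]: applied to [l *: resolvent A l x - x], it
    leaves only terms in [resolvent A l x], which are [O(1 / r)] for [l = c + r]. *)
Lemma dom_dense x (e : R) : 0 < e -> exists2 y, dom A y & nrm (y - x) <= e.
Proof.
pose m : R[i] := c + 1%:C.
have Rm (r : R) : 0 < r -> resolvent_set A (c + r%:C) /\
    forall y, nrm (resolvent A (c + r%:C) y) <= 2 / r * nrm y.
  move=> r0; have [|H1 H2] := half_plane_resolvent (z := c + r%:C).
    by rewrite ReD /=; lra.
  split=> // y; have := H2 y.
  by have -> : c + r%:C - c = r%:C; [ring | rewrite normcC gtr0_norm].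
have [Hm Bm] := Rm 1 ltr01; rewrite -/m in Hm Bm.
set S := resolvent A m in Bm.
have [[LS _] _ _] := resolventP Hm; rewrite -/S in LS.
apply: (weak_approx_strong cX parallelogram (S := S) (N := 2)
  (B := 2 * (`|c0| + 1) * nrm x)) => //.
- move=> y y' Dy Dy'; rewrite -(dom_resolvent Hm Dy) -(dom_resolvent Hm Dy') -/S.
  by rewrite -(linD LS) -(linZ LS); exact: resolvent_dom.
- by move=> y; rewrite (le_trans (Bm y)) // divr1.
- by move=> y; exact: resolvent_inj Hm.
move=> eps eps0; have nx := nrm_ge0 x.
pose Q := (1 + normc m * 2) * (2 * nrm x).
have Q0 : 0 <= Q by rewrite mulr_ge0 ?mulr_ge0 // addr_ge0 // mulr_ge0 // normc_ge0.
pose r := Num.max 1 (Q / eps).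
have r1 : 1 <= r by rewrite le_max lexx.
have r0 : 0 < r := lt_le_trans ltr01 r1.
have rQ : Q / r <= eps by rewrite ler_pdivrMr // mulrC -ler_pdivrMr // le_max lexx orbT.
have [Hr Br] := Rm r r0; set l := c + r%:C in Hr Br *.
exists (l *: resolvent A l x); split.
- have [[Ll _] _ _] := resolventP Hr.
  by rewrite -(linZ Ll); exact: resolvent_dom.
- rewrite nrmZ.
  have nl : normc l <= (`|c0| + 1) * r.
    rewrite (le_trans (le_normcD _ _)) // !normcC (gtr0_norm r0) mulrDl mul1r lerD2r.
    by rewrite ler_peMr.
  rewrite (le_trans (ler_pM (normc_ge0 l) (nrm_ge0 _) nl (Br x))) //.
  rewrite le_eqVlt; apply/orP; left; apply/eqP.
  by field; rewrite lt0r_neq0.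
have -> : S (l *: resolvent A l x - x) =
    - resolvent A l x + m *: S (resolvent A l x).
  have e1 := resolvent_identity x Hm Hr; rewrite -/S in e1.
  rewrite (linS LS) (linZ LS).
  have -> : S x = resolvent A l x + (l - m) *: S (resolvent A l x).
    by rewrite -e1; lmod.
  by lmod.
rewrite (le_trans _ rQ) // (le_trans (nrmD _ _)) // nrmN nrmZ.
have b1 := Br x; have b2 := Bm (resolvent A l x).
rewrite divr1 in b2; have b3 := ler_wpM2l (normc_ge0 m) b2.
have b4 := ler_wpM2l (normc_ge0 m) b1.
have -> : Q / r = (1 + normc m * 2) * (2 / r * nrm x) by rewrite /Q; ring.
lra.
Qed.

End dense_domain.

(** * The semigroup law and the generator *)

Section time_cone.
Variable R : realType.
Implicit Types z w : R[i].

Lemma time_coneD z w : time_cone z -> time_cone w -> time_cone (z + w).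
Proof.
move=> [z0 zI] [w0 wI]; split; rewrite ReD; first exact: addr_gt0.
by rewrite ImD mulrDr (le_trans (ler_normD _ _)) // lerD.
Qed.

Lemma time_coneZ (s : R) z : 0 < s -> time_cone z -> time_cone (s%:C * z).
Proof.
move=> s0 [z0 zI]; split; rewrite ReM /= mul0r subr0; first exact: mulr_gt0.
by rewrite ImM /= mul0r addr0 normrM gtr0_norm // mulrCA ler_wpM2l // ltW.
Qed.

Lemma time_cone_real (t : R) : 0 < t -> time_cone t%:C.
Proof.
by move=> t0; split=> //=; rewrite normr0 mulr_ge0 ?(ltW t0) // divr_ge0 // ltW // slope_gt0.
Qed.

End time_cone.

Lemma deriv_on_quadratic (R : realType) (X : normedModType R[i]) (D : set R)
    (u g : R -> X) :
  (forall s, D s -> exists Q rho : R, 0 < rho /\ forall t, D t -> `|t - s| < rho ->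
    nrm (u t - u s - (t - s)%:C *: g s) <= Q * `|t - s| ^+ 2) ->
  deriv_on D u g.
Proof.
move=> H s Ds e e0; have [Q [rho [rho0 HQ]]] := H s Ds.
have Q1 : 0 < `|Q| + 1 by rewrite ltr_wpDl.
exists (Num.min rho (e / (`|Q| + 1))); first by rewrite lt_min rho0 divr_gt0.
move=> t Dt; rewrite lt_min => /andP[t1 t2].
rewrite (le_trans (HQ t Dt t1)) // expr2 mulrA ler_wpM2r //.
rewrite ltr_pdivlMr // in t2; apply: le_trans (ltW t2); rewrite mulrC ler_wpM2l //.
by rewrite (le_trans (ler_norm Q)) // lerDl.
Qed.

Ltac lmod_ops :=
  repeat match goal with
  | |- context [@sg_op ?R ?X ?c ?J ?z ?x] => move: (@sg_op R X c J z x) => ?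
  | |- context [@sg_der ?R ?X ?c ?J ?z ?x] => move: (@sg_der R X c J z x) => ?
  end; lmod.

Section generated_semigroup.
Variables (R : realType) (X : normedModType R[i]) (A : unbounded_operator X).
Variable c0 : R.
Hypothesis cX : fast_complete X.
Hypothesis parallelogram : forall x y : X,
  nrm (x + y) ^+ 2 + nrm (x - y) ^+ 2 = 2 * nrm x ^+ 2 + 2 * nrm y ^+ 2.
Let c : R[i] := c0%:C.
Hypothesis half_plane_resolvent : forall z, c0 < Re z ->
  resolvent_set A z /\ forall x, nrm (resolvent A z x) <= 2 / normc (z - c) * nrm x.
Implicit Types (z w l : R[i]) (x y : X) (s t : R).

Let J := resolvent A.
Let HJ : pseudo_resolvent c 8 (sectorial c) J.
Proof. exact: resolvent_pseudo. Qed.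
Let M0 : (0 : R) <= 8. Proof. by []. Qed.

Let m : R[i] := c + 1%:C.
Let Hm : sectorial c m.
Proof. exact: half_plane_sectorial (half_plane_real c true ltr01). Qed.
Let Rm : resolvent_set A m.
Proof. by have [] := sectorial_resolvent cX half_plane_resolvent Hm. Qed.

Local Notation sg := (sg_op c0 J).
Local Notation der := (sg_der c0 J).

Let sgB z x y : time_cone z -> sg z (x - y) = sg z x - sg z y.
Proof. by move=> zc; exact: (linS (sg_op_linear cX M0 HJ zc)). Qed.

Let sgZ z (a : R[i]) x : time_cone z -> sg z (a *: x) = a *: sg z x.
Proof. by move=> zc; exact: (linZ (sg_op_linear cX M0 HJ zc)). Qed.

Lemma sg_op_dom z x : time_cone z -> dom A (sg z x) /\ A (sg z x) = der z x.
Proof.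
move=> zc; rewrite -[sg z x](sg_derE cX M0 HJ x zc Hm); split.
  exact: resolvent_dom.
by rewrite op_resolvent // -/J (sg_derE cX M0 HJ x zc Hm); lmod.
Qed.

(** Writing [x = J m v] with [v = m *: x - A x] reduces commutation with [A] to commutation with
    [J m]. *)
Lemma sg_der_dom z x : time_cone z -> dom A x -> der z x = sg z (A x).
Proof.
move=> zc dx; have [_ <-] := sg_op_dom x zc.
have ex : J m (m *: x - A x) = x := dom_resolvent Rm dx.
have -> : A x = m *: x - (m *: x - A x) by lmod.
set v := m *: x - A x in ex *.
rewrite sgB // sgZ // -{1}ex (sg_op_J cX M0 HJ v zc Hm) op_resolvent //.
by rewrite -/J -(sg_op_J cX M0 HJ v zc Hm) ex.
Qed.

Lemma sg_op_der z w x : time_cone z -> time_cone w -> sg w (der z x) = der w (sg z x).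
Proof.
move=> zc wc; have [d e] := sg_op_dom x zc.
by rewrite (sg_der_dom wc d) e.
Qed.

Lemma sg_op_bounded_on (r : R) : exists2 N, 0 <= N &
  forall z x, time_cone z -> Re z <= r -> nrm (sg z x) <= N * nrm x.
Proof.
have [C C0 HC] := sg_op_bound cX M0 HJ.
exists (C * expR (`|c0| * `|r|)); first by rewrite mulr_ge0 ?expR_ge0.
move=> z x zc zr; rewrite (le_trans (HC z x zc)) // ler_wpM2r ?nrm_ge0 //.
rewrite ler_wpM2l // ler_expR (le_trans (ler_norm _)) // normrM ler_wpM2l //.
have [z0 _] := zc; rewrite gtr0_norm // (le_trans zr) //; exact: ler_norm.
Qed.

Lemma sg_op_continuous0 x (e : R) : 0 < e -> exists2 d, 0 < d &
  forall z, time_cone z -> normc z < d -> nrm (sg z x - x) <= e.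
Proof.
move=> e0.
have [N N0 HN] := sg_op_bounded_on 1.
have [C C0 HC] := sg_op_near cX M0 HJ.
have N1 : 0 < N + 1 by rewrite ltr_wpDl.
have e2 : 0 < e / 2 / (N + 1) by rewrite !divr_gt0.
have [y dy xy] := dom_dense cX parallelogram half_plane_resolvent x e2.
(* The vector required by [sg_op_near], as [vP] shows. *)
pose v := A y - c *: y.
have vP l : sectorial c l -> J l y - (l - c)^-1 *: y = (l - c)^-1 *: J l v.
  move=> Hl; have [Rl _] := sectorial_resolvent cX half_plane_resolvent Hl.
  have [[LJ _] _ _] := resolventP Rl.
  have lc : l - c != 0.
    by rewrite subr_eq0; apply/eqP => lc; move: Hl; rewrite lc; exact: sectorial_vertex.
  have E : (l - c) *: J l y - y = J l v.
    rewrite -{2}(dom_resolvent Rl dy) /v -/J -(linZ LJ) -(linS LJ); congr (J l _); lmod.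
  by rewrite -E scalerBr scalerA mulVf // scale1r.
pose E := expR `|c0|; have E0 : 0 <= E := expR_ge0 _.
have nv := nrm_ge0 v; have ny := nrm_ge0 y.
pose Q := C * E * nrm v + (`|c0| + 4 * `|c0| ^+ 2 * E) * nrm y.
have Q0 : 0 <= Q.
  by rewrite addr_ge0 ?mulr_ge0 // addr_ge0 // mulr_ge0 // mulr_ge0 // sqr_ge0.
have Q1 : 0 < Q + 1 by rewrite ltr_wpDl.
exists (Num.min 1 (e / 2 / (Q + 1))); first by rewrite lt_min ltr01 !divr_gt0.
move=> z zc; rewrite lt_min => /andP[z1 z2]; have [z0 _] := zc.
have nz := normc_ge0 z.
have Rez1 : Re z <= normc z := le_trans (ler_norm _) (Re_le_normc z).
have b1 : nrm (sg z (x - y)) <= N * nrm (y - x).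
  by rewrite (nrm_distC y x); apply: HN => //; exact: le_trans Rez1 (ltW z1).
have b2 : nrm (sg z y - cexp (c * z) *: y) <= C * E * nrm v * normc z.
  rewrite (le_trans (HC z y v zc vP)) //.
  have -> : C * E * nrm v * normc z = C * normc z * E * nrm v by ring.
  rewrite ler_wpM2r // ler_pM ?expR_ge0 ?mulr_ge0 ?(ltW z0) //; first by rewrite ler_wpM2l.
  rewrite ler_expR (le_trans (ler_norm _)) // normrM ler_piMr // gtr0_norm //.
  exact: le_trans Rez1 (ltW z1).
have ncz : normc (c * z) = `|c0| * normc z by rewrite Normc.normcM normcC.
have b3 : nrm (cexp (c * z) *: y - y) <= (`|c0| + 4 * `|c0| ^+ 2 * E) * nrm y * normc z.
  have -> : cexp (c * z) *: y - y = (cexp (c * z) - 1) *: y by lmod.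
  rewrite nrmZ mulrAC ler_wpM2r //.
  have := normc_distD (cexp (c * z) - 1) (c * z) 0; rewrite !subr0 => H.
  rewrite (le_trans H) // mulrDl ncz addrC lerD2l (le_trans (cexp_sub1x _)) // ncz.
  have -> : 4 * (`|c0| * normc z) ^+ 2 * expR (`|c0| * normc z) =
    4 * `|c0| ^+ 2 * expR (`|c0| * normc z) * normc z * normc z by ring.
  rewrite ler_wpM2r // -mulrA ler_wpM2l ?mulr_ge0 ?sqr_ge0 //.
  by rewrite -[leRHS]mulr1 ler_pM ?expR_ge0 ?(ltW z1) // ler_expR ler_piMr // (ltW z1).
have -> : sg z x - x = sg z (x - y) + (sg z y - cexp (c * z) *: y) +
  (cexp (c * z) *: y - y) + (y - x) by rewrite sgB //; lmod_ops.
have b4 : Q * normc z <= e / 2.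
  rewrite ltr_pdivlMr // in z2; apply: le_trans (ltW z2).
  by rewrite mulrC ler_wpM2l // lerDl.
have b5 : (N + 1) * nrm (y - x) <= e / 2 by rewrite mulrC -ler_pdivlMr.
have := nrmD (sg z (x - y) + (sg z y - cexp (c * z) *: y) + (cexp (c * z) *: y - y)) (y - x).
have := nrmD (sg z (x - y) + (sg z y - cexp (c * z) *: y)) (cexp (c * z) *: y - y).
have := nrmD (sg z (x - y)) (sg z y - cexp (c * z) *: y).
move: b4; rewrite /Q; lra.
Qed.

Lemma sg_opD z w x : time_cone z -> time_cone w -> sg (z + w) x = sg z (sg w x).
Proof.
move=> zc wc.
(* At [s = 1] the first operator would be taken at 0, outside the cone. Hence [u] is shown constant
   on [[0, b]] for [b < 1] only, and the other end is reached by strong continuity at 0. *)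
pose u s := sg ((1 - s)%:C * z) (sg (w + s%:C * z) x).
have z1 s : s < 1 -> time_cone ((1 - s)%:C * z).
  by move=> s1; apply: time_coneZ => //; rewrite subr_gt0.
have w1 s : 0 <= s -> time_cone (w + s%:C * z).
  rewrite le_eqVlt => /orP[/eqP<-|s0]; first by rewrite mul0r addr0.
  by apply: time_coneD => //; exact: time_coneZ.
have [z0 _] := zc.
have [N N0 HN] := sg_op_bounded_on (Re z).
have zRe s : 0 <= s -> Re ((1 - s)%:C * z) <= Re z.
  by move=> s0; rewrite ReM /= mul0r subr0 ler_piMl ?(ltW z0) // gerBl.
have const b : 0 <= b -> b < 1 -> u b = sg z (sg w x).
  move=> b0 b1; have -> : sg z (sg w x) = u 0.
    by rewrite /u subr0 mul1r mul0r addr0.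
  apply: mvt_const => //; apply: deriv_on_quadratic => s /andP[s0 sb].
  have s1 := le_lt_trans sb b1.
  have [C1 [r1 [C10 r10 H1]]] := sg_op_deriv cX M0 HJ (z1 s s1).
  have [C2 [r2 [C20 r20 H2]]] := sg_op_deriv cX M0 HJ (w1 s s0).
  pose y := sg (w + s%:C * z) x; pose v := der (w + s%:C * z) x.
  have nz := normc_ge0 z; have ny := nrm_ge0 y; have nv := nrm_ge0 v.
  have nx := nrm_ge0 x.
  pose L := nrm (der ((1 - s)%:C * z) v) + C1 * nrm v.
  have L0 : 0 <= L by rewrite addr_ge0 ?nrm_ge0 // mulr_ge0.
  exists (normc z ^+ 2 * (N * C2 * nrm x + L + C1 * nrm y)).
  exists (Num.min (1 / (normc z + 1)) (Num.min (r1 / (normc z + 1)) (r2 / (normc z + 1)))).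
  have nz1 : 0 < normc z + 1 by rewrite ltr_wpDl.
  split; first by rewrite !lt_min !divr_gt0.
  move=> t /andP[t0 tb]; have t1 := le_lt_trans tb b1.
  rewrite !lt_min !ltr_pdivlMr // => /and3P[ts1 ts2 ts3].
  pose h : R[i] := (t - s)%:C * z.
  have nh : normc h = `|t - s| * normc z by rewrite /h (Normc.normcM _%:C) normcC.
  have nh0 := normc_ge0 h.
  have hz : normc h <= `|t - s| * (normc z + 1) by rewrite nh ler_wpM2l // lerDl.
  have E1 : (1 - t)%:C * z = (1 - s)%:C * z - h by rewrite /h; ring.
  have E2 : w + t%:C * z = w + s%:C * z + h by rewrite /h; ring.
  have c1 := z1 t t1; have c2 := w1 t t0; rewrite E1 in c1; rewrite E2 in c2.
  have h1 : normc (- h) < r1 by rewrite normcN; exact: le_lt_trans ts2.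
  have h2 : normc h < r2 by exact: le_lt_trans ts3.
  have h3 : normc h <= 1 by exact: le_trans hz (ltW ts1).
  rewrite scaler0 subr0 /u E1 E2 -/y.
  set z1' := (1 - s)%:C * z - h in c1 *.
  have a1 := H2 h x h2 c2; rewrite -/y -/v in a1.
  have a2 := H1 (- h) y h1 c1; have a3 := H1 (- h) v h1 c1.
  rewrite normcN -/z1' in a2 a3.
  have ev := sg_op_der x (w1 s s0) (z1 s s1); rewrite -/y -/v in ev.
  (* Product rule: the terms of first order cancel by [sg_op_der], and each of the three terms left
     is quadratic in [h]. *)
  have -> : sg z1' (sg (w + s%:C * z + h) x) - sg ((1 - s)%:C * z) y =
    sg z1' (sg (w + s%:C * z + h) x - y - h *: v) +
    h *: (sg z1' v - sg ((1 - s)%:C * z) v) +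
    (sg z1' y - sg ((1 - s)%:C * z) y - - h *: der ((1 - s)%:C * z) y).
    by rewrite !sgB // sgZ // -ev; move: (h) => h'; lmod_ops.
  have b1' : nrm (sg z1' (sg (w + s%:C * z + h) x - y - h *: v)) <=
      N * (C2 * normc h ^+ 2 * nrm x).
    rewrite (le_trans (HN _ _ c1 _)) //; last by rewrite ler_wpM2l.
    by rewrite /z1' -E1; exact: zRe.
  have b2 : nrm (h *: (sg z1' v - sg ((1 - s)%:C * z) v)) <= normc h ^+ 2 * L.
    rewrite nrmZ expr2 -mulrA ler_wpM2l //.
    have := nrm_distl (sg z1' v - sg ((1 - s)%:C * z) v) (- h *: der ((1 - s)%:C * z) v).
    rewrite nrmZ normcN.
    have : C1 * nrm v * (normc h * normc h) <= C1 * nrm v * normc h.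
      by rewrite ler_wpM2l ?mulr_ge0 // ler_piMl.
    move: a3; rewrite expr2 /L; lra.
  rewrite (le_trans (nrmD _ _)) // (le_trans (lerD (nrmD _ _) (lexx _))) //.
  rewrite (le_trans (lerD (lerD b1' b2) a2)) // nh.
  by rewrite le_eqVlt; apply/orP; left; apply/eqP; ring.
apply/eqP; rewrite -subr_eq0; apply/eqP/nrm0_eq0; apply: le_nrm_eps => e e0.
rewrite add0r.
have zwc := time_coneD zc wc.
have [C [rho [C0 rho0 H]]] := sg_op_deriv cX M0 HJ zwc.
set y := sg (z + w) x.
have e2 : 0 < e / 2 by rewrite divr_gt0.
have [d d0 Hd] := sg_op_continuous0 y e2.
pose L := nrm (der (z + w) x) + C * nrm x.
have L0 : 0 <= L by rewrite addr_ge0 ?nrm_ge0 // mulr_ge0 // nrm_ge0.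
have NL : 0 < 2 * (N * L) + 1 by rewrite ltr_wpDl // !mulr_ge0.
have nz1 : 0 < normc z + 1 by rewrite ltr_wpDl // normc_ge0.
pose r := Num.min 1 (Num.min rho (Num.min d (e / (2 * (N * L) + 1)))).
have r0 : 0 < r by rewrite !lt_min ltr01 rho0 d0 divr_gt0.
pose a := r / (normc z + 1) / 2.
have a0 : 0 < a by rewrite !divr_gt0.
have a1 : a < 1.
  have : r <= 1 by rewrite ge_min lexx.
  rewrite /a ltr_pdivrMr // mul1r ltr_pdivrMr //; have := normc_ge0 z; lra.
have naz : normc (a%:C * z) < r.
  rewrite Normc.normcM normcC gtr0_norm // /a.
  have := normc_ge0 z => nz.
  have -> : r / (normc z + 1) / 2 * normc z = r * (normc z / (normc z + 1)) / 2.
    by field; rewrite gt_eqF.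
  rewrite ltr_pdivrMr // ltr_pM2l // ltr_pdivrMr //; lra.
have [r1 r2 r3 r4] : [/\ r <= 1, r <= rho, r <= d & r <= e / (2 * (N * L) + 1)].
  by split; rewrite !ge_min lexx ?orbT.
have b0 : 0 <= 1 - a by lra.
have b1 : 1 - a < 1 by lra.
rewrite -(const (1 - a) b0 b1) /u.
have -> : 1 - (1 - a) = a by ring.
have -> : w + (1 - a)%:C * z = z + w + - (a%:C * z) by ring.
have ac : time_cone (a%:C * z) by exact: time_coneZ.
have wc' : time_cone (z + w + - (a%:C * z)).
  by have := w1 (1 - a) b0; have -> : w + (1 - a)%:C * z = z + w + - (a%:C * z) by ring.
have Hna : normc (- (a%:C * z)) < rho by rewrite normcN (lt_le_trans naz).
have B := H _ x Hna wc'; rewrite normcN -/y in B.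
have Bd := Hd _ ac (lt_le_trans naz r3).
set h := a%:C * z in ac naz wc' Hna B Bd *.
set y' := sg _ x in B *.
have nh0 := normc_ge0 h.
have B1 : nrm (y' - y) <= normc h * L.
  have := nrm_distl (y' - y) (- h *: der (z + w) x); rewrite nrmZ normcN.
  have : C * nrm x * (normc h * normc h) <= C * nrm x * normc h.
    by rewrite ler_wpM2l ?mulr_ge0 ?nrm_ge0 // ler_piMl // ltW // (lt_le_trans naz).
  move: B; rewrite expr2 /L; lra.
have B2 : nrm (sg h (y' - y)) <= N * (normc h * L).
  rewrite (le_trans (HN _ _ ac _)) ?ler_wpM2l // /h ReM /= mul0r subr0.
  by rewrite ler_piMl ?(ltW z0) // ltW.
have B3 : normc h * (2 * (N * L) + 1) <= e.
  by rewrite -ler_pdivlMr // (le_trans (ltW naz)).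
have -> : y - sg h y' = - (sg h (y' - y) + (sg h y - y)) by rewrite sgB //; lmod_ops.
rewrite nrmN (le_trans (nrmD _ _)) //; lra.
Qed.

(** The derivative of [sg s x - s *: A x] is [sg s (A x) - A x], which is small near 0. It is
    available for [s > 0] only, so the mean value inequality is used on [[k, h]], with [k]
    arbitrarily small. *)
Lemma sg_op_right_deriv x (e : R) : dom A x -> 0 < e -> exists2 d, 0 < d &
  forall h, 0 < h < d -> nrm (sg h%:C x - x - h%:C *: A x) <= e * h.
Proof.
move=> dx e0; have [d d0 Hd] := sg_op_continuous0 (A x) e0; exists d => //.
move=> h /andP[h0 hd]; apply: le_nrm_eps => eps eps0.
have eps2 : 0 < eps / 2 by rewrite divr_gt0.
have [r r0 Hr] := sg_op_continuous0 x eps2.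
have nA1 : 0 < nrm (A x) + 1 by rewrite ltr_wpDl // nrm_ge0.
pose k := Num.min h (Num.min (r / 2) (eps / 2 / (nrm (A x) + 1))).
have k0 : 0 < k by rewrite !lt_min h0 !divr_gt0.
have kh : k <= h by rewrite ge_min lexx.
have kr : k < r.
  by apply: (@le_lt_trans _ _ (r / 2)); [rewrite !ge_min lexx orbT|lra].
have ke : k * nrm (A x) <= eps / 2.
  apply: (@le_trans _ _ (k * (nrm (A x) + 1))); first by rewrite ler_wpM2l ?(ltW k0) // lerDl.
  by rewrite -ler_pdivlMr // !ge_min lexx !orbT.
pose u s := sg s%:C x - s%:C *: A x.
have pos s : icc k h s -> 0 < s by move=> /andP[ks _]; exact: lt_le_trans ks.
have du : deriv_on (icc k h) u (fun s => sg s%:C (A x) - A x).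
  apply: deriv_on_quadratic => s Is.
  have sc := time_cone_real (pos s Is).
  have [C [rho [C0 rho0 H]]] := sg_op_deriv cX M0 HJ sc.
  exists (C * nrm x), rho; split=> // t It ts.
  have tc := time_cone_real (pos t It).
  have E : t%:C = s%:C + (t - s)%:C :> R[i] by ring.
  rewrite E in tc; have := H (t - s)%:C x; rewrite normcC => /(_ ts tc).
  rewrite -E (sg_der_dom sc dx) mulrAC /u => B.
  apply: le_trans B; rewrite le_eqVlt; apply/orP; left; apply/eqP; congr nrm; lmod_ops.
have ub s : icc k h s -> nrm (sg s%:C (A x) - A x) <= e.
  move=> Is; have s0 := pos s Is; apply: Hd (time_cone_real s0) _.
  have /andP[_ sh] := Is; rewrite normcC gtr0_norm //; lra.
have := mvt_le kh du ub; rewrite /u => B.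
have B2 : nrm (sg k%:C x - x) <= eps / 2.
  by apply: Hr (time_cone_real k0) _; rewrite normcC gtr0_norm.
have -> : sg h%:C x - x - h%:C *: A x =
  (sg h%:C x - h%:C *: A x - (sg k%:C x - k%:C *: A x)) + (sg k%:C x - x) +
  (- k%:C *: A x) by lmod_ops.
set a1 := sg h%:C x - _ - _ in B *.
have := nrmD (a1 + (sg k%:C x - x)) (- k%:C *: A x).
have := nrmD a1 (sg k%:C x - x).
rewrite nrmZ normcN normcC (gtr0_norm k0).
have : e * (h - k) <= e * h by rewrite ler_wpM2l ?(ltW e0) // gerBl ltW.
lra.
Qed.

(** The resolvent moves [x] into the domain, where the limit is known: the difference quotient at
    [J m x] tends both to [J m y] and to [A (J m x)]. Their equality gives
    [x = J m (m *: x - y)]. *)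
Lemma sg_op_generator x y :
  (forall e : R, 0 < e -> exists2 d, 0 < d & forall h : R, 0 < h < d ->
     nrm (h^-1%:C *: (sg h%:C x - x) - y) <= e) -> dom A x /\ A x = y.
Proof.
move=> lim; have [LJ BJ _] := HJ; have [[LR _] _ _] := resolventP Rm; rewrite -/J in LR.
have nm : normc (m - c) = 1.
  by rewrite /m addrAC subrr add0r normcC normr1.
have BR v : nrm (J m v) <= 8 * nrm v by have := BJ m v Hm; rewrite nm mul1r.
have dR := resolvent_dom x Rm; rewrite -/J in dR.
have e1 : A (J m x) = J m y.
  apply/eqP; rewrite -subr_eq0; apply/eqP/nrm0_eq0; apply: le_nrm_eps => e e0.
  rewrite add0r; have e2 : 0 < e / 16 by rewrite divr_gt0.
  have [d1 d10 H1] := lim _ e2; have [d2 d20 H2] := sg_op_right_deriv dR e2.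
  pose h := Num.min d1 d2 / 2.
  have mm : 0 < Num.min d1 d2 by rewrite lt_min d10.
  have h0 : 0 < h by rewrite divr_gt0.
  have hd1 : h < d1 by have : Num.min d1 d2 <= d1 by [rewrite ge_min lexx]; rewrite /h; lra.
  have hd2 : h < d2 by have : Num.min d1 d2 <= d2 by [rewrite ge_min lexx orbT]; rewrite /h; lra.
  have B1 := H1 h; rewrite h0 hd1 in B1; have {}B1 := B1 isT.
  have B2 := H2 h; rewrite h0 hd2 in B2; have {}B2 := B2 isT.
  have hc := time_cone_real h0.
  have hh : h^-1%:C * h%:C = 1 :> R[i].
    by rewrite -rmorphM mulVf ?gt_eqF // rmorph1.
  set g := sg h%:C x - x in B1.
  have B3 : nrm (J m (h^-1%:C *: g - y)) <= 8 * (e / 16).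
    by rewrite (le_trans (BR _)) // ler_wpM2l.
  have -> : A (J m x) - J m y = J m (h^-1%:C *: g - y) -
    h^-1%:C *: (sg h%:C (J m x) - J m x - h%:C *: A (J m x)).
    have E1 : A (J m x) = h^-1%:C *: (h%:C *: A (J m x)) by rewrite scalerA hh scale1r.
    rewrite (sg_op_J cX M0 HJ x hc Hm) (linS LR) (linZ LR) /g (linS LR) {1}E1.
    by move: (J m (sg _ x)) (J m x) (J m y) => a1 a2 a3; lmod.
  have B4 : nrm (h^-1%:C *: (sg h%:C (J m x) - J m x - h%:C *: A (J m x))) <= e / 16.
    rewrite nrmZr gtr0_norm ?invr_gt0 // mulrC ler_pdivrMr //.
  have := nrmB (J m (h^-1%:C *: g - y))
    (h^-1%:C *: (sg h%:C (J m x) - J m x - h%:C *: A (J m x))); lra.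
have ex : x = J m (m *: x - y).
  rewrite (linS LR) (linZ LR) -/J -e1 op_resolvent //; lmod.
rewrite ex; split; first exact: resolvent_dom.
by rewrite op_resolvent // -/J -ex; lmod.
Qed.

End generated_semigroup.

(** * Limits in terms of the real norm *)

Section norm_filters.
Variable R : realType.

(** Positivity for the partial order of [R[i]] includes being real, so an epsilon in [R[i]] is an
    epsilon in [R]. *)
Lemma gt0_complexE (e : R[i]) : 0 < e -> e = (Re e)%:C /\ 0 < Re e.
Proof.
rewrite ltcE /= => /andP[/eqP e0 e1]; split=> //.
by apply: eqc => //=; rewrite e0.
Qed.

Lemma cvg_nrm (X : normedModType R[i]) (T : Type) (F : set_system T) (f : T -> X) (y : X) :
  Filter F -> (f @ F --> y) <->
  (forall e : R, 0 < e -> \forall t \near F, nrm (f t - y) <= e).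
Proof.
move=> FF; split=> [/cvgrPdist_le H e e0|H].
  have e0' : 0 < e%:C :> R[i] by rewrite ltcR.
  by apply: filterS (H _ e0') => t; rewrite distrC nrmE lecR.
apply/cvgrPdist_le => e /gt0_complexE[-> e0].
by apply: filterS (H _ e0) => t; rewrite distrC nrmE lecR.
Qed.

Lemma nbhs_normcP (z : R[i]) (P : set R[i]) :
  nbhs z P <-> exists2 r : R, 0 < r & forall w, normc (w - z) < r -> P w.
Proof.
split=> [/nbhs_normP[e /gt0_complexE[-> e0] H]|[r r0 H]].
  exists (Re e) => // w wz; apply: H; rewrite /ball_ /= norm_normc ltcR.
  by rewrite -normcN opprB.
apply/nbhs_normP; exists r%:C; first by rewrite /= ltcR.
move=> w /=; rewrite norm_normc ltcR -normcN opprB; exact: H.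
Qed.

Lemma near_within (P Q : set R[i]) (r : R) : 0 < r ->
  (forall w, Q w -> normc w < r -> P w) -> within Q (nbhs (0 : R[i])) P.
Proof.
move=> r0 H; apply/nbhs_normcP; exists r => // w; rewrite subr0 => wr Qw.
exact: H.
Qed.

End norm_filters.

(** * Sectors as inequalities between real and imaginary parts *)

Section sectors_inequalities.
Variable R : realType.
Implicit Types (z c : R[i]).

Lemma abs_arg z : `|arg z| = acos (Re z / normc z).
Proof.
have q : -1 <= Re z / normc z <= 1.
  have [->|z0] := eqVneq z 0; first by rewrite /= mul0r; lra.
  have n0 : 0 < normc z by rewrite normc_gt0.
  rewrite ler_pdivrMr // ler_pdivlMr //.
  by have := Re_le_normc z; rewrite ler_norml; lra.
have a0 := acos_ge0 q.
by rewrite /arg; case: ifP => _; rewrite ?normrN ger0_norm.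
Qed.

Lemma sector_cos c (a : R) z : 0 <= a <= pi -> sector c a z ->
  z != c /\ cos a * normc (z - c) < Re (z - c).
Proof.
move=> a0 [zc]; rewrite abs_arg; set q := _ / _ => qa; split=> //.
have n0 : 0 < normc (z - c) by rewrite normc_gt0 subr_eq0.
have q1 : -1 <= q <= 1.
  rewrite /q ler_pdivrMr // ler_pdivlMr //.
  by have := Re_le_normc (z - c); rewrite ler_norml; lra.
rewrite -ltr_pdivlMr // -/q -(acosK (x := q)) ?in_itv //.
rewrite ltr_cos // in_itv //=; first by rewrite acos_ge0 ?acos_lepi.
Qed.

Lemma cos_atan_sqr (k : R) : 0 < cos (atan k) /\ cos (atan k) ^+ 2 * (1 + k ^+ 2) = 1.
Proof.
have k1 : 0 < 1 + k ^+ 2 by rewrite ltr_pwDl // sqr_ge0.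
rewrite cos_atan; split; first by rewrite invr_gt0 sqrtr_gt0.
by rewrite exprVn sqr_sqrtr ?(ltW k1) // mulVf // gt_eqF.
Qed.

Lemma atan_pos (k : R) : 0 < k -> 0 < atan k < pi / 2.
Proof. by move=> k0; rewrite atan_ltpi2 -[X in X < _]atan0 lt_atan. Qed.

Lemma cos_aperture (k : R) : cos (pi / 2 + atan k) = - (k * cos (atan k)).
Proof.
rewrite cosD cos_pihalf sin_pihalf mul0r mul1r sub0r; congr (- _).
have [c0 _] := cos_atan_sqr k.
by rewrite -{2}(atanK k) /tan divfK // gt_eqF.
Qed.

Lemma sector_time_cone z : sector 0 (atan (slope R / 2)) z ->
  [/\ z != 0, 0 < Re z & `|Im z| < slope R / 2 * Re z].
Proof.
set k := slope R / 2; have k0 : 0 < k by rewrite divr_gt0 // slope_gt0.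
have /andP[a0 a1] := atan_pos k0; have pp := pi_gt0 R.
have [p0 p1] := cos_atan_sqr k.
move=> /sector_cos[|z0]; first by apply/andP; split; lra.
rewrite !subr0 => H; have n0 : 0 < normc z by rewrite normc_gt0.
have r0 : 0 < Re z by apply: lt_trans H; exact: mulr_gt0.
split=> //; rewrite -ltr_sqr ?nnegrE ?(mulr_ge0 (ltW k0) (ltW r0)) //.
rewrite real_normK ?num_real // exprMn.
have : (cos (atan k) * normc z) ^+ 2 < Re z ^+ 2.
  by rewrite ltr_sqr ?nnegrE ?mulr_ge0 ?(ltW p0) ?(ltW n0) ?(ltW r0).
rewrite exprMn normc_sqr => H2.
have k1 : 0 < 1 + k ^+ 2 by rewrite ltr_pwDl // sqr_ge0.
have : (1 + k ^+ 2) * (cos (atan k) ^+ 2 * (Re z ^+ 2 + Im z ^+ 2)) <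
  (1 + k ^+ 2) * Re z ^+ 2 by rewrite ltr_pM2l.
rewrite mulrA (mulrC (1 + _)) p1; lra.
Qed.

(** [pi / 2 + atan slope] is the argument of [edir true], the direction of the upper edge of
    [sectorial c]. Where the real part is not positive the inequality can be squared, and
    [cos_atan_sqr] eliminates the cosine. *)
Lemma sector_sectorial c z : sector c (pi / 2 + atan (slope R)) z -> sectorial c z.
Proof.
have k0 := slope_gt0 R; set k := slope R in k0 *.
have /andP[a0 a1] := atan_pos k0; have pp := pi_gt0 R.
have [p0 p1] := cos_atan_sqr k.
move=> /sector_cos[|z0]; first by apply/andP; split; lra.
rewrite cos_aperture /sectorial /= -/k; set w := z - c => H.
have n0 : 0 < normc w by rewrite normc_gt0 subr_eq0.
have [r0|r0] := ltP 0 (Re w).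
  have : 0 <= k * `|Im w| by rewrite mulr_ge0 // ltW.
  lra.
rewrite ltrNl -ltr_sqr ?nnegrE ?oppr_ge0 ?mulr_ge0 ?(ltW k0) //.
rewrite sqrrN exprMn real_normK ?num_real //.
have : (- Re w) ^+ 2 < (k * cos (atan k) * normc w) ^+ 2.
  rewrite ltr_sqr ?nnegrE ?oppr_ge0 ?mulr_ge0 ?(ltW k0) ?(ltW p0) ?(ltW n0) //; lra.
rewrite sqrrN !exprMn normc_sqr => H2.
have k1 : 0 < 1 + k ^+ 2 by rewrite ltr_pwDl // sqr_ge0.
have : (1 + k ^+ 2) * Re w ^+ 2 <
  (1 + k ^+ 2) * (k ^+ 2 * cos (atan k) ^+ 2 * (Re w ^+ 2 + Im w ^+ 2)) by rewrite ltr_pM2l.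
have -> : (1 + k ^+ 2) * (k ^+ 2 * cos (atan k) ^+ 2 * (Re w ^+ 2 + Im w ^+ 2)) =
  k ^+ 2 * (cos (atan k) ^+ 2 * (1 + k ^+ 2)) * (Re w ^+ 2 + Im w ^+ 2) by ring.
rewrite p1; lra.
Qed.

(** [cos th + slope * sin th] is the inner product of the direction of angle [th] with
    [normal true]. Its positivity makes the distance to the edge of the half plane grow linearly in
    that direction; the sign of [cos th] keeps the exponential bounded. *)
Lemma aperture_direction (th : R) : pi / 2 < th < pi / 2 + atan (slope R) ->
  cos th < 0 /\ 0 < cos th + slope R * sin th.
Proof.
have k0 := slope_gt0 R; set k := slope R in k0 *.
have /andP[a0 a1] := atan_pos k0; have pp := pi_gt0 R.
have [p0 p1] := cos_atan_sqr k.
move=> /andP[t1 t2].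
have c0 : cos th < 0.
  by rewrite -(cos_pihalf R) ltr_cos // in_itv /=; apply/andP; split; lra.
have s0 : 0 < sin th by apply: sin_gt0_pi; apply/andP; split; lra.
have c1 : - (k * cos (atan k)) < cos th.
  by rewrite -cos_aperture ltr_cos // in_itv /=; apply/andP; split; lra.
split=> //; suff : - cos th < k * sin th by lra.
rewrite -ltr_sqr ?nnegrE ?mulr_ge0 ?(ltW k0) ?(ltW s0) //; last by rewrite oppr_ge0 ltW.
have : (- cos th) ^+ 2 < (k * cos (atan k)) ^+ 2.
  rewrite ltr_sqr ?nnegrE ?mulr_ge0 ?(ltW k0) ?(ltW p0) //; first lra.
  by rewrite oppr_ge0 ltW.
have k1 : 0 < 1 + k ^+ 2 by rewrite ltr_pwDl // sqr_ge0.
rewrite sqrrN !exprMn => H.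
have : (1 + k ^+ 2) * cos th ^+ 2 < (1 + k ^+ 2) * (k ^+ 2 * cos (atan k) ^+ 2).
  by rewrite ltr_pM2l.
have -> : (1 + k ^+ 2) * (k ^+ 2 * cos (atan k) ^+ 2) =
  k ^+ 2 * (cos (atan k) ^+ 2 * (1 + k ^+ 2)) by ring.
rewrite p1 sin2cos2; lra.
Qed.

End sectors_inequalities.

(** * The analytic semigroup and its generator *)

Section analytic_semigroup_of_generator.
Variables (R : realType) (X : normedModType R[i]) (A : unbounded_operator X).
Variable c0 : R.
Hypothesis cX : fast_complete X.
Hypothesis parallelogram : forall x y : X,
  nrm (x + y) ^+ 2 + nrm (x - y) ^+ 2 = 2 * nrm x ^+ 2 + 2 * nrm y ^+ 2.
Let c : R[i] := c0%:C.
Hypothesis half_plane_resolvent : forall z, c0 < Re z ->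
  resolvent_set A z /\ forall x, nrm (resolvent A z x) <= 2 / normc (z - c) * nrm x.

Let J := resolvent A.
Let HJ : pseudo_resolvent c 8 (sectorial c) J.
Proof. exact: resolvent_pseudo. Qed.
Let M0 : (0 : R) <= 8. Proof. by []. Qed.

(** At 0 the exponential has no decay along the rays, so the identity is put in by hand. *)
Definition semigroup_ext (z : R[i]) (x : X) : X :=
  if z == 0 then x else sg_op c0 J z x.

Definition semigroup (t : R) : X -> X := semigroup_ext t%:C.

Let delta_cone (z : R[i]) : sector 0 (atan (slope R / 2)) z -> time_cone z.
Proof. by move=> /sector_time_cone[_ z0 zI]; split=> //; exact: ltW. Qed.

Let extE (z : R[i]) : time_cone z -> semigroup_ext z = sg_op c0 J z.
Proof.
move=> [z0 _]; apply/funext => x; rewrite /semigroup_ext; case: eqP => // ze.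
by move: z0; rewrite ze ltxx.
Qed.

Let ext_bounded (z : R[i]) : time_cone z -> bounded_linear (sg_op c0 J z).
Proof.
move=> zc; apply/bounded_linearP; split; first exact: (sg_op_linear cX M0 HJ zc).
have [C _ HC] := sg_op_bound cX M0 HJ.
by exists (C * expR (c0 * Re z)) => x; exact: HC.
Qed.

Lemma semigroup_analytic : analytic_semigroup semigroup.
Proof.
have k0 := slope_gt0 R.
have k2 : 0 < slope R / 2 by rewrite divr_gt0.
exists (atan (slope R / 2)), semigroup_ext; split=> //.
  by have /andP[-> /ltW] := atan_pos k2.
split.
- move=> z [zD|->]; first by rewrite extE; [apply: ext_bounded|]; exact: delta_cone.
  apply/bounded_linearP; rewrite /semigroup_ext eqxx; split=> //.
  by exists 1 => x; rewrite mul1r.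
- move=> z zD; have zc := delta_cone zD; exists (sg_der c0 J z).
    apply/bounded_linearP; split; first exact: (sg_der_linear cX M0 HJ zc).
    by have [C _ HC] := sg_der_bound cX M0 HJ zc; exists C.
  move=> e e0; have [C [rho [C0 rho0 H]]] := sg_op_deriv cX M0 HJ zc.
  have [z0 zr zi] := sector_time_cone zD.
  (* [g] is half of the margin in the inequality of [time_cone] at [z]; together with
     [normc h < Re z], the bound [normc h < g] keeps [z + h] in the cone. *)
  pose g := (slope R / 2 * Re z - `|Im z|) / 2.
  have g0 : 0 < g by rewrite divr_gt0 // subr_gt0.
  have C1 : 0 < C + 1 by rewrite ltr_wpDl.
  pose r := Num.min rho (Num.min (Re z) (Num.min g (e / (C + 1)))).
  have r0 : 0 < r by rewrite !lt_min rho0 zr g0 divr_gt0.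
  apply: (@near_within R _ _ r r0) => h h0.
  rewrite !lt_min => /and4P[h1 h2 h3 h4] x.
  have hRe := Re_le_normc h; have hIm := Im_le_normc h.
  move: (hRe); rewrite ler_norml => /andP[hRe1 _].
  have zh : time_cone (z + h).
    split; rewrite ReD; first lra.
    rewrite ImD (le_trans (ler_normD _ _)) // mulrDr.
    have : slope R / 2 * - normc h <= slope R / 2 * Re h.
      by rewrite ler_wpM2l // ltW.
    have : slope R / 2 <= 1 by rewrite /slope; lra.
    have := normc_ge0 h; rewrite /g in h3; nra.
  rewrite !extE // !nrmE -rmorphM lecR.
  have hn0 : h != 0 by [].
  have B := H h x h1 zh.
  have nh : 0 < normc h by rewrite normc_gt0.
  have -> : h^-1 *: (sg_op c0 J (z + h) x - sg_op c0 J z x) - sg_der c0 J z x =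
    h^-1 *: (sg_op c0 J (z + h) x - sg_op c0 J z x - h *: sg_der c0 J z x).
    by rewrite [RHS]scalerBr scalerA mulVf // scale1r.
  rewrite nrmZ Normc.normcV [leLHS]mulrC ler_pdivrMr //; apply: le_trans B _.
  rewrite expr2 mulrA mulrAC ler_wpM2r ?(ltW nh) // ler_wpM2r ?nrm_ge0 //.
  rewrite ltr_pdivlMr // in h4; apply: le_trans (ltW h4).
  by rewrite mulrC ler_wpM2l ?(ltW nh) // lerDl.
- by apply/funext => x; rewrite /semigroup_ext eqxx.
- have id0 : semigroup_ext 0 = id by apply/funext => x; rewrite /semigroup_ext eqxx.
  move=> z w [zD|->]; last by rewrite add0r id0.
  move=> [wD|->]; last by rewrite addr0 id0.
  have zc := delta_cone zD; have wc := delta_cone wD.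
  have zwc := time_coneD zc wc.
  apply/funext => x /=; rewrite !extE //.
  by apply: sg_opD.
- move=> x; apply/cvg_nrm => e e0.
  have [d d0 Hd] := sg_op_continuous0 cX parallelogram half_plane_resolvent x e0.
  apply: near_within d0 _ => z zD zd; have zc := delta_cone zD.
  by rewrite extE //; exact: Hd.
Qed.

Lemma semigroup_generator : is_generator semigroup A.
Proof.
have E (h : R) : 0 < h -> semigroup h = sg_op c0 J h%:C.
  by move=> h0; rewrite /semigroup extE //; exact: time_cone_real.
move=> x y; split=> [[dx <-]|/cvg_nrm lim].
  apply/cvg_nrm => e e0.
  have [d d0 Hd] := sg_op_right_deriv cX parallelogram half_plane_resolvent dx e0.
  near=> h.
  have h0 : 0 < h by [].
  have hd : 0 < h < d by rewrite h0 /=; near: h; exact: nbhs_right_lt.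
  rewrite E //; have B := Hd h hd.
  have hh : h^-1%:C * h%:C = 1 :> R[i].
    by rewrite -rmorphM mulVf ?gt_eqF // rmorph1.
  have -> : h^-1%:C *: (sg_op c0 J h%:C x - x) - A x =
    h^-1%:C *: (sg_op c0 J h%:C x - x - h%:C *: A x).
    by rewrite [RHS]scalerBr scalerA hh scale1r.
  by rewrite nrmZr gtr0_norm ?invr_gt0 // [leLHS]mulrC ler_pdivrMr.
apply: (sg_op_generator cX parallelogram half_plane_resolvent) => e e0.
have /nbhs_normP[d /= d0 Hd] := lim _ e0; exists d => //.
move=> h /andP[h0 hd]; rewrite -E //; apply: Hd => //=.
by rewrite sub0r normrN gtr0_norm.
Unshelve. all: by end_near. Qed.

End analytic_semigroup_of_generator.

(** * Integration along arbitrary curves *)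

Section arc_integrals.
Variables (R : realType) (X : normedModType R[i]).
Implicit Types (a b d e : R) (Ga : R -> R[i]).

(** Lebesgue number of a compact segment, from the covering form of compactness applied to the right
    neighbourhoods of 0. *)
Lemma compact_gauge (P : R -> R -> Prop) a b :
  (forall t, a <= t <= b -> exists2 r, 0 < r & forall d t', 0 < d < r ->
     `|t' - t| < r -> P d t') ->
  exists2 d, 0 < d & forall t, a <= t <= b -> P d t.
Proof.
move=> loc; have /compact_near_coveringP cov := @segment_compact R a b.
have [|d0 /= d00 H] := cov R (0 : R)^'+ P _ _.
  move=> t; rewrite /= in_itv /= => /loc[r r0 Hr].
  exists ([set t' | `|t' - t| < r], [set d : R | 0 < d < r]) => /=.
    split; first by apply/nbhs_normP; exists r => //= t' /=; rewrite distrC.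
    apply/nbhs_normP; exists r => //= d /=; rewrite sub0r normrN => dr d0.
    by move: dr; rewrite gtr0_norm // => ->; rewrite d0.
  by move=> [t' d] /= [t't dr]; exact: Hr.
exists (d0 / 2); first by rewrite divr_gt0.
move=> t tab; apply: (H (d0 / 2)) => /=; rewrite ?in_itv /= ?divr_gt0 //.
by rewrite sub0r normrN gtr0_norm ?divr_gt0 //; lra.
Qed.

Lemma partition_telescope (H : R -> X) a b s : itv_partition a b s ->
  \sum_(i < size s) (H (nth b s i) - H (nth b (a :: s) i)) = H b - H a.
Proof.
elim: s a => [|t s IH] a ab.
  by rewrite big_ord0 (itv_partition_nil ab) subrr.
have tb := itv_partition_cons ab.
transitivity (H t - H a + (H b - H t)); last by lmod.
by rewrite big_ord_recl; congr (_ + _); rewrite -(IH t tb); apply: eq_bigr.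
Qed.

(** In the hypothesis [m] is independent of [l] and [l'], which absorbs the arbitrary tags of
    Riemann sums. The increments of [G] telescope, and the errors add up to a small multiple of the
    length of the arc. *)
Lemma arc_integral_primitive (Om : set R[i]) (F : R[i] -> X -> X)
    (G : X -> R[i] -> X) Ga a b :
  (forall l0, Om l0 -> forall e, 0 < e -> exists2 r, 0 < r & forall l l' m x,
     normc (l - l0) < r -> normc (l' - l0) < r -> normc (m - l0) < r ->
     nrm (G x l' - G x l - (l' - l) *: F m x) <= e * normc (l' - l) * nrm x) ->
  locally_rectifiable Ga -> (forall s, Om (Ga s)) -> a < b ->
  is_arc_integral Ga F a b (fun x => G x (Ga b) - G x (Ga a)).
Proof.
move=> loc [cG rG] GOm ab e e0; have [L HL] := rG a b ab.
have L1 : 0 < `|L| + 1 by rewrite ltr_wpDl.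
have e'0 : 0 < e / (`|L| + 1) by rewrite divr_gt0.
set e' := e / _ in e'0.
have [t _|d d0 Hd] := @compact_gauge (fun d t => forall s s' xi x,
    `|s - t| < d -> `|s' - t| < d -> `|xi - t| < d ->
    nrm (G x (Ga s') - G x (Ga s) - (Ga s' - Ga s) *: F (Ga xi) x) <=
      e' * normc (Ga s' - Ga s) * nrm x) a b.
  have [r r0 Hr] := loc _ (GOm t) _ e'0.
  have : \forall s \near t, normc (Ga s - Ga t) < r.
    have nb : nbhs (Ga t) [set w | normc (w - Ga t) < r].
      by apply/nbhs_normcP; exists r.
    exact: (cG t _ nb).
  move=> /nbhs_normP[eta /= eta0 Heta].
  exists (eta / 2); first by rewrite divr_gt0.
  move=> d t' /andP[d0 de] t't s s' xi x st s't xit.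
  have near u : `|u - t'| < d -> normc (Ga u - Ga t) < r.
    move=> ut; apply: Heta => /=; rewrite distrC.
    have := ler_normD (u - t') (t' - t); have -> : u - t' + (t' - t) = u - t by ring.
    by move: t't de ut; lra.
  by apply: Hr; exact: near.
exists d => // s xi sab mesh x.
rewrite !nrmE -rmorphM lecR -(partition_telescope (fun t => G x (Ga t)) sab).
rewrite /RS_sum -sumrB (le_trans (nrm_sum _)) //.
have step (i : 'I_(size s)) : nrm ((Ga (nth b s i) - Ga (nth b (a :: s) i)) *: F (Ga (xi i)) x -
    (G x (Ga (nth b s i)) - G x (Ga (nth b (a :: s) i)))) <=
    e' * nrm x * normc (Ga (nth b s i) - Ga (nth b (a :: s) i)).
  have [m1 /andP[m2 m3]] := mesh i (ltn_ord i).
  rewrite nrm_distC mulrAC.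
  have Iab : a <= nth b (a :: s) i <= b.
    have si : (i < (size s).+1)%N by rewrite ltnS ltnW.
    by rewrite (itv_partition_nth_ge si sab) (itv_partition_nth_le si sab).
  apply: (Hd _ Iab).
  - by rewrite subrr normr0.
  - rewrite ger0_norm // subr_ge0; exact: le_trans m3.
  - rewrite ger0_norm ?subr_ge0 //; exact: le_lt_trans (lerB m3 (lexx _)) m1.
rewrite (le_trans (ler_sum _ (fun i _ => step i))) // -mulr_sumr.
have := HL s sab.
under eq_bigr do rewrite norm_normc.
rewrite -rmorph_sum lecR => HLs.
have ne : 0 <= e' * nrm x by rewrite mulr_ge0 ?nrm_ge0 // ltW.
rewrite (le_trans (ler_wpM2l ne HLs)) // mulrAC ler_wpM2r ?nrm_ge0 //.
rewrite /e' mulrAC ler_pdivrMr // ler_wpM2l ?(ltW e0) //.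
by rewrite (le_trans (ler_norm L)) // lerDl.
Qed.

End arc_integrals.

(** * Dunford's formula along an admissible curve *)

Section dunford.
Variables (R : realType) (X : normedModType R[i]) (c0 M : R) (J : R[i] -> X -> X).
Hypothesis cX : fast_complete X.
Let c : R[i] := c0%:C.
Hypothesis M0 : 0 <= M.
Hypothesis HJ : pseudo_resolvent c M (sectorial c) J.
Variable z : R[i].
Hypothesis zc : time_cone z.
Implicit Types (l m w : R[i]) (x : X) (b : bool) (e : R).

Let F l x : X := cexp (l * z) *: J l x.
Let Gb b x l : X := ray_transform (edir R b) z (J^~ x) l.

Let Jb b : pseudo_resolvent c M (half_plane c (normal R b)) J.
Proof. exact: pseudo_resolvent_sub (@half_plane_sectorial _ c b) HJ. Qed.

Let edn b : 0 <= dot (edir R b) (normal R b).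
Proof. by rewrite edir_normal. Qed.

Let half_plane_open b l0 : half_plane c (normal R b) l0 ->
  exists d r : R, [/\ 0 < d, 0 < r & forall l, normc (l - l0) < r ->
    half_plane c (normal R b) l /\ d <= normc (l - c)].
Proof.
move=> H0; have /andP[n0 n2] := normc_normal R b.
have [d0 _] := half_plane_dist H0.
set d := _ / _ in d0.
exists (d / 2), (d / 2); rewrite divr_gt0 //; split=> // l ll0.
have dE : dot (l0 - c) (normal R b) = d * normc (normal R b) by rewrite divfK // gt_eqF.
have dl : d / 2 <= dot (l - c) (normal R b) / normc (normal R b).
  rewrite ler_pdivlMr //; have -> : l - c = (l0 - c) + (l - l0) by ring.
  rewrite dotDl dE.
  have := dot_le (- (l - l0)) (normal R b); rewrite normcN.
  have -> : dot (- (l - l0)) (normal R b) = - dot (l - l0) (normal R b).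
    by rewrite /dot !ReImE; ring.
  have : normc (l - l0) * normc (normal R b) <= d / 2 * normc (normal R b).
    by rewrite ler_wpM2r // ltW.
  lra.
have Hl : half_plane c (normal R b) l.
  have : 0 < dot (l - c) (normal R b) / normc (normal R b).
    by rewrite (lt_le_trans _ dl) // divr_gt0.
  by rewrite pmulr_lgt0 // invr_gt0.
by split=> //; exact: le_trans dl (half_plane_dist Hl).2.
Qed.

Let F_continuous b l0 e : half_plane c (normal R b) l0 -> 0 < e ->
  exists2 r, 0 < r & forall l, normc (l - l0) < r -> half_plane c (normal R b) l /\
    forall x, nrm (F l x - F l0 x) <= e * nrm x.
Proof.
move=> H0 e0; have [d [r [d0 r0 Hr]]] := half_plane_open H0.
pose m := M / d; have m0 : 0 <= m by rewrite divr_ge0 // ltW.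
pose E := expR (Re (l0 * z)); have E0 : 0 <= E := expR_ge0 _.
pose Q := E * ((normc z + 4 * normc z ^+ 2 * expR (normc z)) * m + m * m).
have nz := normc_ge0 z.
have Q00 : 0 <= normc z + 4 * normc z ^+ 2 * expR (normc z).
  by rewrite addr_ge0 // mulr_ge0 ?expR_ge0 // mulr_ge0 // sqr_ge0.
have Q0 : 0 <= Q by rewrite mulr_ge0 // addr_ge0 // mulr_ge0.
have Q1 : 0 < Q + 1 by rewrite ltr_wpDl.
exists (Num.min r (Num.min 1 (e / (Q + 1)))); first by rewrite !lt_min r0 ltr01 divr_gt0.
move=> l; rewrite !lt_min => /and3P[h1 h2 h3].
have [Hl dl] := Hr l h1; split=> // x.
have dl0 : d <= normc (l0 - c).
  have l00 : normc (l0 - l0) < r by rewrite subrr Normc.normc0.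
  by have [] := Hr l0 l00.
pose h := l - l0; rewrite -/h in h1 h2 h3.
have nh := normc_ge0 h; have nx := nrm_ge0 x.
have El : cexp (l * z) = cexp (l0 * z) * cexp (h * z).
  by rewrite -cexpD /h; congr cexp; ring.
have -> : F l x - F l0 x = cexp (l0 * z) *:
    ((cexp (h * z) - 1) *: J l x + (J l x - J l0 x)) by rewrite /F El; lmod.
have [_ _ RJ] := Jb b; rewrite (RJ l l0 x Hl H0).
have Bl y : nrm (J l y) <= m * nrm y by have := pr_bound (Jb b) y Hl d0 dl.
have Bl0 y : nrm (J l0 y) <= m * nrm y by have := pr_bound (Jb b) y H0 d0 dl0.
rewrite nrmZ (normc_cexp (l0 * z)) -/E.
have t1 : nrm ((cexp (h * z) - 1) *: J l x) <=
    normc h * (normc z + 4 * normc z ^+ 2 * expR (normc z)) * (m * nrm x).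
  rewrite nrmZ ler_pM ?normc_ge0 ?nrm_ge0 //.
  have := normc_distD (cexp (h * z) - 1) (h * z) 0; rewrite !subr0 => H.
  have hz : normc (h * z) <= normc z by rewrite Normc.normcM ler_piMl // ltW.
  rewrite (le_trans H) // mulrDr addrC (Normc.normcM h z) lerD2l.
  rewrite (le_trans (cexp_sub1x _)) // (Normc.normcM h z).
  have ee : expR (normc h * normc z) <= expR (normc z) by rewrite ler_expR -Normc.normcM.
  have -> : 4 * (normc h * normc z) ^+ 2 * expR (normc h * normc z) =
    normc h * (4 * normc z ^+ 2 * (normc h * expR (normc h * normc z))) by ring.
  rewrite ler_wpM2l // ler_wpM2l ?mulr_ge0 ?sqr_ge0 //.
  by rewrite (le_trans _ ee) // ler_piMl ?expR_ge0 // ltW.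
have t2 : nrm ((l0 - l) *: J l (J l0 x)) <= normc h * (m * (m * nrm x)).
  rewrite nrmZ -normcN opprB -/h ler_wpM2l // (le_trans (Bl _)) // ler_wpM2l //.
rewrite (le_trans (ler_wpM2l E0 (le_trans (nrmD _ _) (lerD t1 t2)))) //.
have -> : E * (normc h * (normc z + 4 * normc z ^+ 2 * expR (normc z)) * (m * nrm x) +
  normc h * (m * (m * nrm x))) = Q * normc h * nrm x by rewrite /Q; ring.
rewrite ltr_pdivlMr // in h3; rewrite ler_wpM2r //; apply: le_trans (ltW h3).
by rewrite mulrC ler_wpM2l // lerDl.
Qed.

(** Mean value inequality on the segment from [l] to [l'], which stays in the ball around [l0],
    where the integrand differs little from its value at [m]. *)
Let Gb_primitive b l0 e : half_plane c (normal R b) l0 -> 0 < e ->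
  exists2 r, 0 < r & forall l l' m x,
    normc (l - l0) < r -> normc (l' - l0) < r -> normc (m - l0) < r ->
    nrm (Gb b x l' - Gb b x l - (l' - l) *: F m x) <= e * normc (l' - l) * nrm x.
Proof.
move=> H0 e0; have e2 : 0 < e / 2 by rewrite divr_gt0.
have [r r0 Hr] := F_continuous H0 e2; exists r => // l l' m x hl hl' hm.
have [Hl _] := Hr l hl; have [Hl' _] := Hr l' hl'.
pose p (s : R) := l + s%:C * (l' - l).
pose u (s : R) := Gb b x (p s) - s%:C *: ((l' - l) *: F m x).
pose g (s : R) := (l' - l) *: (F (p s) x - F m x).
have du : deriv_on (icc 0 1) u g.
  have D := ray_transform_segment cX x (Jb b) M0 (edn b) (edir_time_lt0 b zc) Hl Hl'.
  move=> s Is eps eps0; have [d d0 Hd] := D s Is eps eps0; exists d => // t It td.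
  have := Hd t It td; rewrite -/(p t) -/(p s) -/(Gb b x _) -/(Gb b x _) -/(F (p s) x).
  rewrite /u /g; move: (Gb b x (p t)) (Gb b x (p s)) (F (p s) x) (F m x) => a1 a2 f1 f2.
  by have -> : a1 - t%:C *: ((l' - l) *: f2) - (a2 - s%:C *: ((l' - l) *: f2)) -
    (t - s)%:C *: ((l' - l) *: (f1 - f2)) = a1 - a2 - (t - s)%:C *: ((l' - l) *: f1) by lmod.
have gb s : icc 0 1 s -> nrm (g s) <= e * normc (l' - l) * nrm x.
  move=> /andP[s0 s1]; rewrite nrmZ mulrAC mulrC ler_wpM2r ?normc_ge0 //.
  have hp : normc (p s - l0) < r.
    have -> : p s - l0 = (1 - s)%:C * (l - l0) + s%:C * (l' - l0) by rewrite /p; ring.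
    apply: le_lt_trans (le_normcD _ _) _.
    rewrite !Normc.normcM !normcC (ger0_norm s0) ger0_norm ?subr_ge0 //.
    have [->|s00] := eqVneq s 0; first by rewrite mul0r addr0 subr0 mul1r.
    have sp : 0 < s by rewrite lt_neqAle eq_sym s00.
    have : s * normc (l' - l0) < s * r by rewrite ltr_pM2l.
    have : (1 - s) * normc (l - l0) <= (1 - s) * r by rewrite ler_wpM2l ?subr_ge0 // ltW.
    lra.
  have [_ /(_ x) h1] := Hr _ hp; have [_ /(_ x) h2] := Hr _ hm.
  have := nrm_distD (F (p s) x) (F l0 x) (F m x); rewrite (nrm_distC (F l0 x)); lra.
have := mvt_le ler01 du gb; rewrite subr0 mulr1 /u /p.
have -> : l + 1%:C * (l' - l) = l' by rewrite rmorph1; ring.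
have -> : l + 0%:C * (l' - l) = l by rewrite rmorph0; ring.
move: (Gb b x l') (Gb b x l) (F m x) => a1 a2 f.
have -> : a1 - 1%:C *: ((l' - l) *: f) - (a2 - 0%:C *: ((l' - l) *: f)) =
  a1 - a2 - (l' - l) *: f by rewrite rmorph1 rmorph0; lmod.
exact.
Qed.

(** By [contour_jump], this is [- 2 pi i] times the contour integral that defines the semigroup. *)
Let jump x : X := Gb true x (c + 1%:C) - Gb false x (c + 1%:C).

Let Gb_jump x l : half_plane c (normal R true) l -> half_plane c (normal R false) l ->
  Gb true x l = Gb false x l + jump x.
Proof.
move=> H1 H2.
have := ray_transform_diff cX x (Jb true) (Jb false) M0 (edn true) (edn false)
  (edir_time_lt0 true zc) (edir_time_lt0 false zc)
  (half_plane_real c true ltr01) (half_plane_real c false ltr01) H1 H2.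
rewrite -/(Gb true x _) -/(Gb false x _) -/(Gb true x l) -/(Gb false x l) -/(jump x).
by move=> <-; rewrite addrC subrK.
Qed.

(* The primitive of the integrand that vanishes at infinity in the upper half
   plane; it tends to [jump x] at infinity in the lower one. *)
Definition dunford_primitive x l : X :=
  if 0 <= Im l then Gb true x l else Gb false x l + jump x.

Let Imc l : Im (l - c) = Im l. Proof. by rewrite ImD /= oppr0 addr0. Qed.

Lemma dunford_primitiveP l0 e : sectorial c l0 -> 0 < e ->
  exists2 r, 0 < r & forall l l' m x,
    normc (l - l0) < r -> normc (l' - l0) < r -> normc (m - l0) < r ->
    nrm (dunford_primitive x l' - dunford_primitive x l -
      (l' - l) *: (cexp (m * z) *: J m x)) <= e * normc (l' - l) * nrm x.
Proof.
move=> H0 e0.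
have Imd l : `|Im l - Im l0| <= normc (l - l0) by have := Im_le_normc (l - l0); rewrite ImD ImN.
have HT : 0 <= Im l0 -> half_plane c (normal R true) l0.
  move=> i0; rewrite half_plane_normalE Imc; move: H0.
  by rewrite /sectorial /= Imc ger0_norm // /sgn; lra.
have HF : Im l0 <= 0 -> half_plane c (normal R false) l0.
  move=> i0; rewrite half_plane_normalE Imc; move: H0.
  by rewrite /sectorial /= Imc ler0_norm // /sgn; lra.
have [i0|i0|i0] := ltgtP (Im l0) 0.
- have [r r0 Hr] := Gb_primitive (HF (ltW i0)) e0.
  exists (Num.min r (- Im l0)); first by rewrite lt_min r0 oppr_gt0.
  move=> l l' m x; rewrite !lt_min => /andP[l1 l2] /andP[l1' l2'] /andP[m1 _].
  have neg w : normc (w - l0) < - Im l0 -> (0 <= Im w) = false.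
    move=> wl; apply/negbTE; rewrite -ltNge; have := Imd w; rewrite ler_norml; lra.
  rewrite /dunford_primitive !neg //.
  have -> : Gb false x l' + jump x - (Gb false x l + jump x) =
    Gb false x l' - Gb false x l by rewrite opprD addrACA subrr addr0.
  exact: Hr.
- have [r r0 Hr] := Gb_primitive (HT (ltW i0)) e0.
  exists (Num.min r (Im l0)); first by rewrite lt_min r0.
  move=> l l' m x; rewrite !lt_min => /andP[l1 l2] /andP[l1' l2'] /andP[m1 _].
  have pos w : normc (w - l0) < Im l0 -> 0 <= Im w.
    by move=> wl; have := Imd w; rewrite ler_norml; lra.
  by rewrite /dunford_primitive !pos //; exact: Hr.
(* Both branches of the definition occur near a real [l0]; it lies in both half planes, where
   [Gb_jump] identifies the two formulas. *)
have Ht : half_plane c (normal R true) l0 by apply: HT; rewrite i0.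
have Hf : half_plane c (normal R false) l0 by apply: HF; rewrite i0.
have [r r0 Hr] := Gb_primitive Ht e0.
have [dt [rt [_ rt0 Ot]]] := half_plane_open Ht.
have [df [rf [_ rf0 Of]]] := half_plane_open Hf.
exists (Num.min r (Num.min rt rf)); first by rewrite !lt_min r0 rt0.
move=> l l' m x; rewrite !lt_min => /and3P[l1 l2 l3] /and3P[l1' l2' l3'] /and3P[m1 _ _].
have eqT w : normc (w - l0) < rt -> normc (w - l0) < rf ->
    dunford_primitive x w = Gb true x w.
  move=> /Ot[H1 _] /Of[H2 _]; rewrite /dunford_primitive; case: ifP => // _.
  by rewrite -Gb_jump.
by rewrite !eqT //; exact: Hr.
Qed.

(** Along the tail of the curve the distance to the edge of the half plane is at least a fixed
    multiple of [normc g], so that [J] is [O(1 / normc g)] on the ray issued from [g]. The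
    exponential is at most 1 because [z] is real and positive and [Re g <= 0]. *)
Lemma ray_transform_tail b (th t e : R) : z = t%:C -> 0 < e ->
  cos th < 0 -> 0 < cos th + slope R * sin th ->
  exists n0 eta : R, 0 < eta /\ forall g : R[i], n0 <= normc g ->
    normc (g / `|g| - (cos th +i* (sgn R b * sin th))) <= eta ->
    0 < sgn R b * Im g /\ forall x, nrm (Gb b x g) <= e * nrm x.
Proof.
move=> zE e0 cth; set k := slope R; set q := cos th + k * sin th => q0.
have k0 : 0 < k := slope_gt0 R.
have k1 : k <= 1 by rewrite /k /slope; lra.
have s0 : 0 < sin th.
  have : 0 < k * sin th by move: q0; rewrite /q; lra.
  by rewrite pmulr_rgt0.
have [z0 _] := zc.
have g0 : 0 < k / 2 * Re z by rewrite mulr_gt0 // divr_gt0.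
pose K := 16 * M / q / (k / 2 * Re z).
have K0 : 0 <= K by rewrite /K divr_ge0 ?(ltW g0) // divr_ge0 ?(ltW q0) // mulr_ge0.
(* In the radius, [4 * |c0| / q] makes the shift by [c0] harmless and [K / e] yields the final
   bound. In the tolerance, [- cos th] fixes the sign of [Re g], [sin th / 2] that of [Im g], and
   [q / 4] preserves half of [q]. *)
exists (1 + 4 * `|c0| / q + K / e), (Num.min (- cos th) (Num.min (sin th / 2) (q / 4))).
split; first by rewrite !lt_min oppr_gt0 cth !divr_gt0.
move=> g ng; rewrite !le_min norm_normc => /and3P[h1 h2 h3].
set n := normc g in ng h1 h2 h3.
have cq0 : 0 <= 4 * `|c0| / q by rewrite divr_ge0 ?mulr_ge0 // ltW.
have Ke0 : 0 <= K / e by rewrite divr_ge0 // ltW.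
have n0 : 0 < n by lra.
pose p := g / n%:C; rewrite -/p in h1 h2 h3.
have gE : g = n%:C * p.
  rewrite /p mulrCA divff ?mulr1 //; apply/eqP => /(congr1 Re) /= ne.
  by move: n0; rewrite ne ltxx.
have Rg : Re g = n * Re p by rewrite {1}gE ReM /= mul0r subr0.
have Ig : Im g = n * Im p by rewrite {1}gE ImM /= mul0r addr0.
set dl := normc _ in h1 h2 h3.
have Rp : `|Re p - cos th| <= dl.
  by have := Re_le_normc (p - (cos th +i* (sgn R b * sin th))); rewrite ReD /=.
have Ip : `|sgn R b * Im p - sin th| <= dl.
  have -> : sgn R b * Im p - sin th = sgn R b * (Im p - sgn R b * sin th).
    by rewrite mulrBr mulrA sgn_sqr mul1r.
  rewrite normrM (_ : `|sgn R b| = 1) ?mul1r.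
    by have := Im_le_normc (p - (cos th +i* (sgn R b * sin th))); rewrite ImD /=.
  by case: (b); rewrite /sgn ?normrN normr1.
move: Rp Ip; rewrite !ler_norml => /andP[Rp1 Rp2] /andP[Ip1 Ip2].
have sI : 0 < sgn R b * Im p by lra.
have split_ : 0 < sgn R b * Im g by rewrite Ig mulrCA mulr_gt0.
split=> // x.
have qp : q / 2 <= Re p + k * (sgn R b * Im p).
  have : k * (sin th - dl) <= k * (sgn R b * Im p) by rewrite ler_wpM2l ?(ltW k0) //; lra.
  have : k * dl <= dl by rewrite ler_piMl // normc_ge0.
  by rewrite /q in h3 *; lra.
have nq : 4 * `|c0| <= n * q by rewrite -ler_pdivrMr //; lra.
have dot_g : n * q / 4 <= dot (g - c) (normal R b).
  have -> : dot (g - c) (normal R b) = n * (Re p + k * (sgn R b * Im p)) - c0.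
    rewrite /dot (ReD g) (ImD g) ReN ImN /= Rg Ig -/k.
    by move: (Re p) (Im p) (sgn R b) => rp ip sb; ring.
  have : n * (q / 2) <= n * (Re p + k * (sgn R b * Im p)) by rewrite ler_wpM2l // ltW.
  by have := ler_norm c0; lra.
have nq0 : 0 < n * q by rewrite mulr_gt0.
have Hg : half_plane c (normal R b) g by rewrite /half_plane /=; lra.
pose d := n * q / 8; have d0 : 0 < d by rewrite divr_gt0.
have dd : d <= dot (g - c) (normal R b) / normc (normal R b).
  have /andP[v0 v2] := normc_normal R b; rewrite ler_pdivlMr //.
  have : d * normc (normal R b) <= d * 2 by rewrite ler_wpM2l // ltW.
  by rewrite /d; lra.
have qQ s : 0 <= s -> nrm (J (g + s%:C * edir R b) x) <= M / d * nrm x.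
  move=> s00; have [Hs ds] := half_plane_ray (edn b) s00 Hg.
  by have := pr_bound (Jb b) x Hs d0 (le_trans dd ds).
have ex : exists I, ray_int (fun s : R => cexp ((g + s%:C * edir R b) * z) *:
    J (g + s%:C * edir R b) x) I.
  by eexists; have := pr_ray_int cX (Jb b) M0 (edn b) (edir_time_lt0 b zc) x Hg; exact.
have := @edir_transform_bound R X b z (J^~ x) g _ zc qQ ex.
rewrite -/(Gb b x g) => B; apply: le_trans B _.
have E1 : expR (Re (g * z)) <= 1.
  rewrite -[leRHS]expR0 ler_expR zE ReM /= mulr0 subr0 Rg.
  rewrite mulr_le0_ge0 //; last by move: z0; rewrite zE /=; exact: ltW.
  by rewrite mulr_ge0_le0 ?(ltW n0) //; lra.
have nx := nrm_ge0 x.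
have Q0 : 0 <= M / d * nrm x by rewrite mulr_ge0 // divr_ge0 // ltW.
apply: (@le_trans _ _ (2 * (M / d * nrm x / (k / 2 * Re z)))).
  rewrite ler_wpM2l // ler_wpM2r ?invr_ge0 ?(ltW g0) // ler_piMr //.
have -> : 2 * (M / d * nrm x / (k / 2 * Re z)) = K / n * nrm x.
  by rewrite /K /d; field; rewrite !lt0r_neq0.
rewrite ler_wpM2r // ler_pdivrMr // mulrC -ler_pdivrMr //; lra.
Qed.

(** The primitive tends, in operator norm, to [jump] at the lower end of the curve and to 0 at the
    upper end. *)
Lemma dunford_curve_integral (Ga : R -> R[i]) (th t : R) : z = t%:C ->
  cos th < 0 -> 0 < cos th + slope R * sin th ->
  locally_rectifiable Ga -> joins_infinity Ga (- th) th ->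
  (forall s, sectorial c (Ga s)) ->
  is_curve_integral Ga (fun l x => cexp (l * z) *: J l x) (fun x => - jump x).
Proof.
move=> zE cth q0 rG [n1 a1 n2 a2] GO.
exists (fun (a b : R) x => dunford_primitive x (Ga b) - dunford_primitive x (Ga a)); split.
  move=> a b ab; apply: arc_integral_primitive GO ab => //.
  by move=> l0 H0 eps; exact: dunford_primitiveP.
move=> e e0; have e2 : 0 < e / 2 by rewrite divr_gt0.
have [N1 [eta1 [eta10 T1]]] := ray_transform_tail false zE e2 cth q0.
have [N2 [eta2 [eta20 T2]]] := ray_transform_tail true zE e2 cth q0.
have dir (Fi : set_system R) (FF : Filter Fi) (q : R[i]) (eta : R) : 0 < eta ->
    Ga s / `|Ga s| @[s --> Fi] --> q ->
    \forall s \near Fi, normc (Ga s / `|Ga s| - q) <= eta.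
  move=> eta0 /cvgrPdist_le H; have e10 : 0 < eta%:C :> R[i] by rewrite ltcR.
  by apply: filterS (H _ e10) => s; rewrite distrC norm_normc lecR.
have A1 : \forall a \near -oo, forall x,
    nrm (dunford_primitive x (Ga a) - jump x) <= e / 2 * nrm x.
  move/cvgryPge: n1 => n1.
  apply: filterS2 (n1 N1) (dir _ _ _ _ eta10 a1) => a ha; rewrite cosN sinN.
  have -> : cos th +i* - sin th = cos th +i* (sgn R false * sin th) by rewrite /sgn mulN1r.
  move=> /(T1 _ ha)[]; rewrite /sgn mulN1r oppr_gt0 => im H x.
  rewrite /dunford_primitive ifF; last by apply/negbTE; rewrite -ltNge.
  by rewrite addrK; exact: H.
have A2 : \forall b \near +oo, forall x,
    nrm (dunford_primitive x (Ga b)) <= e / 2 * nrm x.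
  move/cvgryPge: n2 => n2.
  apply: filterS2 (n2 N2) (dir _ _ _ _ eta20 a2) => a ha.
  have -> : cos th +i* sin th = cos th +i* (sgn R true * sin th) by rewrite /sgn mul1r.
  move=> /(T2 _ ha)[]; rewrite /sgn mul1r => im H x.
  by rewrite /dunford_primitive ifT ?(ltW im) //; exact: H.
exists ([set a | forall x, nrm (dunford_primitive x (Ga a) - jump x) <= e / 2 * nrm x],
        [set b | forall x, nrm (dunford_primitive x (Ga b)) <= e / 2 * nrm x]) => //=.
move=> [a b] /= [ha hb] x; rewrite !nrmE -rmorphM lecR.
have -> : dunford_primitive x (Ga b) - dunford_primitive x (Ga a) - - jump x =
  dunford_primitive x (Ga b) - (dunford_primitive x (Ga a) - jump x) by lmod.
by have := nrmB (dunford_primitive x (Ga b)) (dunford_primitive x (Ga a) - jump x);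
  have := ha x; have := hb x; lra.
Qed.

Lemma contour_jump x : contour z (J^~ x) (c + 1%:C) = (0 +i* (2 * pi))^-1 *: (- jump x).
Proof. by rewrite /contour /jump /Gb opprB. Qed.

End dunford.

(** * The space L^2 *)

Section square_integrable.
Variable R : realType.
Local Notation mu := (@lebesgue_measure R).
Local Open Scope quotient_scope.
Implicit Types (f g : R -> R[i]) (u v : L2 R).

Definition sqnorm f (x : R) : \bar R := (normc (f x) ^+ 2)%:E.

Definition cmeasurable f : Prop :=
  measurable_fun setT (Re \o f) /\ measurable_fun setT (Im \o f).

Lemma sqint_cmeasurable f : f \in @sqint R -> cmeasurable f.
Proof. by move=> /andP[/Lfun_meas ? /Lfun_meas ?]. Qed.

Lemma measurable_sqnorm f : cmeasurable f -> measurable_fun setT (sqnorm f).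
Proof.
move=> [mr mi]; apply/measurable_EFinP.
rewrite (_ : (fun x => _) = (fun x => (Re \o f) x ^+ 2 + (Im \o f) x ^+ 2)).
  by apply: measurable_funD; apply: measurable_funX.
by apply/funext => x; rewrite normc_sqr.
Qed.

Lemma sqnorm_ge0 f x : (0 <= sqnorm f x)%E.
Proof. by rewrite lee_fin sqr_ge0. Qed.

Lemma norm2_sqr f : f \in @sqint R ->
  ((norm2 f ^+ 2)%:E = \int[mu]_x sqnorm f x)%E.
Proof.
move=> fL; have n0 : 0 <= norm2 f.
  by rewrite -lee_fin norm2E // Lnorm_ge0.
rewrite -powR_mulrn // -poweR_EFin norm2E // powR_Lnorm //.
apply: eq_integral => x _ /=.
by rewrite ger0_norm ?normc_ge0 // powR_mulrn ?normc_ge0.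
Qed.

Lemma Lfun2_bounded (h : R -> R) f : measurable_fun setT h -> cmeasurable f ->
  (forall x, h x ^+ 2 <= normc (f x) ^+ 2) -> (\int[mu]_x sqnorm f x < +oo)%E ->
  h \in Lfun mu 2%:E.
Proof.
move=> mh mf hf If; apply/andP; split; rewrite inE //=.
rewrite /finite_norm unlock /= poweR_lty //.
apply: le_lt_trans If; apply: ge0_le_integral => //.
- apply/measurable_EFinP; apply: (measurableT_comp (measurable_powR _)).
  exact: measurableT_comp.
- exact: measurable_sqnorm.
move=> x _ /=; rewrite lee_fin powR_mulrn //.
by rewrite real_normK ?num_real.
Qed.

Lemma sqint_finite f : cmeasurable f -> (\int[mu]_x sqnorm f x < +oo)%E ->
  f \in @sqint R.
Proof.
move=> mf If; have [mr mi] := mf; apply/andP; split.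
  by apply: Lfun2_bounded mr mf _ If => x /=; rewrite normc_sqr lerDl sqr_ge0.
by apply: Lfun2_bounded mi mf _ If => x /=; rewrite normc_sqr lerDr sqr_ge0.
Qed.

Lemma nrm_pi (w : sqfun R) : nrm (\pi_(L2 R) w : L2 R) = norm2 w.
Proof.
apply: complexI; rewrite -nrmE; exact: norm_pi.
Qed.

Lemma L2_repr u : \pi_(L2 R) (repr u) = u. Proof. exact: reprK. Qed.

Lemma piB (w w' : sqfun R) : \pi_(L2 R) (w - w') = \pi_(L2 R) w - \pi_(L2 R) w'.
Proof. by rewrite !piE. Qed.

Lemma L2_parallelogram u v :
  nrm (u + v) ^+ 2 + nrm (u - v) ^+ 2 = 2 * nrm u ^+ 2 + 2 * nrm v ^+ 2.
Proof.
rewrite -(L2_repr u) -(L2_repr v) -piB -piD !nrm_pi.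
set f := repr u; set g := repr v.
have fL := sqfunP f; have gL := sqfunP g.
have sL := sqfunP (f + g); have dL := sqfunP (f - g).
have m w : measurable_fun setT (sqnorm (sqfun_val w)).
  exact: measurable_sqnorm (sqint_cmeasurable (sqfunP w)).
apply: EFin_inj; rewrite !EFinD (EFinM 2 (norm2 f ^+ 2)).
rewrite (EFinM 2 (norm2 g ^+ 2)) !norm2_sqr //.
have s0 (w : sqfun R) : forall x, setT x -> (0 <= sqnorm w x)%E.
  by move=> x _; exact: sqnorm_ge0.
have I2 (w : sqfun R) : (2%:E * \int[mu]_x sqnorm w x = \int[mu]_x (2%:E * sqnorm w x))%E.
  by rewrite (@ge0_integralZl _ _ _ mu setT measurableT (sqnorm w) (m w) 2%:E (s0 w)).
have s2 (w : sqfun R) : forall x, setT x -> (0 <= 2%:E * sqnorm w x)%E.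
  by move=> x _; rewrite mule_ge0 // sqnorm_ge0.
have m2 (w : sqfun R) : measurable_fun setT (fun x => 2%:E * sqnorm w x)%E.
  exact: measurable_funeM.
transitivity (\int[mu]_x (sqnorm (sqfun_val (f + g)%R) x + sqnorm (sqfun_val (f - g)%R) x))%E.
  by rewrite (@ge0_integralD _ _ _ mu setT measurableT _ _ (s0 (f + g)) (m (f + g))
    (s0 (f - g)) (m (f - g))).
transitivity (\int[mu]_x (2%:E * sqnorm f x + 2%:E * sqnorm g x))%E; last first.
  by rewrite !I2 (@ge0_integralD _ _ _ mu setT measurableT _ _ (s2 f) (m2 f) (s2 g) (m2 g)).
apply: eq_integral => x _; rewrite /sqnorm -!EFinM -!EFinD; congr (_%:E).
rewrite !normc_sqr.
have -> : sqfun_val (f + g) x = f x + g x by [].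
have -> : sqfun_val (f - g) x = f x - g x by [].
by rewrite !ReImE; ring.
Qed.

End square_integrable.

(** * Completeness of L^2 *)

Section L2_completeness.
Variable R : realType.
Local Notation mu := (@lebesgue_measure R).
Local Open Scope quotient_scope.

Lemma geometric_cvg (v : R^nat) (S : R) :
  (forall k, `|v k.+1 - v k| <= S * (2 / 3) ^+ k) -> cvgn v.
Proof.
move=> vS; have S0 : 0 <= S.
  by have := le_trans (normr_ge0 _) (vS 0%N); rewrite expr0 mulr1.
have q1 : `|2 / 3 : R| < 1 by rewrite ger0_norm; lra.
have cs : cvgn (series (telescope v)).
  apply: normed_cvg.
  have g0 n : 0 <= geometric S (2 / 3) n.
    by rewrite /= mulr_ge0 // exprn_ge0 // divr_ge0.
  exact: (series_le_cvg (fun n => normr_ge0 _) g0 vS (is_cvg_geometric_series q1)).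
have -> : v = (fun n => v 0%N + series (telescope v) n).
  by apply/funext => n; exact: eq_sum_telescope.
by apply: is_cvgD => //; exact: is_cvg_cst.
Qed.

Lemma limn_einf_le (w : (\bar R)^nat) (b : \bar R) :
  (forall n, (w n <= b)%E) -> (limn_einf w <= b)%E.
Proof.
move=> wb; rewrite limn_einf_lim; apply: lime_le; first exact: is_cvg_einfs.
apply: nearW => n; apply: le_trans (wb n).
by apply: ereal_inf_lbound; exists n => //=.
Qed.

Lemma limn_einf_ge0 (w : (\bar R)^nat) :
  (forall n, (0 <= w n)%E) -> (0 <= limn_einf w)%E.
Proof.
move=> w0; rewrite limn_einf_lim; apply: lime_ge; first exact: is_cvg_einfs.
by apply: nearW => n; apply: le_ereal_inf_tmp => _ [m /= _ <-].
Qed.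

Variables (u : nat -> L2 R) (C : R).
Hypothesis uC : forall n, nrm (u n.+1 - u n) <= C * 2^-1 ^+ n.

Let C0 : 0 <= C.
Proof. by have := le_trans (nrm_ge0 _) (uC 0%N); rewrite expr0 mulr1. Qed.

Let bound_ge0 n : 0 <= 2 * C * 2^-1 ^+ n.
Proof. by rewrite mulr_ge0 ?exprn_ge0 ?invr_ge0 // mulr_ge0. Qed.

Lemma fast_cauchy n m : nrm (u (m + n)%N - u n) <= 2 * C * 2^-1 ^+ n.
Proof.
(* The factor [1 - 2^-1 ^ m] keeps the exact partial geometric sum, as the induction requires. *)
suff : nrm (u (m + n)%N - u n) <= 2 * C * 2^-1 ^+ n * (1 - 2^-1 ^+ m).
  by move=> H; apply: le_trans H _; rewrite ler_piMr ?bound_ge0 // gerBl exprn_ge0 // invr_ge0.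
elim: m => [|m IH]; first by rewrite add0n subrr nrm0 expr0 subrr mulr0.
have := nrm_distD (u (m.+1 + n)%N) (u (m + n)%N) (u n).
have := uC (m + n)%N; rewrite addSn exprD [2^-1 ^+ m.+1]exprS.
move: (2^-1 ^+ m) (2^-1 ^+ n) IH => a b; lra.
Qed.

Let f n : R -> R[i] := sqfun_val (repr (u n)).
Let D n m : sqfun R := repr (u n) - repr (u m).

Let normD n m : norm2 (D n m) = nrm (u n - u m).
Proof. by rewrite -nrm_pi piB !L2_repr. Qed.

Let DE n m x : D n m x = f n x - f m x. Proof. by []. Qed.

Let mD n m : measurable_fun setT (sqnorm (D n m)).
Proof. exact: measurable_sqnorm (sqint_cmeasurable (sqfunP (D n m))). Qed.

(* The integral of the weighted sum [h] is at most [C ^ 2] times the sum of the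
   [(9 / 16) ^ k]; where [h] is finite, [f k.+1 - f k] is [O((2 / 3) ^ k)]. *)
Let weight k : R := (9 / 4) ^+ k.
Let weight_ge0 k : 0 <= weight k.
Proof. by rewrite exprn_ge0 // divr_ge0. Qed.
Let weight_sqr k (a b : R) : 9 / 4 * a ^+ 2 = b -> weight k * (a ^+ k) ^+ 2 = b ^+ k.
Proof. by move=> <-; rewrite exprMn -!exprM mulnC. Qed.

Let h x : \bar R := (\sum_(0 <= k <oo) ((weight k)%:E * sqnorm (D k.+1 k) x))%E.

Let term_ge0 k x : (0 <= (weight k)%:E * sqnorm (D k.+1 k) x)%E.
Proof. by rewrite mule_ge0 ?sqnorm_ge0 // lee_fin. Qed.

Let term_meas k : measurable_fun setT (fun x => (weight k)%:E * sqnorm (D k.+1 k) x)%E.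
Proof. by apply: measurable_funeM; exact: mD. Qed.

Let h_fin : {ae mu, forall x, h x \is a fin_num}.
Proof.
have mh : measurable_fun setT h.
  by apply: ge0_emeasurable_sum => // k x _; exact: term_ge0.
have h0 x : (0 <= h x)%E by apply: nneseries_ge0 => k _ _; exact: term_ge0.
have Ih : (\int[mu]_x h x < +oo)%E.
  rewrite (@integral_nneseries _ _ R mu setT measurableT _ term_meas (fun k x _ => term_ge0 k x)).
  (* [16 / 7] is the sum of the geometric series of ratio [9 / 16]. *)
  apply: (@le_lt_trans _ _ ((C ^+ 2 * (16 / 7))%:E)); last exact: ltry.
  apply: lime_le.
    apply: is_cvg_nneseries => k _ _; apply: integral_ge0 => x _; exact: term_ge0.
  apply: nearW => n.
  have E k : (\int[mu]_x ((weight k)%:E * sqnorm (D k.+1 k) x) =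
      (weight k * norm2 (D k.+1 k) ^+ 2)%:E)%E.
    rewrite (@ge0_integralZl _ _ _ mu setT measurableT _ (mD k.+1 k)) ?lee_fin //.
      by rewrite -norm2_sqr ?sqfunP // EFinM.
    by move=> x _; exact: sqnorm_ge0.
  rewrite (eq_bigr _ (fun k _ => E k)) sumEFin lee_fin.
  have B k : weight k * norm2 (D k.+1 k) ^+ 2 <= C ^+ 2 * (9 / 16) ^+ k.
    have -> : C ^+ 2 * (9 / 16) ^+ k = weight k * (C * 2^-1 ^+ k) ^+ 2.
      rewrite -(@weight_sqr k 2^-1 (9 / 16)); last by field.
      by ring.
    have b0 : 0 <= C * 2^-1 ^+ k by rewrite mulr_ge0 // exprn_ge0 // invr_ge0.
    by rewrite ler_wpM2l // normD ler_sqr ?nnegrE ?nrm_ge0.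
  apply: le_trans (ler_sum _ (fun k _ => B k)) _.
  rewrite -mulr_sumr ler_wpM2l ?sqr_ge0 //.
  suff : \sum_(0 <= k < n) (9 / 16 : R) ^+ k <= 16 / 7 * (1 - (9 / 16) ^+ n).
    have p0 : 0 <= (9 / 16 : R) ^+ n by rewrite exprn_ge0 // divr_ge0.
    by move=> H; apply: le_trans H _; move: p0; move: (_ ^+ n) => a; lra.
  elim: n => [|n IH]; first by rewrite big_geq // expr0 subrr mulr0.
  by rewrite big_nat_recr //= exprS; move: ((9 / 16) ^+ n) IH => a; lra.
have int_h : mu.-integrable setT h.
  apply/integrableP; split=> //.
  by under eq_integral => x _ do rewrite gee0_abs //.
have := integrable_ae measurableT int_h.
by apply: (@filterS _ _ (ae_filter_ringOfSetsType mu)) => x /(_ I).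
Qed.

Let step_bound x : h x \is a fin_num ->
  exists S, forall k, normc (f k.+1 x - f k x) <= S * (2 / 3) ^+ k.
Proof.
(* [H + 1] stands in for the square root of [H], since [H <= (H + 1) ^ 2]. *)
move=> hx; pose H := fine (h x); exists (H + 1) => k.
have H0 : 0 <= H by apply: fine_ge0; apply: nneseries_ge0 => j _ _; exact: term_ge0.
have : ((weight k)%:E * sqnorm (D k.+1 k) x <= h x)%E.
  have := @nneseries_lim_ge R (fun k => (weight k)%:E * sqnorm (D k.+1 k) x)%E xpredT 0 k.+1.
  move=> /(_ (fun j _ _ => term_ge0 j x)); apply: le_trans.
  rewrite big_nat_recr //= leeDr //.
  by apply: sume_ge0 => j _; exact: term_ge0.
rewrite -(fineK hx) -/H /sqnorm -EFinM lee_fin DE => B.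
have q0 : 0 <= (2 / 3 : R) ^+ k by rewrite exprn_ge0 // divr_ge0.
rewrite -ler_sqr ?nnegrE ?normc_ge0 ?mulr_ge0 // ?addr_ge0 // exprMn.
have wq : weight k * ((2 / 3) ^+ k) ^+ 2 = 1.
  by rewrite -[RHS](expr1n _ k); apply: weight_sqr; field.
have w0 : 0 < weight k by rewrite exprn_gt0 // divr_gt0.
rewrite -(ler_pM2l w0) (le_trans B) // mulrCA wq mulr1.
by nra.
Qed.

(** An upper limit is measurable whether or not the sequence converges; [fine] supplies a default
    value where it is infinite, which happens at most on a null set. *)
Let fr x : R := fine (limn_esup (fun n => (Re (f n x))%:E)).
Let fi x : R := fine (limn_esup (fun n => (Im (f n x))%:E)).
Let F x : R[i] := fr x +i* fi x.

Let F_meas : cmeasurable F.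
Proof.
have mf n : cmeasurable (f n) by exact: sqint_cmeasurable (sqfunP _).
split; apply: (measurableT_comp (fine_measurable measurableT));
  apply: measurable_fun_limn_esup => n; apply/measurable_EFinP.
- by have [] := mf n.
- by have [] := mf n.
Qed.

Let F_lim x : h x \is a fin_num ->
  (Re (f n x) @[n --> \oo] --> Re (F x)) /\ (Im (f n x) @[n --> \oo] --> Im (F x)).
Proof.
move=> /step_bound[S HS].
have lim (v : R^nat) : cvgn v -> v n @[n --> \oo] --> fine (limn_esup (fun n => (v n)%:E)).
  move=> cv; have e : (v n)%:E @[n --> \oo] --> (limn v)%:E by apply: cvg_EFin => //; exact: nearW.
  by have [_ ->] := cvg_limn_einf_sup e.
split; apply: lim; apply: (@geometric_cvg _ S) => k; apply: le_trans (HS k).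
- have := Re_le_normc (f k.+1 x - f k x); by rewrite ReD ReN.
- have := Im_le_normc (f k.+1 x - f k x); by rewrite ImD ImN.
Qed.

Let Fn_meas n : cmeasurable (fun x => F x - f n x).
Proof.
have [fm1 fm2] : cmeasurable (f n) by exact: sqint_cmeasurable (sqfunP _).
have [F1 F2] := F_meas; split.
  rewrite (_ : _ \o _ = (Re \o F) \- (Re \o f n)); first exact: measurable_funB.
  by apply/funext => x; rewrite /= ReD ReN.
rewrite (_ : _ \o _ = (Im \o F) \- (Im \o f n)); first exact: measurable_funB.
by apply/funext => x; rewrite /= ImD ImN.
Qed.

(** Fatou's lemma, for [m] tending to infinity in [f (m + n) - f n], whose norms [fast_cauchy]
    bounds. It gives at once the square integrability of the limit and the rate of convergence. *)
Let F_bound n : (\int[mu]_x sqnorm (fun x => (F x - f n x)%R) x <=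
  ((2 * C * 2^-1 ^+ n) ^+ 2)%:E)%E.
Proof.
have ae_lim : {ae mu, forall x, sqnorm (fun x => F x - f n x) x =
    limn_einf (fun m => sqnorm (D (m + n) n) x)}.
  apply: (@filterS _ _ (ae_filter_ringOfSetsType mu) _ _ _ h_fin) => x /F_lim[HR HI].
  apply/esym; apply: (cvg_limn_einf_sup _).1.
  apply: cvg_EFin; first exact: nearW.
  have shift (v : R^nat) (l : R) : v m @[m --> \oo] --> l -> v (m + n)%N @[m --> \oo] --> l.
    by move=> H; rewrite (cvg_shiftn n v (nbhs l)).
  have := shift _ _ HR; have := shift _ _ HI => {}HI {}HR.
  rewrite normc_sqr ReD ImD ReN ImN.
  rewrite (_ : _ \o _ = (fun m => (Re (f (m + n)%N x) - Re (f n x)) ^+ 2 +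
     (Im (f (m + n)%N x) - Im (f n x)) ^+ 2)); last first.
    apply/funext => m; rewrite -[LHS]/(normc (f (m + n)%N x - f n x) ^+ 2).
    by rewrite normc_sqr ReD ImD ReN ImN.
  by rewrite /= !expr2; apply: cvgD; apply: cvgM; (apply: cvgB; [|exact: cvg_cst]).
have meas : measurable_fun setT (fun x => limn_einf (fun m => sqnorm (D (m + n) n) x)).
  rewrite (_ : (fun x => _) = (fun x => - limn_esup (fun m => - sqnorm (D (m + n) n) x))%E).
    apply: measurableT_comp => //; apply: measurable_fun_limn_esup => m.
    by apply: measurableT_comp => //; exact: mD.
  apply/funext => x; rewrite -[RHS]limn_einfN; congr limn_einf.
  by apply/funext => m; exact: (esym (oppeK _)).
have -> : (\int[mu]_x sqnorm (fun x => (F x - f n x)%R) x =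
    \int[mu]_x limn_einf (fun m => sqnorm (D (m + n) n) x))%E.
  apply: ge0_ae_eq_integral => //.
  - exact: measurable_sqnorm (Fn_meas n).
  - by move=> x _; exact: sqnorm_ge0.
  - by move=> x _; apply: limn_einf_ge0 => m; exact: sqnorm_ge0.
  by apply: (@filterS _ _ (ae_filter_ringOfSetsType mu) _ _ _ ae_lim) => x.
have fatou_D := @fatou _ _ R mu setT measurableT (fun m => sqnorm (D (m + n) n))
  (fun m => mD (m + n) n) (fun m x _ => sqnorm_ge0 _ x).
apply: le_trans fatou_D _; apply: limn_einf_le => m.
rewrite -norm2_sqr ?sqfunP // lee_fin normD.
by rewrite ler_sqr ?nnegrE ?nrm_ge0 ?bound_ge0 // fast_cauchy.
Qed.

Lemma L2_fast_limit : exists l : L2 R, forall n, nrm (u n - l) <= 2 * C * 2^-1 ^+ n.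
Proof.
have FnL n : (fun x => F x - f n x) \in @sqint R.
  apply: sqint_finite (Fn_meas n) _; apply: le_lt_trans (F_bound n) _; exact: ltry.
have FL : F \in @sqint R.
  rewrite (_ : F = (fun x => F x - f 0%N x) + f 0%N).
    by apply: rpredD; [exact: FnL | exact: sqfunP].
  by apply/funext => x; rewrite -[RHS]/(F x - f 0%N x + f 0%N x) subrK.
exists (\pi_(L2 R) (Sqfun FL)) => n.
rewrite nrm_distC -[u n]L2_repr -piB nrm_pi.
rewrite -ler_sqr ?nnegrE ?bound_ge0 //; last first.
  by rewrite -nrm_pi nrm_ge0.
by rewrite -lee_fin norm2_sqr ?sqfunP //; exact: F_bound.
Qed.

End L2_completeness.

Lemma L2_fast_complete (R : realType) : fast_complete (L2 R).
Proof. by move=> u C uC; exact: L2_fast_limit uC. Qed.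

(** * The semigroup of the linearized operator *)

Theorem corollary5p2 (R : realType) (D f phi : R -> R) (alpha eta0 : R)
  (hD : nagumo_diffusion D)
  (halpha : 0 < alpha < 1)
  (hf : nagumo_reaction f alpha)
  (hDf : \int[lebesgue_measure]_(u in `[0, 1]) (D u * f u) = 0)
  (hphi : stationary_front D f phi)
  (heta0 : 0 < eta0)
  (hrho : forall z : R[i], eta0 < complex.Re z ->
     resolvent_set (linearized_operator D f phi) z /\
     forall u : L2 R,
       `|resolvent (linearized_operator D f phi) z u|
         <= 2 / `|z - eta0%:C| * `|u|) :
  exists T : R -> L2 R -> L2 R,
    [/\ analytic_semigroup T,
        is_generator T (linearized_operator D f phi) &
        exists2 delta : R, 0 < delta &
          sector eta0%:C (pi / 2 + delta)
            `<=` resolvent_set (linearized_operator D f phi) /\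
          forall theta : R, pi / 2 < theta < pi / 2 + delta ->
          forall Gamma : R -> R[i],
            locally_rectifiable Gamma ->
            joins_infinity Gamma (- theta) theta ->
            (forall s : R, sector eta0%:C theta (Gamma s)) ->
          forall t : R, 0 < t ->
            is_dunford_integral (linearized_operator D f phi) Gamma t (T t)].
Proof.
have cX := @L2_fast_complete R.
have par := @L2_parallelogram R.
move: (linearized_operator D f phi) hrho => A hrho.
have hp z : eta0 < Re z -> resolvent_set A z /\
    forall x, nrm (resolvent A z x) <= 2 / normc (z - eta0%:C) * nrm x.
  move=> /hrho[rz bz]; split=> // x; have := bz x.
  rewrite norm_normc !nrmE -[2 in X in X -> _](rmorph_nat (@real_complex R)).
  by rewrite -fmorphV -!rmorphM lecR.
have HJ := resolvent_pseudo cX hp.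
exists (semigroup A eta0); split.
- exact: semigroup_analytic.
- exact: semigroup_generator.
(* The aperture beyond [pi / 2] of the region [sectorial], to which the resolvent extends. *)
exists (atan (slope R)); first by have /andP[] := atan_pos (slope_gt0 R).
split=> [z /sector_sectorial zs|th thb Ga rG jG GS t t0].
  by have [] := sectorial_resolvent cX hp zs.
have [cth qth] := aperture_direction thb.
have tc := time_cone_real t0.
have GO s : sectorial eta0%:C (Ga s).
  apply: sector_sectorial; have [gs ls] := GS s; split=> //.
  by apply: lt_trans ls _; have /andP[] := thb.
have M0 : 0 <= 8 :> R by [].
have H := dunford_curve_integral cX M0 HJ tc erefl cth qth rG jG GO.
eexists; first exact: H.
(* As [t > 0], the extension takes its contour branch and not the value put in at 0. *)
move=> x; rewrite -contour_jump /semigroup /semigroup_ext ifF //.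
by apply/negbTE; rewrite (inj_eq (@complexI R)) gt_eqF.
Qed.
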